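(* Let $n\ge1$ and let $F\in C^1((\overline{B}_1\setminus\{0\})\times\mathbb{R}\times\mathbb{R}^n\times\mathcal{S}^{n\times n})$ be such that the matrix $\left(\frac{\partial F}{\partial M_{ij}}(x,s,p,M)\right)$ is positive definite for all $(x,s,p,M)\in(\overline{B}_1\setminus\{0\})\times\mathbb{R}\times\mathbb{R}^n\times\mathcal{S}^{n\times n}$. Assume that for all $x\in B_1$ with $0<x_1<1$, all $\hat x_1$ with $-1<\hat x_1\le x_1$, $x_1+\hat x_1>0$ and $(\hat x_1,x_2,\dots,x_n)\neq0$, and all $s\in\mathbb{R}$, $p\in\mathbb{R}^n$, $M\in\mathcal{S}^{n\times n}$, $$F(\hat x_1,x_2,\dots,x_n,s,\hat p,\widehat M)\ge F(x_1,x_2,\dots,x_n,s,p,M).$$ Assume that $u\in C^2(\overline{B}_1\setminus\{0\})$ satisfies, for some $0<\bar r\le 1$: for every $V\in\mathbb{R}^n$, the function $w(x):=u(x)+V\cdot x$ satisfies $\inf_{B_r\setminus\{0\}}w=\min_{\partial B_r}w$ for all $0<r<\bar r$. Assume also $$F(x,u,\nabla u,\nabla^2u)=0,\quad u>0\qquad\text{in }B_1\setminus\{0\},$$ and $u=0$ on $\partial B_1$. Then $$\frac{\partial u}{\partial x_1}(x)<0\qquad\text{for all }x\in B_1\text{ with }0<x_1<1.$$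
   Context: $B_r$ is the open ball of radius $r$ centered at the origin of $\mathbb{R}^n$. $\mathcal{S}^{n\times n}$ is the set of real symmetric $n\times n$ matrices. For $p=(p_1,\dots,p_n)\in\mathbb{R}^n$ put $\hat p:=(-p_1,p_2,\dots,p_n)$. For $M=(M_{ij})\in\mathcal{S}^{n\times n}$, $\widehat M=(\widehat M_{ij})$ is given by $\widehat M_{1j}=-M_{1j}$ for $2\le j\le n$, $\widehat M_{i1}=-M_{i1}$ for $2\le i\le n$, $\widehat M_{11}=M_{11}$, and $\widehat M_{ij}=M_{ij}$ for $2\le i,j\le n$. *)

(* Defs.v *)
From HB Require Import structures.
From mathcomp Require Import all_boot all_order all_algebra.
From mathcomp Require Import all_classical all_reals all_analysis.

Set Implicit Arguments.
Unset Strict Implicit.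
Unset Printing Implicit Defensive.

Import Order.TTheory GRing.Theory Num.Theory.
Import numFieldNormedType.Exports.

Local Open Scope classical_set_scope.
Local Open Scope ring_scope.

(* R^n with n >= 1 is 'rV[R]_n.+1, and the coordinate x_1 is x 0 0.  The norm
   of the library on 'rV[R]_n.+1 is the sup norm, so the Euclidean norm and its
   balls are defined here; the topology is the same. *)
Section Euclidean.
Variables (R : realType) (n : nat).
Implicit Types (x y : 'rV[R]_n.+1) (r : R).

Definition edot x y : R := \sum_i x 0 i * y 0 i.
Definition enorm x : R := Num.sqrt (edot x x).

Definition eball r : set 'rV[R]_n.+1 := [set x | enorm x < r].
Definition ecball r : set 'rV[R]_n.+1 := [set x | enorm x <= r].
Definition esphere r : set 'rV[R]_n.+1 := [set x | enorm x = r].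

End Euclidean.
Arguments eball {R n} r.
Arguments ecball {R n} r.
Arguments esphere {R n} r.

(* f is C^k on D, where O is the interior of D relative to the linear subspace
   W (for D contained in W and in the closure of O): f and its derivatives up
   to order k, taken in O along directions of W, extend continuously to D. *)
Fixpoint Ck_on (R : realType) (E : normedModType R) (W O D : set E) (k : nat)
    (f : E -> R) : Prop :=
  {within D, continuous f} /\
  if k is k'.+1 then
    forall v, W v ->
      (forall a, O a -> derivable f a v) /\
      exists2 g : E -> R,
        Ck_on W O D k' g & forall a, O a -> g a = 'D_v f a
  else True.

Section Calculus.
Variables (R : realType) (n : nat).
Implicit Types (x p : 'rV[R]_n.+1) (M : 'M[R]_n.+1).

Definition partial (i : 'I_n.+1) (u : 'rV[R]_n.+1 -> R) x : R :=
  'D_(delta_mx 0 i) u x.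

Definition gradient (u : 'rV[R]_n.+1 -> R) x : 'rV[R]_n.+1 :=
  \row_i partial i u x.

Definition hessian (u : 'rV[R]_n.+1 -> R) x : 'M[R]_n.+1 :=
  \matrix_(i, j) partial i (partial j u) x.

Definition C2_on_punctured_cball (u : 'rV[R]_n.+1 -> R) : Prop :=
  Ck_on setT (eball 1 `\ 0) (ecball 1 `\ 0) 2 u.

(* A function of (x, s, p, M) with M symmetric is represented by a function on
   all square matrices; only its values at symmetric M are ever used. *)
Definition symmx : set 'M[R]_n.+1 := [set M | M^T = M].

Definition jets (A : set 'rV[R]_n.+1) :
    set ('rV[R]_n.+1 * R * 'rV[R]_n.+1 * 'M[R]_n.+1) :=
  [set a | A a.1.1.1 /\ symmx a.2].

Definition C1_on_jets (F : 'rV[R]_n.+1 -> R -> 'rV[R]_n.+1 -> 'M[R]_n.+1 -> R) :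
    Prop :=
  Ck_on (jets setT) (jets (eball 1 `\ 0)) (jets (ecball 1 `\ 0)) 1
    (fun a => F a.1.1.1 a.1.1.2 a.1.2 a.2).

(* The matrix (dF/dM_ij) on the space of symmetric matrices, i.e. the symmetric
   matrix A with dF(M)[N] = \sum_(i, j) A i j * N i j for all symmetric N; the
   entry A i j is the derivative along the symmetric part of delta_mx i j. *)
Definition dsym (G : 'M[R]_n.+1 -> R) M : 'M[R]_n.+1 :=
  \matrix_(i, j) 'D_(2^-1 *: (delta_mx i j + delta_mx j i)) G M.

Definition posdefmx M : Prop :=
  M^T = M /\ forall v : 'rV[R]_n.+1, v != 0 -> 0 < (v *m M *m v^T) 0 0.

Definition set_x1 x (t : R) : 'rV[R]_n.+1 :=
  \row_i (if i == 0 then t else x 0 i).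

Definition hatv p : 'rV[R]_n.+1 :=
  \row_i (if i == 0 then - p 0 i else p 0 i).

Definition hatmx M : 'M[R]_n.+1 :=
  \matrix_(i, j) (if (i == 0) (+) (j == 0) then - M i j else M i j).

(* inf_A w = min_B w, the minimum being attained; the infimum is taken in the
   extended reals. *)
Definition inf_eq_min (A B : set 'rV[R]_n.+1) (w : 'rV[R]_n.+1 -> R) : Prop :=
  exists m : R,
    [/\ (w @` B) m, lbound (w @` B) m
      & ereal_inf [set (w x)%:E | x in A] = m%:E].

End Calculus.

(* Main.v *)
(* Moving planes.  Let [x^l] be the reflection of [x] in the hyperplane
   [x_1 = l].  By the hypothesis on [F], [u(x^l)] is a supersolution of the
   equation solved by [u], and the claim is that [u(x) <= u(x^l)] in the cap
   [x_1 > l], for every [0 < l < 1]; Hopf's lemma on [x_1 = l] then gives the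
   sign of the derivative.  The planes move from [l = 1] down to [l = 0]: the
   plane can be moved further because the inequality is strict in the cap and
   because, near the plane, a maximum principle holds in narrow strips.

   The jets of [u] may blow up at the origin, so the equation is only ever
   linearized around the jets of [u] at [x], which are bounded in the cap: test
   functions [u + g] with explicit [g] touch [u(x^l)] from below.

   The delicate point is the reflection [z] of the origin.  Hopf's lemma in
   balls touching [z] shows that the difference grows at least linearly away
   from [z] in every direction.  If the lower limit of [u] at the origin were
   [u(z)], the hypothesis on [u + V.x], with [V] minus the gradient of
   [u(x^l)] at the origin, would contradict this linear growth. *)
Require Import Defs.
From HB Require Import structures.
From mathcomp Require Import all_boot all_order all_algebra.
From mathcomp Require Import all_classical all_reals all_analysis.
From mathcomp Require Import ring lra.
Import Order.TTheory GRing.Theory Num.Theory.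
Import numFieldNormedType.Exports.
Local Open Scope classical_set_scope.
Local Open Scope ring_scope.

(** * Directional derivatives along lines and planes *)

(** Strictness in a cap is obtained along rays parallel to the first axis. Such a ray leaves the
    ball at a point where [u] vanishes while [u] is positive near the reflected point, and Hopf
    barriers in small balls carry the strict inequality back along the ray. The one obstacle is a
    ray that runs into [z]: in dimension at least two a small step off the axis avoids it, but on
    the line the points before [z] are reached only through [z] itself, after strictness there has
    been deduced from the points beyond it.

    The linear growth at [z] is decisive for a quantitative reason: on a sphere of radius [r] about
    the origin, [u + V.x] exceeds [u(z)] by a multiple of [r], since the Taylor remainder at [z] is
    [o(r)]. The hypothesis carries this excess inside the sphere, and [V.x] tends to 0 at the
    origin, so the lower limit of [u] there is above [u(z)].

    As [F] is only [C^1], linearizing means the mean value theorem between two jets. Its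
    coefficients are controlled on compact sets of jets, whence the scaling of every test function
    to a jet of size at most 1. *)

Section Lines.
Context {R : realType} {E : normedModType R}.
Implicit Types (f : E -> R) (a v A B : E).

Lemma is_derive_line f a v (t : R) :
  derivable f (a + t *: v) v ->
  is_derive t 1 (fun s : R => f (a + s *: v)) ('D_v f (a + t *: v)).
Proof.
move=> df.
have e : (fun h : R => h^-1 *:
    (((fun s : R => f (a + s *: v)) \o shift t) (h *: 1) - f (a + t *: v))) =
  (fun h : R => h^-1 *: ((f \o shift (a + t *: v)) (h *: v) - f (a + t *: v))).
  apply/funext => h /=; congr (_ *: (f _ - _)).
  by rewrite /shift /= [h *: 1]mulr1 scalerDl addrCA.
by split; [rewrite /derivable e|rewrite /derive e].
Qed.

Lemma MVT_line f a v (t : R) :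
  (forall s : R, 0 <= s <= 1 -> derivable f (a + (s * t) *: v) v) ->
  exists2 s : R, 0 <= s <= 1 & f (a + t *: v) - f a = t * 'D_v f (a + (s * t) *: v).
Proof.
move=> df.
pose g (s : R) := f (a + (s * t) *: v).
have dg (s : R) : 0 <= s <= 1 -> is_derive s (1:R) g (t * 'D_v f (a + (s * t) *: v)).
  move=> s01; rewrite mulrC.
  have := @is_derive_line f a v (s * t) (df s s01).
  have h : is_derive s (1:R) (fun s : R => s * t) t.
    have := @is_deriveZ _ _ _ (@id R) t s 1 1 _.
    have -> : t \*: @id R = (fun s : R => s * t).
      by apply/funext => x /=; rewrite mulrC.
    by rewrite [t *: 1]mulr1; apply.
  by move=> h1; exact: (@is_derive1_comp _ _ _ s _ _ h1 h).
have [||s s01] := @MVT_segment _ g (fun s => t * 'D_v f (a + (s * t) *: v)) 0 1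
    ler01.
- by move=> x; rewrite in_itv /= => /andP[x0 x1]; apply: dg; rewrite !ltW.
- apply: derivable_within_continuous => x; rewrite in_itv /= => x01.
  by have [] := dg x x01.
rewrite /g mul1r mul0r scale0r addr0 subr0 mulr1 => e.
by exists s => //; move: s01; rewrite in_itv.
Qed.

(** Only points of the plane through [a] spanned by [A] and [B] enter, so that the calculus below
    also covers functions differentiable only along a subspace, as [F] is along symmetric
    matrices. *)
Definition near_plane (P : E -> Prop) a A B :=
  exists2 d : R, 0 < d &
    forall s t : R, `|s| < d -> `|t| < d -> P (a + s *: A + t *: B).

Lemma near_planeI {P Q : E -> Prop} {a A B} : near_plane P a A B ->
  near_plane Q a A B -> near_plane (fun x => P x /\ Q x) a A B.
Proof.
move=> [d d0 H] [d' d'0 H']; exists (Num.min d d').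
  by rewrite lt_min d0.
by move=> s t; rewrite !lt_min => /andP[s1 s2] /andP[t1 t2]; split;
  [apply: H|apply: H'].
Qed.

Lemma near_planeC {P : E -> Prop} {a A B} :
  near_plane P a A B -> near_plane P a B A.
Proof. by move=> [d d0 H]; exists d => // s t sd td; rewrite addrAC; apply: H. Qed.

Lemma near_plane_near {P W : E -> Prop} {a A B} :
  (forall s t, W (a + s *: A + t *: B)) ->
  (\forall x \near a, W x -> P x) -> near_plane P a A B.
Proof.
move=> HW /nbhs_ballP[d /= d0 Hd].
have AB0 : 0 < `|A| + `|B| + 1 by have := normr_ge0 A; have := normr_ge0 B; lra.
exists (d / (`|A| + `|B| + 1)); first by rewrite divr_gt0.
move=> s t; rewrite !ltr_pdivlMr// => sd td; apply: Hd => //.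
rewrite -ball_normE /ball_ /= -addrA opprD addrA subrr add0r normrN.
apply: (le_lt_trans (ler_normD _ _)); rewrite !normrZ.
have [s_t|t_s] := leP `|s| `|t|.
  have := normr_ge0 A; have := normr_ge0 B; have := normr_ge0 t.
  have := normr_ge0 s; nra.
have := normr_ge0 A; have := normr_ge0 B; have := normr_ge0 t.
have := normr_ge0 s; nra.
Qed.

(** The increment is one step along [A] from [a] followed by one step along [B] from the moved point
    [a + h *: A]; the mean value theorem and the continuity of ['D_B f] bring the second quotient
    back to [a]. *)
Lemma is_derive_dirD f a A B :
  derivable f a A -> near_plane (fun x => derivable f x B) a A B ->
  (forall e : R, 0 < e -> near_plane (fun x => `|'D_B f x - 'D_B f a| < e) a A B) ->
  is_derive a (A + B) f ('D_A f a + 'D_B f a).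
Proof.
move=> dA dB cB.
suff H : h^-1 *: ((f \o shift a) (h *: (A + B)) - f a) @[h --> 0^']
    --> 'D_A f a + 'D_B f a.
  by split; [apply/cvg_ex; eexists; exact: H|exact: cvg_lim].
have -> : (fun h : R => h^-1 *: ((f \o shift a) (h *: (A + B)) - f a)) =
   (fun h : R => h^-1 *: ((f \o shift a) (h *: A) - f a)) \+
   (fun h : R => h^-1 *: (f (a + h *: A + h *: B) - f (a + h *: A))).
  apply/funext => h /=; rewrite -scalerDr; congr (_ *: _).
  rewrite /shift /= scalerDr.
  have -> : h *: A + h *: B + a = a + h *: A + h *: B by rewrite addrC addrA.
  by rewrite (addrC (h *: A) a); ring.
apply: cvgD; first exact: dA.
apply/cvgrPdist_lt => e e0.
have [d d0 Hd] := near_planeI dB (cB e e0).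
near=> h.
have hd : `|h| < d.
  by near: h; apply: dnbhs0_lt.
have h0 : h != 0 by near: h; exact: nbhs_dnbhs_neq.
have [s s01|s s01 ->] := @MVT_line f (a + h *: A) B h.
  apply: (proj1 (Hd h (s * h) hd _)); rewrite normrM.
  by apply: le_lt_trans hd; rewrite ler_piMl// ger0_norm; lra.
rewrite -[_ *: _]/(_ * _) mulrA mulVf// mul1r distrC.
apply: (proj2 (Hd h (s * h) hd _)); rewrite normrM.
by apply: le_lt_trans hd; rewrite ler_piMl// ger0_norm; lra.
Unshelve. all: by end_near. Qed.

(** First half of Clairaut's theorem: two mean value theorems, along [A] for the increment of [f]
    over [h *: B], then along [B] for ['D_A f]. The second difference itself is symmetric in [A] and
    [B]. *)
Lemma second_difference f a A B :
  near_plane (fun x => derivable f x A) a A B ->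
  near_plane (fun x => derivable ('D_A f) x B) a A B ->
  exists2 d : R, 0 < d & forall h : R, 0 < h < d ->
    exists s t : R, [/\ `|s| <= h, `|t| <= h &
      f (a + h *: A + h *: B) - f (a + h *: A) - f (a + h *: B) + f a =
      h ^+ 2 * 'D_B ('D_A f) (a + s *: A + t *: B)].
Proof.
move=> dA dB; have [d d0 Hd] := near_planeI dA dB.
exists d => // h /andP[h0 hd].
have hn : `|h| < d by rewrite gtr0_norm.
have n0 : `|0 : R| < d by rewrite normr0.
have bnd (s : R) : 0 <= s <= 1 -> `|s * h| <= h.
  by move=> s01; rewrite normrM !ger0_norm ?ler_piMl//; lra.
have bnd' (s : R) : 0 <= s <= 1 -> `|s * h| < d.
  by move=> s01; exact: le_lt_trans (bnd s s01) hd.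
pose g x := f (x + h *: B) - f x.
have dg (s : R) : 0 <= s <= 1 ->
    is_derive (a + (s * h) *: A) A g ('D_A f (a + (s * h) *: A + h *: B)
        - 'D_A f (a + (s * h) *: A)).
  move=> s01.
  have [d1 _] := Hd (s * h) h (bnd' s s01) hn.
  have [d2 _] := Hd (s * h) 0 (bnd' s s01) n0.
  rewrite scale0r addr0 in d2.
  apply: is_deriveB; last exact/derivableP.
  have e : (fun k : R => k^-1 *: (((fun x => f (x + h *: B))
         \o shift (a + (s * h) *: A)) (k *: A) - f (a + (s * h) *: A + h *: B))) =
     (fun k : R => k^-1 *: ((f \o shift (a + (s * h) *: A + h *: B)) (k *: A)
         - f (a + (s * h) *: A + h *: B))).
    by apply/funext => k /=; rewrite /shift /= -!addrA.
  by split; [rewrite /derivable e|rewrite /derive e].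
have [s s01|s s01 e1] := @MVT_line g a A h.
  by have [] := dg s s01.
have [t t01|t t01 e2] := @MVT_line ('D_A f) (a + (s * h) *: A) B h.
  by have [] := Hd (s * h) (t * h) (bnd' s s01) (bnd' t t01).
exists (s * h), (t * h); split; [exact: bnd|exact: bnd|].
move: e1; have [_ ->] := dg s s01; rewrite e2 /g mulrA -expr2 => <-.
by ring.
Qed.

(** Both [p] and [q] take the value [Delta h / h ^+ 2] at points that tend to [a] with [h]; these
    points may differ, hence the continuity of both functions. *)
Lemma eq_mixed_values (p q : E -> R) (Delta : R -> R) a A B :
  (forall e : R, 0 < e -> near_plane (fun x => `|p x - p a| < e) a A B) ->
  (forall e : R, 0 < e -> near_plane (fun x => `|q x - q a| < e) a A B) ->
  (exists2 d : R, 0 < d & forall h : R, 0 < h < d -> exists s t : R,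
    [/\ `|s| <= h, `|t| <= h & Delta h = h ^+ 2 * p (a + s *: A + t *: B)]) ->
  (exists2 d : R, 0 < d & forall h : R, 0 < h < d -> exists s t : R,
    [/\ `|s| <= h, `|t| <= h & Delta h = h ^+ 2 * q (a + s *: A + t *: B)]) ->
  p a = q a.
Proof.
move=> cp cq [d1 d10 H1] [d2 d20 H2].
apply/eqP; rewrite -subr_eq0 -normr_le0; apply/ler_addgt0Pl => e e0.
have e20 : 0 < e / 2 by rewrite divr_gt0.
have [d3 d30 H3] := near_planeI (cp _ e20) (cq _ e20).
pose d := Num.min d1 (Num.min d2 d3).
have d0 : 0 < d by rewrite !lt_min d10 d20.
have [dd1 [dd2 dd3]] : d <= d1 /\ d <= d2 /\ d <= d3.
  by rewrite /d !ge_min !lexx !orbT.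
pose h := d / 2.
have h0 : 0 < h by rewrite divr_gt0.
have hd : h < d by rewrite /h; lra.
have [|s [t [sh th e1]]] := H1 h; first by rewrite h0 (lt_le_trans hd).
have [|s' [t' [sh' th' e2]]] := H2 h; first by rewrite h0 (lt_le_trans hd).
have hd3 : h < d3 by exact: lt_le_trans dd3.
have [c1 _] := H3 s t (le_lt_trans sh hd3) (le_lt_trans th hd3).
have [_ c2] := H3 s' t' (le_lt_trans sh' hd3) (le_lt_trans th' hd3).
have h20 : h ^+ 2 != 0 by rewrite expf_neq0// gt_eqF.
have eq := mulfI h20 (etrans (esym e1) e2).
rewrite eq in c1; rewrite addr0.
move: c1 c2; rewrite !ltr_norml ler_norml => /andP[? ?] /andP[? ?].
by apply/andP; split; lra.
Qed.

Lemma derive_symmetric f a A B :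
  near_plane (fun x => derivable f x A) a A B ->
  near_plane (fun x => derivable f x B) a A B ->
  near_plane (fun x => derivable ('D_A f) x B) a A B ->
  near_plane (fun x => derivable ('D_B f) x A) a A B ->
  (forall e : R, 0 < e -> near_plane
     (fun x => `|'D_B ('D_A f) x - 'D_B ('D_A f) a| < e) a A B) ->
  (forall e : R, 0 < e -> near_plane
     (fun x => `|'D_A ('D_B f) x - 'D_A ('D_B f) a| < e) a A B) ->
  'D_B ('D_A f) a = 'D_A ('D_B f) a.
Proof.
move=> dA dB dAB dBA cAB cBA.
apply: (eq_mixed_values _ _ (fun h => f (a + h *: A + h *: B) - f (a + h *: A)
   - f (a + h *: B) + f a) _ _ _ cAB cBA).
  exact: second_difference.
have [d d0 H] := second_difference _ _ _ _ (near_planeC dB) (near_planeC dBA).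
exists d; first exact: d0.
move=> h hd; have [s [t [sh th e]]] := H h hd.
exists t, s; split; [exact: th|exact: sh|].
rewrite (addrAC a (t *: A)) -e (addrAC a (h *: B)).
move: (f (a + h *: A + h *: B)) (f (a + h *: A)) (f (a + h *: B)) (f a).
by move=> x y z w; ring.
Qed.

End Lines.

(** Taylor's formula in Peano's form: [dphi] is assumed differentiable at 0 only, so L'Hospital's
    rule is used once and leaves the difference quotient of [dphi]. *)
Lemma taylor2 {R : realType} (phi dphi : R -> R) (m : R) :
  (\forall t \near (0 : R), is_derive t (1 : R) phi (dphi t)) ->
  is_derive (0 : R) 1 dphi m ->
  (phi t - phi 0 - t * dphi 0) / t ^+ 2 @[t --> (0 : R)^'] --> m / 2.
Proof.
move=> /nbhs_ballP[r /= r0 Hr] dm.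
have Hr' t : t \in `]- r, r[ -> is_derive t (1 : R) phi (dphi t).
  move=> tr; apply: Hr; rewrite /ball /= sub0r normrN ltr_norml.
  by move: tr; rewrite in_itv.
have phi0 : is_derive (0 : R) 1 phi (dphi 0).
  by apply: Hr' ; rewrite in_itv /= r0 oppr_lt0 r0.
have c0 : phi t @[t --> (0 : R)] --> phi 0.
  by apply/differentiable_continuous; apply/derivable1_diffP; case: phi0.
have h0r : (0 : R) \in `]- r, r[ by rewrite in_itv /= r0 oppr_lt0 r0.
(* [lhopital] takes the full limit of the quotient of the derivatives, so the
   quotient is given its limit as value at 0. *)
apply: (@lhopital _ (fun t => phi t - phi 0 - t * dphi 0)
  (fun t => if t == 0 then m / 2 else dphi t - dphi 0)
  (fun t => t ^+ 2) (fun t => if t == 0 then 1 else 2 * t)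
  _ _ _ _ h0r).
- move=> x /set_mem[/= xr /eqP/negbTE ->].
  have h := Hr' x xr.
  have h1 := is_deriveB (is_deriveB h (is_derive_cst (phi 0) x 1))
    (is_deriveZ (dphi 0) (is_derive_id x (1 : R))).
  have e1 : phi - cst (phi 0) - dphi 0 \*: @id R =
      (fun t => phi t - phi 0 - t * dphi 0).
    by apply/funext => t; rewrite !fctE /= -[_ *: _]/(_ * _) mulrC.
  have e2 : dphi x - 0 - dphi 0 *: (1 : R) = dphi x - dphi 0.
    by rewrite subr0 -[_ *: _]/(_ * _) mulr1.
  by rewrite e1 e2 in h1.
- move=> x /set_mem[/= _ /eqP/negbTE ->].
  have -> : (fun t : R => t ^+ 2) = (@id R) ^+ 2 by apply/funext => t.
  by apply: is_derive_eq; rewrite /= expr1 -[_ *: _]/(_ * _) mulr1 -mulr_natl.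
- have := cvgB (cvgB c0 (cvg_cst (phi 0)))
    (cvgM (@cvg_id _ (nbhs (0 : R))) (cvg_cst (dphi 0))).
  by rewrite subrr mul0r subr0; apply.
- have h : t ^+ 2 @[t --> (0 : R)] --> (0 : R) ^+ 2 by exact: exprn_continuous.
  by rewrite expr0n in h.
- by move=> x /set_mem[/= _ /eqP x0]; rewrite (negbTE x0) mulf_neq0.
have [d1 d1m] := dm.
have h : h^-1 *: ((dphi \o shift 0) (h *: 1) - dphi 0) / 2 @[h --> (0 : R)^']
    --> m / 2.
  by rewrite -d1m; exact: (cvgMr_tmp d1).
apply/cvgrPdist_lt => e e0.
have /cvgrPdist_lt/(_ e e0) := h.
rewrite /dnbhs /within /= => h'; near=> t.
have [_|t0] := eqVneq t 0; first by rewrite divr1 subrr normr0.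
have : t != 0 -> `|m / 2 - t^-1 *: ((dphi \o shift 0) (t *: 1) - dphi 0) / 2| < e.
  by near: t.
move=> /(_ t0); rewrite /= /shift /= addr0 [t *: 1]mulr1 -[_ *: _]/(_ * _).
suff -> : (dphi t - dphi 0) / (2 * t) = t^-1 * (dphi t - dphi 0) / 2 by [].
by rewrite invfM mulrA mulrC mulrA.
Unshelve. all: by end_near. Qed.

(** * Euclidean norm and quadratic forms *)

Section MatrixNorm.
Context {R : realType}.

Lemma mx_coord_le_norm (m n : nat) (M : 'M[R]_(m, n)) i j : `|M i j| <= `|M|.
Proof.
rewrite [leRHS]/Num.Def.normr /= mx_normrE; apply/bigmax_geP; right => /=.
by exists (i, j).
Qed.

Lemma mx_norm_leP (m n : nat) (M : 'M[R]_(m, n)) (K : R) : 0 <= K ->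
  (forall i j, `|M i j| <= K) -> `|M| <= K.
Proof.
move=> K0 h; rewrite [leLHS]/Num.Def.normr /= mx_normrE; apply/bigmax_leP.
by split => // -[i j] _.
Qed.

End MatrixNorm.

Section EuclideanNorm.
Context {R : realType} {n : nat}.
Implicit Types (x y z p v : 'rV[R]_n.+1) (M A N : 'M[R]_n.+1).

Lemma edotC x y : edot x y = edot y x.
Proof. by apply: eq_bigr => i _; rewrite mulrC. Qed.

Lemma edotDl x y z : edot (x + y) z = edot x z + edot y z.
Proof. by rewrite -big_split; apply: eq_bigr => i _; rewrite !mxE mulrDl. Qed.

Lemma edotZl (a : R) x y : edot (a *: x) y = a * edot x y.
Proof. by rewrite /edot mulr_sumr; apply: eq_bigr => i _; rewrite !mxE mulrA. Qed.

Lemma edotNl x y : edot (- x) y = - edot x y.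
Proof. by rewrite -scaleN1r edotZl mulN1r. Qed.

Lemma edotDr x y z : edot x (y + z) = edot x y + edot x z.
Proof. by rewrite edotC edotDl !(edotC x). Qed.

Lemma edotZr (a : R) x y : edot x (a *: y) = a * edot x y.
Proof. by rewrite edotC edotZl (edotC x). Qed.

Lemma edotNr x y : edot x (- y) = - edot x y.
Proof. by rewrite edotC edotNl (edotC x). Qed.

Lemma edot0l x : edot 0 x = 0.
Proof. by rewrite -(scale0r 0) edotZl mul0r. Qed.

Lemma edotxx_ge0 x : 0 <= edot x x.
Proof. by apply: sumr_ge0 => i _; rewrite -expr2 sqr_ge0. Qed.

Lemma coord_le_edot x i : x 0 i ^+ 2 <= edot x x.
Proof.
rewrite /edot (bigD1 i)//= -expr2 lerDl; apply: sumr_ge0 => j _.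
by rewrite -expr2 sqr_ge0.
Qed.

Lemma edotxx_eq0 x : (edot x x == 0) = (x == 0).
Proof.
apply/idP/eqP => [/eqP x0|->]; last by rewrite edot0l.
apply/rowP => i; rewrite mxE; apply/eqP; rewrite -sqrf_eq0 eq_le sqr_ge0 andbT.
by rewrite -x0 coord_le_edot.
Qed.

Lemma enorm_ge0 x : 0 <= enorm x.
Proof. exact: sqrtr_ge0. Qed.

Lemma enorm_sqr x : enorm x ^+ 2 = edot x x.
Proof. by rewrite sqr_sqrtr// edotxx_ge0. Qed.

Lemma enorm0 : enorm (0 : 'rV[R]_n.+1) = 0.
Proof. by rewrite /enorm edot0l sqrtr0. Qed.

Lemma enorm_eq0 x : (enorm x == 0) = (x == 0).
Proof. by rewrite -sqrf_eq0 enorm_sqr edotxx_eq0. Qed.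

Lemma enorm_gt0 x : (0 < enorm x) = (x != 0).
Proof. by rewrite lt_neqAle enorm_ge0 andbT eq_sym enorm_eq0. Qed.

Lemma enormZ (a : R) x : enorm (a *: x) = `|a| * enorm x.
Proof.
by rewrite /enorm edotZl edotZr mulrA -expr2 sqrtrM ?sqr_ge0// sqrtr_sqr.
Qed.

Lemma enormN x : enorm (- x) = enorm x.
Proof. by rewrite /enorm edotNl edotNr opprK. Qed.

Lemma enormB x y : enorm (x - y) = enorm (y - x).
Proof. by rewrite -opprB enormN. Qed.

(** Cauchy-Schwarz, from the square of [enorm y *: x - enorm x *: y]. *)
Lemma edot_le x y : edot x y <= enorm x * enorm y.
Proof.
have [->|x0] := eqVneq x 0; first by rewrite edot0l enorm0 mul0r.
have [->|y0] := eqVneq y 0; first by rewrite edotC edot0l enorm0 mulr0.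
have a0 : 0 < enorm x by rewrite enorm_gt0.
have b0 : 0 < enorm y by rewrite enorm_gt0.
have := edotxx_ge0 (enorm y *: x - enorm x *: y).
rewrite !(edotDl, edotDr, edotNl, edotNr, edotZl, edotZr) (edotC y x).
rewrite -!enorm_sqr => h.
have {}h : 0 <= (enorm x * enorm y) * (2 * (enorm x * enorm y - edot x y)).
  by move: h; congr (_ <= _); ring.
move: h; rewrite pmulr_rge0 ?mulr_gt0// pmulr_rge0// subr_ge0.
by [].
Qed.

Lemma ler_enormD x y : enorm (x + y) <= enorm x + enorm y.
Proof.
rewrite -(@ler_pXn2r _ 2)// ?nnegrE ?enorm_ge0 ?addr_ge0 ?enorm_ge0//.
rewrite enorm_sqr !edotDl !edotDr (edotC y x) sqrrD !enorm_sqr.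
by have := edot_le x y; lra.
Qed.

Lemma ler_enorm_dist x y : enorm x <= enorm y + enorm (x - y).
Proof. by apply: le_trans (ler_enormD _ _); rewrite addrCA subrr addr0. Qed.

Lemma coord_le_enorm x i : `|x 0 i| <= enorm x.
Proof.
rewrite -(@ler_pXn2r _ 2)// ?nnegrE ?enorm_ge0//.
by rewrite enorm_sqr real_normK ?num_real// coord_le_edot.
Qed.

Lemma enorm_le_norm x : enorm x <= n.+1%:R * `|x|.
Proof.
rewrite -(@ler_pXn2r _ 2)// ?nnegrE ?enorm_ge0 ?mulr_ge0//.
rewrite enorm_sqr exprMn.
apply: (@le_trans _ _ (n.+1%:R * `|x| ^+ 2)).
  have -> : n.+1%:R * `|x| ^+ 2 = \sum_(i < n.+1) `|x| ^+ 2.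
    by rewrite sumr_const card_ord mulr_natl.
  apply: ler_sum => i _; rewrite -expr2 -[x 0 i ^+ 2]ger0_norm ?sqr_ge0//.
  by rewrite normrX lerXn2r ?nnegrE ?normr_ge0// mx_coord_le_norm.
rewrite ler_wpM2r ?sqr_ge0// -natrX ler_nat expnS leq_pmulr//.
Qed.

Lemma norm_le_enorm x : `|x| <= enorm x.
Proof.
rewrite [leLHS]/Num.Def.normr /= mx_normrE; apply/bigmax_leP; split.
  exact: enorm_ge0.
by move=> [i j] _ /=; rewrite (ord1 i) coord_le_enorm.
Qed.

Lemma nbhs_enorm x (P : set 'rV[R]_n.+1) : nbhs x P <->
  exists2 r : R, 0 < r & forall y, enorm (y - x) < r -> P y.
Proof.
split=> [/nbhs_normP[r /= r0 h]|[r r0 h]].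
  exists r => // y yr; apply: h; rewrite /ball_ /= distrC.
  by apply: le_lt_trans yr; exact: norm_le_enorm.
apply/nbhs_ballP; exists (r / n.+1%:R) => /=; first by rewrite divr_gt0.
move=> y; rewrite mx_norm_ball /ball_ /= distrC ltr_pdivlMr// mulrC => yr; apply: h.
by apply: le_lt_trans yr; exact: enorm_le_norm.
Qed.

Lemma lipschitz_enorm_continuous (f : 'rV[R]_n.+1 -> R) (K : R) :
  (forall x y, `|f x - f y| <= K * enorm (x - y)) -> continuous f.
Proof.
move=> fK x; apply/(@cvgrPdist_lt _ _ _ (nbhs x) (nbhs_filter x)) => e e0.
apply/nbhs_enorm.
have K0 : 0 < `|K| + 1 by rewrite ltr_wpDl.
exists (e / (`|K| + 1)); first by rewrite divr_gt0.
move=> y; rewrite ltr_pdivlMr// => yx; rewrite distrC.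
apply: le_lt_trans (fK _ _) _; apply: le_lt_trans yx.
rewrite mulrC ler_wpM2l ?enorm_ge0//.
by apply: le_trans (ler_norm _) _; rewrite lerDl.
Qed.

Lemma continuous_enorm : continuous (@enorm R n).
Proof.
apply: (@lipschitz_enorm_continuous _ 1) => x y; rewrite mul1r ler_norml.
have := ler_enorm_dist x y; have := ler_enorm_dist y x; rewrite (enormB y).
by move=> ? ?; apply/andP; split; lra.
Qed.

Lemma normr_edot_le x y : `|edot x y| <= enorm x * enorm y.
Proof.
rewrite ler_norml edot_le andbT lerNl -edotNl.
by rewrite (le_trans (edot_le _ _))// enormN.
Qed.

Lemma continuous_coord i : continuous (fun x => x 0 i).
Proof.
apply: (@lipschitz_enorm_continuous _ 1) => x y.
by rewrite mul1r; have := coord_le_enorm (x - y) i; rewrite !mxE.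
Qed.

Lemma closed_le_enorm (r : R) : closed [set x : 'rV[R]_n.+1 | r <= enorm x].
Proof.
have := @preimage_closed _ _ (@enorm R n) [set y : R | r <= y].
by apply => [x _|]; [exact: continuous_enorm|exact: closed_ge].
Qed.

Lemma closed_ecball (r : R) : closed (@ecball R n r).
Proof.
have := @preimage_closed _ _ (@enorm R n) [set y : R | y <= r].
by apply => [x _|]; [exact: continuous_enorm|exact: closed_le].
Qed.

Lemma open_eball (r : R) : open (@eball R n r).
Proof.
move=> x xr; apply/nbhs_enorm; exists (r - enorm x); first by rewrite subr_gt0.
move=> y yx; rewrite /eball /=; apply: le_lt_trans (ler_enorm_dist y x) _.
by rewrite -ltrBrDl.
Qed.

Lemma compact_ecball (A : set 'rV[R]_n.+1) (r : R) : closed A ->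
  A `<=` ecball r -> compact A.
Proof.
move=> cA Ar; apply: bounded_closed_compact => //.
exists r; split; first by rewrite num_real.
move=> M rM x /Ar xr; apply: le_trans (norm_le_enorm x) _.
exact: le_trans xr (ltW rM).
Qed.

End EuclideanNorm.

(** * Quadratic forms and the pairing of positive semidefinite matrices *)

Section QuadraticForms.
Context {R : realType} {n : nat}.
Implicit Types (x y z p v : 'rV[R]_n.+1) (M A N : 'M[R]_n.+1).

Definition qform M v := edot (v *m M) v.

Lemma qformE M v : qform M v = \sum_i \sum_j M i j * (v 0 i * v 0 j).
Proof.
rewrite /qform /edot exchange_big /=; apply: eq_bigr => j _.
by rewrite !mxE mulr_suml; apply: eq_bigr => i _; ring.
Qed.

Lemma qformD M N v : qform (M + N) v = qform M v + qform N v.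
Proof. by rewrite /qform mulmxDr edotDl. Qed.

Lemma qformZ (a : R) M v : qform (a *: M) v = a * qform M v.
Proof. by rewrite /qform -scalemxAr edotZl. Qed.

Lemma qformN M v : qform (- M) v = - qform M v.
Proof. by rewrite /qform mulmxN edotNl. Qed.

Lemma qform_scale M (a : R) v : qform M (a *: v) = a ^+ 2 * qform M v.
Proof. by rewrite /qform -scalemxAl edotZl edotZr; ring. Qed.

Lemma qform_mx M v : (v *m M *m v^T) 0 0 = qform M v.
Proof. by rewrite mxE; apply: eq_bigr => i _; rewrite !mxE. Qed.

(** The Frobenius pairing, that is the trace of [M^T *m N]; with the second-order coefficients on
    the left it is the principal part of the linearized operator. *)
Definition mxdot M N : R := \sum_i \sum_j M i j * N i j.

Lemma mxdotDr A M N : mxdot A (M + N) = mxdot A M + mxdot A N.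
Proof.
rewrite /mxdot -big_split; apply: eq_bigr => i _; rewrite -big_split.
by apply: eq_bigr => j _; rewrite !mxE mulrDr.
Qed.

Lemma mxdotZr (a : R) A M : mxdot A (a *: M) = a * mxdot A M.
Proof.
rewrite /mxdot mulr_sumr; apply: eq_bigr => i _; rewrite mulr_sumr.
by apply: eq_bigr => j _; rewrite !mxE; ring.
Qed.

Lemma mxdot_outer A v : mxdot A (v^T *m v) = qform A v.
Proof.
rewrite qformE; apply: eq_bigr => i _; apply: eq_bigr => j _.
by rewrite !mxE big_ord1 !mxE.
Qed.

Lemma psd_diag_ge0 N i : (forall v, 0 <= qform N v) -> 0 <= N i i.
Proof.
move=> /(_ (delta_mx 0 i)); rewrite qformE (bigD1 i)//= (bigD1 i)//= !mxE !eqxx.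
rewrite big1 => [|j ji]; last by rewrite !mxE eqxx (negbTE ji) /= !mulr0.
rewrite big1 => [|j ji]; last first.
  by rewrite big1// => k _; rewrite !mxE eqxx (negbTE ji) /= mul0r mulr0.
by rewrite !addr0 !mulr1.
Qed.

(** A nonnegative quadratic polynomial in [t], here [qform N (v + t *: delta_mx 0 i)], has
    nonpositive discriminant. *)
Lemma psd_cauchy N i v : N^T = N -> (forall v, 0 <= qform N v) ->
  ((v *m N) 0 i) ^+ 2 <= qform N v * N i i.
Proof.
move=> sN pN.
have expand (t : R) : qform N (v + t *: delta_mx 0 i) =
    qform N v + 2 * t * (v *m N) 0 i + t ^+ 2 * N i i.
  have e1 : edot (v *m N) (delta_mx 0 i) = (v *m N) 0 i.
    rewrite /edot (bigD1 i)//= big1 => [|j ji]; last first.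
      by rewrite !mxE (negbTE ji) andbF mulr0.
    by rewrite addr0 [delta_mx _ _ _ _]mxE !eqxx mulr1.
  have e2 : edot (delta_mx 0 i *m N) v = (v *m N) 0 i.
    rewrite -rowE /edot [RHS]mxE; apply: eq_bigr => j _.
    by rewrite mxE -[in LHS]sN mxE mulrC.
  have e3 : edot (delta_mx 0 i *m N) (delta_mx 0 i) = N i i.
    rewrite -rowE /edot (bigD1 i)//= big1 => [|j ji]; last first.
      by rewrite !mxE (negbTE ji) andbF mulr0.
    by rewrite addr0 !mxE !eqxx mulr1.
  rewrite /qform mulmxDl -scalemxAl !edotDl !edotDr !edotZl !edotZr e1 e2 e3.
  by ring.
have Nii := psd_diag_ge0 _ i pN.
have h t := pN (v + t *: delta_mx 0 i).
have [N0|N0] := eqVneq (N i i) 0.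
  rewrite N0 mulr0; set b := (v *m N) 0 i.
  have [->|b0] := eqVneq b 0; first by rewrite expr0n.
  (* Without a term in [t ^+ 2] the polynomial is affine, and this [t] would give it the value
     -1. *)
  have := h (- (qform N v + 1) / (2 * b)); rewrite expand N0 -/b mulr0 addr0.
  have -> : 2 * (- (qform N v + 1) / (2 * b)) * b = - (qform N v + 1) by field.
  by lra.
have {}N0 : 0 < N i i by rewrite lt_neqAle eq_sym N0.
have := h (- (v *m N) 0 i / N i i); rewrite expand.
set b := (v *m N) 0 i.
have -> : qform N v + 2 * (- b / N i i) * b + (- b / N i i) ^+ 2 * N i i =
    (qform N v * N i i - b ^+ 2) / N i i by field; rewrite gt_eqF.
by rewrite pmulr_lge0 ?invr_gt0// subr_ge0.
Qed.

(** Rank-one terms are split off as in a Cholesky factorization: subtracting [w^T *m w] divided by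
    the pivot [N i i], with [w] the row [i], leaves a positive semidefinite matrix by [psd_cauchy],
    and a rank-one term pairs with [A] to a value of [qform A]. The induction is on the number of
    nonzero diagonal entries. *)
Lemma mxdot_psd_ge0 A N : (forall v, 0 <= qform A v) -> N^T = N ->
  (forall v, 0 <= qform N v) -> 0 <= mxdot A N.
Proof.
move=> pA; have [k] := ubnP #|[set i | N i i != 0]%SET|.
elim: k N => // k IH N; rewrite ltnS => kN sN pN.
have [/existsP[i Ni]|] := boolP [exists i, N i i != 0]; last first.
  rewrite negb_exists => /forallP N0.
  suff -> : N = 0.
    by rewrite /mxdot big1// => i _; rewrite big1// => j _; rewrite mxE mulr0.
  apply/matrixP => i j; rewrite mxE.
  have := psd_cauchy _ j (delta_mx 0 i) sN pN.
  have /negPn/eqP -> := N0 j.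
  rewrite mulr0 -rowE mxE => h.
  by apply/eqP; rewrite -sqrf_eq0 eq_le h sqr_ge0.
have Nii : 0 < N i i by rewrite lt_neqAle eq_sym Ni psd_diag_ge0.
pose w := row i N.
pose N' := N - (N i i)^-1 *: (w^T *m w).
have wv v : edot w v = (v *m N) 0 i.
  by rewrite /edot mxE; apply: eq_bigr => j _; rewrite mxE -[in LHS]sN mxE mulrC.
have qw v : qform (w^T *m w) v = edot w v ^+ 2.
  rewrite /qform mulmxA.
  have -> : v *m w^T = (edot w v)%:M.
    apply/matrixP => a b; rewrite !ord1 !mxE mulr1n.
    by apply: eq_bigr => j _; rewrite !mxE mulrC.
  by rewrite mul_scalar_mx edotZl expr2.
have sN' : N'^T = N'.
  by rewrite /N' linearB linearZ /= trmx_mul trmxK sN.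
have pN' v : 0 <= qform N' v.
  rewrite qformD qformN qformZ qw wv subr_ge0 ler_pdivrMl// mulrC.
  exact: psd_cauchy.
have -> : N = N' + (N i i)^-1 *: (w^T *m w) by rewrite subrK.
rewrite mxdotDr mxdotZr mxdot_outer.
apply: addr_ge0; last by rewrite mulr_ge0// invr_ge0 ltW.
apply: IH => //; apply: leq_trans kN; apply: proper_card.
apply/properP; split; last first.
  exists i; rewrite inE// negbK !mxE big_ord1 !mxE.
  by rewrite mulKf ?subrr// gt_eqF.
(* Diagonal entries can only decrease and stay nonnegative, so an entry that is zero remains
   zero. *)
apply/fintype.subsetP => j; rewrite !inE; apply: contra => /eqP Nj.
have := psd_diag_ge0 _ j pN'; rewrite !mxE big_ord1 !mxE Nj sub0r oppr_ge0 => h.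
rewrite oppr_eq0 eq_le h /=; apply: mulr_ge0; first by rewrite invr_ge0 ltW.
by rewrite -expr2 sqr_ge0.
Qed.

End QuadraticForms.

(** * Second order expansions *)

Section DirectionalDerivatives.
Context {R : realType} {E : normedModType R}.
Implicit Types (f g : E -> R) (a v A B : E).

Lemma is_derive_dirZ f a v (c : R) : derivable f a v ->
  is_derive a (c *: v) f (c * 'D_v f a).
Proof.
move=> df.
have h1 : is_derive (0 * c) 1 (fun s : R => f (a + s *: v)) ('D_v f a).
  have := @is_derive_line _ _ f a v (0 * c).
  by rewrite !mul0r scale0r addr0; apply.
have h2 : is_derive (0 : R) (1 : R) (fun s : R => s * c) c.
  have -> : (fun s : R => s * c) = c \*: @id R.
    by apply/funext => x /=; rewrite -[_ *: _]/(_ * _) mulrC.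
  have := is_deriveZ c (is_derive_id (0 : R) (1 : R)).
  by rewrite [c *: _]mulr1.
have [d1 d2] := @is_derive1_comp _ _ (fun s : R => s * c) 0 _ _ h1 h2.
have e : (fun h : R => h^-1 *: ((((fun s : R => f (a + s *: v)) \o
      (fun s : R => s * c)) \o shift 0) (h *: 1) - f (a + (0 * c) *: v))) =
    (fun h : R => h^-1 *: ((f \o shift a) (h *: (c *: v)) - f a)).
  apply/funext => h; rewrite /= /shift /= addr0 mul0r scale0r addr0.
  by rewrite [h *: 1]mulr1 -scalerA [a + _]addrC.
split; first by move: d1; rewrite /derivable /= e.
by move: d2; rewrite /derive /= e mulrC.
Qed.

Section Subspace.
Variables (W : set E).
Hypothesis W0 : W 0.
Hypothesis WD : forall x y, W x -> W y -> W (x + y).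
Hypothesis WZ : forall (c : R) x, W x -> W (c *: x).

(** Class [C^1] relative to the subspace [W], for base points and directions alike. [W] is
    everything for [u], and the jets with symmetric matrix for [F]. *)
Definition C1_at f a :=
  forall v, W v -> (\forall x \near a, W x -> derivable f x v) /\
    forall e : R, 0 < e -> \forall x \near a, W x -> `|'D_v f x - 'D_v f a| < e.

Lemma C1_at_sum f a (I : Type) (r : seq I) (A : I -> E) : W a -> C1_at f a ->
  (forall i, W (A i)) ->
  is_derive a (\sum_(i <- r) A i) f (\sum_(i <- r) 'D_(A i) f a).
Proof.
move=> Wa Cf WA; elim: r => [|i r IH].
  rewrite !big_nil; have := @is_derive_dirZ f a 0 0.
  rewrite scale0r mul0r; apply.
  by have [h _] := Cf _ W0; exact: (nbhs_singleton h).
have Wr : W (\sum_(j <- r) A j) by apply: big_rec => // j x _; exact: WD.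
(* The tail sum is known to be a direction of differentiability at [a] only, so [A i] takes the role
   in which [is_derive_dirD] asks for continuity. *)
rewrite !big_cons addrC [X in is_derive _ _ _ X]addrC; have [d1 <-] := IH.
have [h1 h2] := Cf _ (WA i).
have Wp s t : W (a + s *: (\sum_(j <- r) A j) + t *: A i).
  by apply: WD; [apply: WD => //|]; exact: WZ.
apply: is_derive_dirD => //; first exact: near_plane_near Wp h1.
by move=> e e0; exact: near_plane_near Wp (h2 e e0).
Qed.

End Subspace.
End DirectionalDerivatives.

Section SecondOrderJets.
Context {R : realType} {n : nat}.
Implicit Types (f g : 'rV[R]_n.+1 -> R) (x y z p v w : 'rV[R]_n.+1).
Implicit Types (M N : 'M[R]_n.+1).

(** The expansion is required on each line through [x] separately, without uniformity in [v]. That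
    is enough at a minimum and makes sums and reflections immediate. *)
Definition jet2 f x p M := forall v,
  (f (x + t *: v) - f x - t * edot p v) / t ^+ 2 @[t --> (0 : R)^'] -->
  qform M v / 2.

Lemma jet2D f g x p q M N : jet2 f x p M -> jet2 g x q N ->
  jet2 (f \+ g) x (p + q) (M + N).
Proof.
move=> fx gx v; rewrite qformD mulrDl.
have -> : (fun t : R => ((f \+ g) (x + t *: v) - (f \+ g) x
      - t * edot (p + q) v) / t ^+ 2) =
    (fun t : R => (f (x + t *: v) - f x - t * edot p v) / t ^+ 2) \+
    (fun t : R => (g (x + t *: v) - g x - t * edot q v) / t ^+ 2).
  by apply/funext => t; rewrite /= edotDl -mulrDl; congr (_ / _); ring.
exact: cvgD.
Qed.

Lemma jet2Z f x p M (c : R) :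
  jet2 f x p M -> jet2 (fun y => c * f y) x (c *: p) (c *: M).
Proof.
move=> fx v; rewrite qformZ -mulrA.
have -> : (fun t : R => (c * f (x + t *: v) - c * f x
      - t * edot (c *: p) v) / t ^+ 2) =
    (fun t : R => c * ((f (x + t *: v) - f x - t * edot p v) / t ^+ 2)).
  by apply/funext => t; rewrite /= edotZl [RHS]mulrA; congr (_ * _); ring.
exact: cvgMl_tmp.
Qed.

Lemma cvg_line x v : x + t *: v @[t --> (0 : R)^'] --> x.
Proof.
have : x + t *: v @[t --> (0 : R)] --> x + 0 *: v.
  by apply: cvgD; [exact: cvg_cst|apply: cvgZr_tmp; exact: cvg_id].
by rewrite scale0r addr0; apply: cvg_trans; apply: cvg_app; exact: cvg_within.
Qed.

Lemma jet2_min f x p M : jet2 f x p M -> (\forall y \near x, f x <= f y) ->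
  p = 0 /\ forall v, 0 <= qform M v.
Proof.
move=> fx minf.
have minl v : \forall t \near (0 : R)^', f x <= f (x + t *: v).
  exact: (cvg_line x v _ minf).
have p0 : p = 0.
  apply/eqP; rewrite -edotxx_eq0; apply: contraT => c0.
  have {}c0 : 0 < edot p p by rewrite lt_neqAle eq_sym c0 edotxx_ge0.
  have /cvgrPdist_lt/(_ 1 ltr01) := fx p.
  set m := qform M p / 2 => Hm.
  have [d d0 Hd] : exists2 d : R, 0 < d & forall t, `|t| < d -> t != 0 ->
     `|m - (f (x + t *: p) - f x - t * edot p p) / t ^+ 2| < 1 /\
     f x <= f (x + t *: p).
    have H0 : \forall t \near (0 : R), t != 0 ->
        `|m - (f (x + t *: p) - f x - t * edot p p) / t ^+ 2| < 1 /\
        f x <= f (x + t *: p) by exact: filterI Hm (minl p).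
    have [d /= d0 Hd] := (nbhs_ballP _ _).1 H0.
    exists d => // t td t0; apply: Hd => //.
    by rewrite /ball /= sub0r normrN.
  pose k := `|m| + 1; have k0 : 0 < k by rewrite ltr_wpDl.
  (* A negative [t] moves against [p]: the linear term [t * edot p p] outweighs the remainder, which
     is below [k * t ^+ 2], and [f] would drop below its minimum. *)
  pose t := - Num.min (d / 2) (edot p p / k / 2).
  have t0 : 0 < - t by rewrite opprK lt_min !divr_gt0.
  have td : `|t| < d.
    rewrite ltr0_norm ?oppr_gt0 -?oppr_gt0// opprK.
    by apply: (@le_lt_trans _ _ (d / 2)); [rewrite ge_min lexx|lra].
  have tk : - t * k < edot p p.
    rewrite opprK -ltr_pdivlMr//.
    apply: (@le_lt_trans _ _ (edot p p / k / 2)); first by rewrite ge_min lexx orbT.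
    have : 0 < edot p p / k by rewrite divr_gt0.
    by lra.
  have tn0 : t != 0 by rewrite -oppr_eq0 gt_eqF.
  have [h1 h2] := Hd t td tn0.
  have : (f (x + t *: p) - f x - t * edot p p) / t ^+ 2 < k.
    have := ler_norm m.
    have := ler_norm (- (m - (f (x + t *: p) - f x - t * edot p p) / t ^+ 2)).
    by rewrite normrN /k; lra.
  rewrite ltr_pdivrMr; last by rewrite exprn_even_gt0.
  by nra.
split => // v.
have := fx v; rewrite p0 => h.
have : 0 <= qform M v / 2.
  rewrite -(cvg_lim _ h)//; apply: limr_ge; first exact: (cvgP _ h).
  near=> t; rewrite edot0l mulr0 subr0 divr_ge0 ?sqr_ge0// subr_ge0.
  by near: t; exact: minl.
by rewrite pmulr_lge0.
Unshelve. all: by end_near. Qed.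

(** Both Gaussian test functions, the radial one of Hopf's lemma and the one-dimensional one of
    narrow strips, restrict to a line as the exponential of a quadratic polynomial in [t]. *)
Lemma exp_quadratic_taylor (alpha q b c : R) :
  (expR (- alpha * (q + t * (2 * b) + t ^+ 2 * c)) - expR (- alpha * q)
     - t * (- (2 * alpha) * expR (- alpha * q) * b)) / t ^+ 2
    @[t --> (0 : R)^'] -->
  expR (- alpha * q) * (4 * alpha ^+ 2 * b ^+ 2 - 2 * alpha * c) / 2.
Proof.
pose phi t := expR (- alpha * (q + t * (2 * b) + t ^+ 2 * c)).
pose dphi t := phi t * (- alpha * (2 * b + 2 * t * c)).
have dlin (t : R) : is_derive t (1 : R)
    (fun t : R => - alpha * (q + t * (2 * b) + t ^+ 2 * c))
    (- alpha * (2 * b + 2 * t * c)).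
  have -> : (fun t : R => - alpha * (q + t * (2 * b) + t ^+ 2 * c)) =
      (- alpha) \*: (cst q + (2 * b) \*: @id R + c \*: (@id R) ^+ 2).
    by apply/funext => s; rewrite /= !fctE /= /GRing.scale /=; ring.
  apply: is_derive_eq; rewrite /GRing.scale /=; ring.
have dexp (t : R) : is_derive t (1 : R) phi (dphi t).
  exact: (@is_derive1_comp _ expR _ t _ _ (is_derive_expR _) (dlin t)).
have ddphi : is_derive (0 : R) (1 : R) dphi
    (expR (- alpha * q) * (4 * alpha ^+ 2 * b ^+ 2 - 2 * alpha * c)).
  have h : is_derive (0 : R) (1 : R) (fun t : R => - alpha * (2 * b + 2 * t * c))
      (- alpha * (2 * c)).
    have -> : (fun t : R => - alpha * (2 * b + 2 * t * c)) =
        (- alpha) \*: (cst (2 * b) + (2 * c) \*: @id R).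
      by apply/funext => s; rewrite /= !fctE /= /GRing.scale /=; ring.
    apply: is_derive_eq; rewrite /GRing.scale /=; ring.
  apply: (is_derive_eq (is_deriveM (dexp 0) h)).
  rewrite /GRing.scale /= /dphi /phi !mul0r expr0n mul0r !addr0; ring.
have H1 : \forall t \near (0 : R), is_derive t (1 : R) phi (dphi t).
  by exists 1 => //= t _; exact: dexp.
have := taylor2 _ _ _ H1 ddphi.
have phi0 : phi 0 = expR (- alpha * q).
  by rewrite /phi !mul0r expr0n mul0r !addr0.
rewrite /dphi phi0; apply: cvg_trans; apply: near_eq_cvg; near=> t.
by congr (_ / _); rewrite /phi; ring.
Unshelve. all: by end_near. Qed.

Lemma jet2_gauss (alpha : R) (e x : 'rV[R]_n.+1) :
  let E := expR (- alpha * edot (x - e) (x - e)) in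
  jet2 (fun y => expR (- alpha * edot (y - e) (y - e))) x
    (- (2 * alpha) * E *: (x - e))
    (E *: ((4 * alpha ^+ 2) *: ((x - e)^T *m (x - e)) - (2 * alpha)%:M)).
Proof.
move=> E v.
have := @exp_quadratic_taylor alpha (edot (x - e) (x - e)) (edot (x - e) v)
  (edot v v).
rewrite -/E qformZ qformD qformN qformZ.
have -> : qform ((x - e)^T *m (x - e)) v = edot (x - e) v ^+ 2.
  rewrite /qform mulmxA.
  have -> : v *m (x - e)^T = (edot (x - e) v)%:M.
    apply/matrixP => a b; rewrite !ord1 [RHS]mxE mulr1n mxE.
    by apply: eq_bigr => j _; rewrite [(x - e)^T _ _]mxE mulrC.
  by rewrite mul_scalar_mx edotZl expr2.
have -> : qform (2 * alpha)%:M v = 2 * alpha * edot v v.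
  by rewrite /qform mul_mx_scalar edotZl.
apply: cvg_trans; apply: near_eq_cvg; near=> t.
rewrite edotZl; congr ((expR _ - _ - _) / _).
  have -> : x + t *: v - e = (x - e) + t *: v by rewrite addrAC.
  move: (x - e) => d.
  by rewrite !edotDl !edotDr !edotZl !edotZr (edotC v d); ring.
Unshelve. all: by end_near. Qed.

Lemma jet2_gauss1 (alpha c : R) (x : 'rV[R]_n.+1) :
  let E := expR (- alpha * (x 0 0 - c) ^+ 2) in
  jet2 (fun y => expR (- alpha * (y 0 0 - c) ^+ 2)) x
    (- (2 * alpha) * E * (x 0 0 - c) *: delta_mx 0 0)
    (E * (4 * alpha ^+ 2 * (x 0 0 - c) ^+ 2 - 2 * alpha) *: delta_mx 0 0).
Proof.
move=> E v.
have := @exp_quadratic_taylor alpha ((x 0 0 - c) ^+ 2) ((x 0 0 - c) * v 0 0)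
  (v 0 0 ^+ 2).
have d0 : edot (delta_mx 0 0) v = v 0 0.
  rewrite /edot (bigD1 0)//= big1 => [|i i0].
    by rewrite mxE !eqxx mul1r addr0.
  by rewrite mxE (negbTE i0) andbF mul0r.
rewrite -/E qformZ.
have -> : qform (delta_mx 0 0) v = v 0 0 ^+ 2.
  rewrite qformE (bigD1 0)//= (bigD1 0)//= big1 => [|i i0].
    rewrite big1 => [|i i0]; first by rewrite mxE !eqxx mul1r !addr0.
    by rewrite big1// => j _; rewrite mxE (negbTE i0) /= mul0r.
  by rewrite mxE (negbTE i0) andbF mul0r.
have -> : E * (4 * alpha ^+ 2 * ((x 0 0 - c) * v 0 0) ^+ 2 - 2 * alpha * v 0 0 ^+ 2)
   = E * (4 * alpha ^+ 2 * (x 0 0 - c) ^+ 2 - 2 * alpha) * v 0 0 ^+ 2 by ring.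
apply: cvg_trans; apply: near_eq_cvg; near=> t.
rewrite edotZl d0; congr ((expR _ - _ - _) / _); last by ring.
by rewrite !mxE; ring.
Unshelve. all: by end_near. Qed.

End SecondOrderJets.

(** * Functions of class C^2 in the punctured ball *)

Section PuncturedBall.
Context {R : realType} {n : nat}.
Implicit Types (u : 'rV[R]_n.+1 -> R) (x y a v w : 'rV[R]_n.+1).

Lemma open_punctured_eball : open (eball 1 `\ (0 : 'rV[R]_n.+1)).
Proof.
rewrite setDE; apply: openI; first exact: open_eball.
rewrite openC.
exact: accessible_closed_set1 (hausdorff_accessible (@norm_hausdorff _ _)) 0.
Qed.

Lemma near_punctured a : (eball 1 `\ 0) a -> \forall x \near a, (eball 1 `\ 0) x.
Proof.
by move=> Oa; apply: open_nbhs_nbhs; split; [exact: open_punctured_eball|].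
Qed.

Lemma punctured_closure x : (eball 1 `\ 0) x -> (ecball 1 `\ 0) x.
Proof. by move=> [h1 h2]; split => //; exact: ltW. Qed.

Lemma within_continuous_near u (D : set 'rV[R]_n.+1) a :
  {within D, continuous u} -> D a ->
  forall e : R, 0 < e -> \forall x \near a, D x -> `|u x - u a| < e.
Proof.
move=> /subspace_continuousP uD Da e e0.
have /cvgrPdist_lt/(_ e e0) := uD a Da.
rewrite /within /= => h.
have {}h : \forall x \near a, D x -> `|u a - u x| < e by exact: h.
by apply: filterS h => x h Dx; rewrite distrC; exact: h.
Qed.

Variable u : 'rV[R]_n.+1 -> R.
Hypothesis u_C2 : C2_on_punctured_cball u.

Lemma C2_continuous : {within ecball 1 `\ 0, continuous u}.
Proof. by have [] := u_C2. Qed.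

Lemma C2_derivable v a : (eball 1 `\ 0) a -> derivable u a v.
Proof. by have [_ h] := u_C2; have [+ _] := h v I; apply. Qed.

(** [Ck_on] provides a function that equals ['D_v u] in the open punctured ball only; its continuity
    up to the sphere is what bounds the derivatives of [u] near the sphere. *)
Lemma C2_derive_extension v : exists g : 'rV[R]_n.+1 -> R,
  [/\ {within ecball 1 `\ 0, continuous g},
      (forall a w, (eball 1 `\ 0) a -> derivable g a w),
      (forall w, exists2 h : 'rV[R]_n.+1 -> R,
        {within ecball 1 `\ 0, continuous h} &
        forall a, (eball 1 `\ 0) a -> h a = 'D_w g a) &
      forall a, (eball 1 `\ 0) a -> g a = 'D_v u a].
Proof.
have [_ h] := u_C2; have [_ [g [gc gd] gu]] := h v I.
exists g; split => //.
  by move=> a w Oa; have [+ _] := gd w I; apply.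
by move=> w; have [_ [k [kc _] kg]] := gd w I; exists k.
Qed.

Lemma C2_derive2 v w : exists2 h : 'rV[R]_n.+1 -> R,
  {within ecball 1 `\ 0, continuous h} &
  forall a, (eball 1 `\ 0) a -> is_derive a w ('D_v u) (h a).
Proof.
have [g [_ gd gh gu]] := C2_derive_extension v.
have [h hc hg] := gh w; exists h => // a Oa.
(* The punctured ball is open, so [g] and ['D_v u] coincide near [a] and have the same
   derivative. *)
apply: (@near_eq_is_derive _ _ _ g).
  by apply: filterS (near_punctured _ Oa) => x Ox; exact: gu.
by rewrite hg//; apply/derivableP; exact: gd.
Qed.

Lemma extension_near (g h : 'rV[R]_n.+1 -> R) a :
  {within ecball 1 `\ 0, continuous h} ->
  (forall a, (eball 1 `\ 0) a -> h a = g a) -> (eball 1 `\ 0) a ->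
  forall e : R, 0 < e -> \forall x \near a, setT x -> `|g x - g a| < e.
Proof.
move=> hc hg Oa e e0.
have Da := punctured_closure _ Oa.
have := within_continuous_near _ _ _ hc Da _ e0.
have := near_punctured _ Oa; apply: filterS2 => x Ox + _.
by rewrite !hg//; apply; exact: punctured_closure.
Qed.

Lemma C2_C1_at a : (eball 1 `\ 0) a -> C1_at setT u a.
Proof.
move=> Oa v _; split.
  by apply: filterS (near_punctured _ Oa) => x Ox _; exact: C2_derivable.
have [g [gc _ _ gu]] := C2_derive_extension v.
exact: (extension_near _ _ _ gc gu Oa).
Qed.

Lemma C2_C1_at_derive v a : (eball 1 `\ 0) a -> C1_at setT ('D_v u) a.
Proof.
move=> Oa w _; have [h hc hd] := C2_derive2 v w.
split.
  by apply: filterS (near_punctured _ Oa) => x Ox _; case: (hd x Ox).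
by apply: (extension_near _ _ _ hc) => // x Ox; case: (hd x Ox).
Qed.

Lemma row_sum v : v = \sum_i v 0 i *: delta_mx 0 i.
Proof. exact: row_sum_delta. Qed.

Lemma C1_at_gradient (f : 'rV[R]_n.+1 -> R) v a : C1_at setT f a ->
  'D_v f a = edot (gradient f a) v.
Proof.
move=> Cf; rewrite {1}[v]row_sum.
have [_ ->] : is_derive a (\sum_i v 0 i *: delta_mx 0 i) f
    (\sum_i 'D_(v 0 i *: delta_mx 0 i) f a) by apply: (@C1_at_sum _ _ setT).
apply: eq_bigr => i _; rewrite mxE mulrC.
have [] := @is_derive_dirZ _ _ f a (delta_mx 0 i) (v 0 i) => //.
by have [h _] := Cf (delta_mx 0 i) I; exact: (nbhs_singleton h).
Qed.

Lemma C2_derive_gradient v a : (eball 1 `\ 0) a ->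
  'D_v u a = edot (gradient u a) v.
Proof. by move=> Oa; apply/C1_at_gradient/C2_C1_at. Qed.

Lemma C2_hessian_sym a : (eball 1 `\ 0) a -> symmx (hessian u a).
Proof.
move=> Oa; apply/matrixP => i j; rewrite !mxE /partial.
have P (Q : 'rV[R]_n.+1 -> Prop) A B : (\forall x \near a, setT x -> Q x) ->
   near_plane Q a A B.
  by apply: near_plane_near.
have h v : \forall x \near a, setT x -> derivable u x v.
  by have [] := C2_C1_at _ Oa v I.
apply: derive_symmetric.
- exact/P/h.
- exact/P/h.
- by apply: P; have [] := C2_C1_at_derive (delta_mx 0 i) _ Oa (delta_mx 0 j) I.
- by apply: P; have [] := C2_C1_at_derive (delta_mx 0 j) _ Oa (delta_mx 0 i) I.
- move=> e e0; apply: P.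
  by have [_ +] := C2_C1_at_derive (delta_mx 0 i) _ Oa (delta_mx 0 j) I; apply.
- move=> e e0; apply: P.
  by have [_ +] := C2_C1_at_derive (delta_mx 0 j) _ Oa (delta_mx 0 i) I; apply.
Qed.

Lemma C2_derive2_hessian v a : (eball 1 `\ 0) a ->
  is_derive a v ('D_v u) (qform (hessian u a) v).
Proof.
move=> Oa.
have [h _ hd] := C2_derive2 v v.
suff -> : qform (hessian u a) v = h a by exact: hd.
have [_ <-] := hd a Oa; rewrite (C1_at_gradient _ _ _ (C2_C1_at_derive _ _ Oa)).
rewrite /qform; congr (edot _ v); apply/rowP => i.
rewrite [RHS]mxE mxE /partial.
have e : \forall x \near a, \sum_j v 0 j *: partial j u x = 'D_v u x.
  apply: filterS (near_punctured _ Oa) => x Ox.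
  rewrite (C2_derive_gradient _ _ Ox) /edot; apply: eq_bigr => j _.
  by rewrite mxE mulrC.
have [_ ->] : is_derive a (delta_mx 0 i) ('D_v u)
   (\sum_j v 0 j *: 'D_(delta_mx 0 i) (partial j u) a).
  apply: near_eq_is_derive e _.
  have -> : (fun x => \sum_j v 0 j *: partial j u x) =
      \sum_j (v 0 j \*: partial j u).
    by apply/funext => x; rewrite fct_sumE.
  apply: is_derive_sum => j; apply: is_deriveZ; apply/derivableP.
  by have [k _ kd] := C2_derive2 (delta_mx 0 j) (delta_mx 0 i); case: (kd a Oa).
by apply: eq_bigr => j _; rewrite -(C2_hessian_sym _ Oa) !mxE.
Qed.

Lemma C2_jet2 a : (eball 1 `\ 0) a -> jet2 u a (gradient u a) (hessian u a).
Proof.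
move=> Oa v.
pose phi (t : R) := u (a + t *: v); pose dphi (t : R) := 'D_v u (a + t *: v).
have nO : \forall t \near (0 : R), (eball 1 `\ 0) (a + t *: v).
  have : a + t *: v @[t --> (0 : R)] --> a + 0 *: v.
    by apply: cvgD; [exact: cvg_cst|apply: cvgZr_tmp; exact: cvg_id].
  by rewrite scale0r addr0; apply; exact: near_punctured.
have H1 : \forall t \near (0 : R), is_derive t (1 : R) phi (dphi t).
  by apply: filterS nO => t Ot; apply: is_derive_line; exact: C2_derivable.
have H2 : is_derive (0 : R) (1 : R) dphi (qform (hessian u a) v).
  have [d1 <-] := C2_derive2_hessian v _ Oa.
  have := @is_derive_line _ _ ('D_v u) a v 0.
  by rewrite scale0r addr0; apply.
have := taylor2 _ _ _ H1 H2.
rewrite /phi /dphi scale0r addr0 C2_derive_gradient//.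
Qed.

Lemma compact_shell (rho : R) : compact [set x : 'rV[R]_n.+1 | rho <= enorm x <= 1].
Proof.
apply: (@compact_ecball _ _ _ 1) => [|x /andP[]//].
have -> : [set x : 'rV[R]_n.+1 | rho <= enorm x <= 1] =
   [set x | rho <= enorm x] `&` ecball 1.
  by apply/seteqP; split=> x /= => [/andP[]|[-> ->]].
by apply: closedI; [exact: closed_le_enorm|exact: closed_ecball].
Qed.

Lemma shell_sub (rho : R) : 0 < rho ->
  [set x : 'rV[R]_n.+1 | rho <= enorm x <= 1] `<=` ecball 1 `\ 0.
Proof.
move=> r0 x /andP[h1 h2]; split => // x0.
by move: h1; rewrite x0 enorm0 leNgt r0.
Qed.

Lemma shell_bounded (rho : R) (f : 'rV[R]_n.+1 -> R) : 0 < rho ->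
  {within ecball 1 `\ 0, continuous f} ->
  exists K : R, forall x, rho <= enorm x <= 1 -> `|f x| <= K.
Proof.
move=> r0 fc.
have c : compact (f @` [set x : 'rV[R]_n.+1 | rho <= enorm x <= 1]).
  apply: continuous_compact; last exact: compact_shell.
  exact: continuous_subspaceW (shell_sub _ r0) fc.
have [M [_ hM]] := compact_bounded c.
exists (M + 1) => x xr; apply: (hM (M + 1)); first by rewrite ltrDl.
by exists x.
Qed.

Lemma C2_jet_bounded (rho : R) : 0 < rho -> exists2 K : R, 0 < K &
  forall x, rho <= enorm x < 1 ->
    [/\ `|u x| <= K, `|gradient u x| <= K & `|hessian u x| <= K].
Proof.
move=> r0.
have shellO x : rho <= enorm x < 1 -> (eball 1 `\ 0) x.
  move=> /andP[h1 h2]; split => // x0; move: h1.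
  by rewrite x0 enorm0 leNgt r0.
have [K0 hK0] := shell_bounded _ _ r0 C2_continuous.
have [K1 hK1] : exists K : R, forall i x, rho <= enorm x < 1 -> `|partial i u x| <= K.
  have /choice[K HK] : forall i, exists K : R, forall x, rho <= enorm x < 1 ->
      `|partial i u x| <= K.
    move=> i; have [g [gc _ _ gu]] := C2_derive_extension (delta_mx 0 i).
    have [K hK] := shell_bounded _ _ r0 gc; exists K => x xr.
    rewrite /partial -gu; last exact: shellO.
    by apply: hK; move: xr => /andP[-> /ltW].
  exists (\sum_i `|K i|) => i x xr; apply: le_trans (HK i x xr) _.
  apply: le_trans (ler_norm _) _.
  by rewrite (bigD1 i)//= lerDl sumr_ge0.
have [K2 hK2] : exists K : R, forall ij x, rho <= enorm x < 1 ->
    `|hessian u x ij.1 ij.2| <= K.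
  have /choice[K HK] : forall ij : 'I_n.+1 * 'I_n.+1, exists K : R, forall x,
      rho <= enorm x < 1 -> `|hessian u x ij.1 ij.2| <= K.
    move=> [i j]; have [h hc hd] := C2_derive2 (delta_mx 0 j) (delta_mx 0 i).
    have [K hK] := shell_bounded _ _ r0 hc; exists K => x xr.
    rewrite mxE /partial /=; have [_ ->] := hd x (shellO x xr).
    by apply: hK; move: xr => /andP[-> /ltW].
  exists (\sum_ij `|K ij|) => ij x xr; apply: le_trans (HK ij x xr) _.
  apply: le_trans (ler_norm _) _.
  by rewrite (bigD1 ij)//= lerDl sumr_ge0.
pose K := `|K0| + `|K1| + `|K2| + 1.
have [kk0 [kk1 kk2]] : K0 <= K /\ K1 <= K /\ K2 <= K.
  have := ler_norm K0; have := ler_norm K1; have := ler_norm K2.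
  have := normr_ge0 K0; have := normr_ge0 K1; have := normr_ge0 K2.
  by rewrite /K => *; split; [|split]; lra.
have K_gt0 : 0 < K by rewrite /K ltr_wpDl// !addr_ge0.
exists K => // x xr; split.
- by apply: le_trans kk0; apply: hK0; move: xr => /andP[-> /ltW].
- rewrite [leLHS]/Num.Def.normr /= mx_normrE; apply/bigmax_leP.
  split; first exact: ltW.
  by move=> [i j] _; rewrite /= mxE; apply: le_trans kk1; exact: hK1.
- rewrite [leLHS]/Num.Def.normr /= mx_normrE; apply/bigmax_leP.
  split; first exact: ltW.
  by move=> ij _; apply: le_trans kk2; exact: hK2.
Qed.

End PuncturedBall.

(** * Linearization of the operator *)

Section CompactSets.
Context {R : realType}.

Lemma compact_norm_le (n : nat) (K : R) : compact [set v : 'rV[R]_n | `|v| <= K].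
Proof.
apply: bounded_closed_compact.
  exists K; split; first by rewrite num_real.
  by move=> M KM x xK; apply: le_trans xK (ltW KM).
have := @preimage_closed _ _ (fun v : 'rV[R]_n => `|v|) [set y : R | y <= K].
apply; last exact: closed_le.
by move=> x _; exact: norm_continuous.
Qed.

(** The set is the image of a box of row vectors under the symmetrization [S], which is 1-Lipschitz
    for the sup norm. *)
Lemma compact_symmx_norm_le (n : nat) (K : R) :
  compact [set M : 'M[R]_n.+1 | symmx M /\ `|M| <= K].
Proof.
pose S (v : 'rV[R]_(n.+1 * n.+1)) : 'M[R]_n.+1 := 2^-1 *: (vec_mx v + (vec_mx v)^T).
have Sle v w : `|S v - S w| <= `|v - w|.
  apply: mx_norm_leP => // i j.
  have h k : `|v 0 k - w 0 k| <= `|v - w|.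
    by have := mx_coord_le_norm _ _ (v - w) 0 k; rewrite !mxE.
  have := h (mxvec_index i j); have := h (mxvec_index j i).
  rewrite !mxE; set a := v _ _; set b := w _ _; set c := v _ _; set d := w _ _.
  move=> h1 h2.
  have -> : 2^-1 * (c + a) - 2^-1 * (d + b) = 2^-1 * ((a - b) + (c - d)) by ring.
  rewrite normrM gtr0_norm ?invr_gt0//.
  by have := ler_normD (a - b) (c - d); lra.
have Sc : continuous S.
  move=> v; apply/(@cvgrPdist_lt _ _ _ (nbhs v) (nbhs_filter v)) => e e0.
  apply/nbhs_ballP; exists e => // w; rewrite mx_norm_ball /ball_ /= => vw.
  exact: le_lt_trans (Sle v w) vw.
have -> : [set M : 'M[R]_n.+1 | symmx M /\ `|M| <= K] =
    S @` [set v | `|v| <= K].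
  apply/seteqP; split=> [M [sM MK]|_ [v /= vK <-]] /=.
    exists (mxvec M) => /=.
      have K0 : 0 <= K by apply: le_trans MK.
      apply: mx_norm_leP => // i k; rewrite (ord1 i).
      case/mxvec_indexP: k => a b; rewrite mxvecE.
      by apply: le_trans MK; exact: mx_coord_le_norm.
    apply/matrixP => i j; rewrite /S mxvecK sM !mxE.
    by field.
  split.
    by apply/matrixP => i j; rewrite !mxE addrC.
  have := Sle v 0; rewrite subr0 => h; apply: le_trans vK; apply: le_trans h.
  by rewrite /S !linear0 addr0 scaler0 subr0.
apply: continuous_compact; last exact: compact_norm_le.
exact: continuous_subspaceT.
Qed.

Lemma compact_fun_bounded (T : topologicalType) (f : T -> R) (A : set T) :
  compact A -> {within A, continuous f} ->
  exists K : R, forall x, A x -> `|f x| <= K.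
Proof.
move=> cA fc; have [M [_ hM]] := compact_bounded (continuous_compact fc cA).
exists (M + 1) => x Ax; apply: (hM (M + 1)); first by rewrite ltrDl.
by exists x.
Qed.

Lemma cvg_bigsum (T : Type) (F : set_system T) (FF : Filter F) (I : Type)
  (r : seq I) (f : I -> T -> R) (l : I -> R) :
  (forall i, f i x @[x --> F] --> l i) ->
  \sum_(i <- r) f i x @[x --> F] --> \sum_(i <- r) l i.
Proof.
move=> h; elim: r => [|i r IH].
  rewrite big_nil; under eq_fun do rewrite big_nil; exact: cvg_cst.
rewrite big_cons; under eq_fun do rewrite big_cons; exact: cvgD.
Qed.

End CompactSets.

Section Jets.
Context {R : realType} {n : nat}.
Notation V := 'rV[R]_n.+1.
Notation J := ('rV[R]_n.+1 * R * 'rV[R]_n.+1 * 'M[R]_n.+1)%type.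
Implicit Types (x p q : V) (s : R) (M N A : 'M[R]_n.+1) (a b d : J).

(** With [x] fixed, [dirS], [dirP] and [dirM] span the directions of the jets. [dirM i j] carries
    the symmetric part of [delta_mx i j], since derivatives of [F] are known along symmetric
    matrices only. *)
Definition dirS : J := (0, 1, 0, 0).
Definition dirP (i : 'I_n.+1) : J := (0, 0, delta_mx 0 i, 0).
Definition dirM (i j : 'I_n.+1) : J :=
  (0, 0, 0, 2^-1 *: (delta_mx i j + delta_mx j i)).

Lemma symmxD M N : symmx M -> symmx N -> symmx (M + N).
Proof. by rewrite /symmx /= => h1 h2; rewrite linearD /= h1 h2. Qed.

Lemma symmxZ (c : R) M : symmx M -> symmx (c *: M).
Proof. by rewrite /symmx /= => h; rewrite linearZ /= h. Qed.

Lemma symmx0 : symmx (0 : 'M[R]_n.+1).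
Proof. by rewrite /symmx /= linear0. Qed.

Lemma symmx_dir i j : symmx (2^-1 *: (delta_mx i j + delta_mx j i) : 'M[R]_n.+1).
Proof. by apply: symmxZ; rewrite /symmx /= linearD /= !trmx_delta addrC. Qed.

Lemma jetsD a b : jets setT a -> jets setT b -> jets setT (a + b).
Proof. by move=> [_ h1] [_ h2]; split => //; exact: symmxD. Qed.

Lemma jetsZ (c : R) a : jets setT a -> jets setT (c *: a).
Proof. by move=> [_ h]; split => //; exact: symmxZ. Qed.

Lemma jets0 : jets setT (0 : J).
Proof. by split => //; exact: symmx0. Qed.

Lemma jet_decomposition s p N : symmx N -> (0, s, p, N) =
  s *: dirS + \sum_i p 0 i *: dirP i + \sum_i \sum_j N i j *: dirM i j.
Proof.
move=> sN.
pose inP q : J := (0, 0, q, 0); pose inM M : J := (0, 0, 0, M).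
have inPD q q' : inP (q + q') = inP q + inP q'.
  by apply: injective_projections => /=; [apply: injective_projections => /=;
    [apply: injective_projections => /=|]|]; rewrite ?addr0.
have inMD M M' : inM (M + M') = inM M + inM M'.
  by apply: injective_projections => /=; [apply: injective_projections => /=;
    [apply: injective_projections => /=|]|]; rewrite ?addr0.
have -> : \sum_i p 0 i *: dirP i = inP p.
  rewrite [p in RHS]row_sum (big_morph inP inPD erefl); apply: eq_bigr => i _.
  apply: injective_projections => /=; [apply: injective_projections => /=;
    [apply: injective_projections => /=|]|]; by rewrite ?scaler0 //= mulr0.
have -> : \sum_i \sum_j N i j *: dirM i j = inM N.
  transitivity (inM (\sum_i \sum_j N i j *: (2^-1 *: (delta_mx i j + delta_mx j i)))).
    rewrite (big_morph inM inMD erefl); apply: eq_bigr => i _.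
    rewrite (big_morph inM inMD erefl); apply: eq_bigr => j _.
    apply: injective_projections => /=; [apply: injective_projections => /=;
      [apply: injective_projections => /=|]|]; by rewrite ?scaler0 //= mulr0.
  congr inM.
  have e : \sum_i \sum_j N i j *: delta_mx j i = N^T.
    rewrite [N in RHS]matrix_sum_delta linear_sum; apply: eq_bigr => i _.
    rewrite linear_sum; apply: eq_bigr => j _.
    by rewrite linearZ /= trmx_delta.
  transitivity (2^-1 *: (N + N^T)).
    rewrite -e [X in _ *: (X + _)]matrix_sum_delta -big_split scaler_sumr.
    apply: eq_bigr => i _; rewrite -big_split scaler_sumr; apply: eq_bigr => j _.
    rewrite -[X in _ = 2^-1 *: X]/(N i j *: delta_mx i j + N i j *: delta_mx j i).
    by rewrite -scalerDr !scalerA mulrC.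
  by rewrite sN; apply/matrixP => i j; rewrite !mxE; field.
apply: injective_projections => /=; [apply: injective_projections => /=;
  [apply: injective_projections => /=|]|]; rewrite ?scaler0 ?addr0 ?add0r//.
exact: esym (mulr1 _).
Qed.

Variable F : V -> R -> V -> 'M[R]_n.+1 -> R.
Hypothesis F_C1 : C1_on_jets F.
Hypothesis F_elliptic : forall x s p M,
  (ecball 1 `\ 0) x -> symmx M -> posdefmx (dsym (F x s p) M).

Let f (a : J) := F a.1.1.1 a.1.1.2 a.1.2 a.2.

Lemma near_jet (P : set V) a : (\forall x \near a.1.1.1, P x) ->
  \forall b \near a, P b.1.1.1.
Proof.
move=> h.
have c : b.1.1.1 @[b --> a] --> a.1.1.1.
  case: a h => [[[x s] p] M] _ /=.
  apply: (@cvg_comp _ _ _ (fun b : J => b.1.1) (fun c : V * R => c.1)).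
    apply: (@cvg_comp _ _ _ (fun b : J => b.1) (fun c : V * R * V => c.1)).
      exact: cvg_fst.
    exact: cvg_fst.
  exact: cvg_fst.
exact: (c _ h).
Qed.

Lemma jets_closure a : jets (eball 1 `\ 0) a -> jets (ecball 1 `\ 0) a.
Proof. by move=> [h1 h2]; split => //; exact: punctured_closure. Qed.

Lemma F_derivable d a : jets setT d -> jets (eball 1 `\ 0) a -> derivable f a d.
Proof. by move=> Wd Oa; have [_ h] := F_C1; have [+ _] := h d Wd; apply. Qed.

Lemma F_extension d : jets setT d -> exists2 g : J -> R,
  {within jets (ecball 1 `\ 0), continuous g} &
  forall a, jets (eball 1 `\ 0) a -> g a = 'D_d f a.
Proof.
move=> Wd; have [_ h] := F_C1; have [_ [g [gc _] gd]] := h d Wd.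
by exists g.
Qed.

Lemma within_cvg_near (g : J -> R) (D : set J) a :
  {within D, continuous g} -> D a ->
  forall e : R, 0 < e -> \forall x \near a, D x -> `|g x - g a| < e.
Proof.
move=> /subspace_continuousP gD Da e e0.
have /cvgrPdist_lt/(_ e e0) := gD a Da.
rewrite /within /= => h.
have {}h : \forall x \near a, D x -> `|g a - g x| < e by exact: h.
by apply: filterS h => x h Dx; rewrite distrC; exact: h.
Qed.

Lemma F_C1_at a : jets (eball 1 `\ 0) a -> C1_at (jets setT) f a.
Proof.
move=> Oa d Wd; have nO := near_jet _ _ (near_punctured _ Oa.1).
split.
  by apply: filterS nO => b Ob [_ sb]; exact: F_derivable.
have [g gc gd] := F_extension _ Wd => e e0.
have := within_cvg_near _ _ _ gc (jets_closure _ Oa) _ e0.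
move: nO; apply: filterS2 => b Ob + [_ sb].
have Ojb : jets (eball 1 `\ 0) b by [].
by rewrite !gd//; apply; exact: jets_closure.
Qed.

Definition coefM a : 'M[R]_n.+1 := \matrix_(i, j) 'D_(dirM i j) f a.
Definition coefP a : V := \row_i 'D_(dirP i) f a.
Definition coefS a : R := 'D_dirS f a.

Lemma F_derive a s p N : jets (eball 1 `\ 0) a -> symmx N ->
  'D_(0, s, p, N) f a = mxdot (coefM a) N + edot (coefP a) p + coefS a * s.
Proof.
move=> Oa sN; have Wa : jets setT a by case: Oa.
have Ca := F_C1_at _ Oa.
have WS : jets setT dirS by split => //; exact: symmx0.
have WP i : jets setT (dirP i) by split => //; exact: symmx0.
have WM i j : jets setT (dirM i j) by split => //; exact: symmx_dir.
have dZ c d : jets setT d -> 'D_(c *: d) f a = c * 'D_d f a.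
  by move=> Wd; have [] := @is_derive_dirZ _ _ f a d c (F_derivable _ _ Wd Oa).
have Wsum (I : Type) (r : seq I) (h : I -> J) : (forall i, jets setT (h i)) ->
    jets setT (\sum_(i <- r) h i).
  move=> Wh; apply: big_rec => [|i y _ Wy]; first exact: jets0.
  exact: jetsD.
have dsum (I : Type) (r : seq I) (h : I -> J) : (forall i, jets setT (h i)) ->
    'D_(\sum_(i <- r) h i) f a = \sum_(i <- r) 'D_(h i) f a.
  move=> Wh; have [] := @C1_at_sum _ _ (jets setT) jets0 jetsD jetsZ f a _ r h Wa Ca Wh.
  by [].
have dD d d' : jets setT d -> jets setT d' ->
    'D_(d + d') f a = 'D_d f a + 'D_d' f a.
  move=> Wd Wd'.
  have := dsum bool [:: true; false] (fun b : bool => if b then d else d').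
  by rewrite !big_cons !big_nil !addr0 => h; apply: h => -[].
rewrite (jet_decomposition _ _ _ sN) !dD//; last 4 first.
- exact: jetsZ.
- by apply: Wsum => i; exact: jetsZ.
- by apply: jetsD; [exact: jetsZ|apply: Wsum => i; exact: jetsZ].
- by apply: (@Wsum) => i; apply: (@Wsum) => j; exact: jetsZ.
rewrite dZ// dsum; last by move=> i; exact: jetsZ.
rewrite dsum; last by move=> i; apply: (@Wsum) => j; exact: jetsZ.
have -> : \sum_i 'D_(p 0 i *: dirP i) f a = edot (coefP a) p.
  by apply: eq_bigr => i _; rewrite dZ// mxE mulrC.
have -> : \sum_i 'D_(\sum_j N i j *: dirM i j) f a = mxdot (coefM a) N.
  apply: eq_bigr => i _; rewrite dsum; last by move=> j; exact: jetsZ.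
  by apply: eq_bigr => j _; rewrite dZ// mxE mulrC.
by rewrite -addrA addrC [edot _ _ + _]addrC [s * _]mulrC.
Qed.

Lemma F_mvt x s p M s' p' N : (eball 1 `\ 0) x -> symmx M -> symmx N ->
  exists2 t : R, 0 <= t <= 1 &
    let a : J := (x, s + t * s', p + t *: p', M + t *: N) in
    F x (s + s') (p + p') (M + N) - F x s p M =
    mxdot (coefM a) N + edot (coefP a) p' + coefS a * s'.
Proof.
move=> Ox sM sN.
pose a : J := (x, s, p, M); pose d : J := (0, s', p', N).
have Wd : jets setT d by [].
have aE (t : R) : a + t *: d = (x, s + t * s', p + t *: p', M + t *: N).
  by rewrite /a /d; apply: injective_projections => /=;
   [apply: injective_projections => /=; [apply: injective_projections => /=|]|];
   rewrite ?scaler0 ?addr0.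
have Oa t : jets (eball 1 `\ 0) (a + t *: d).
  by rewrite aE; split => //; apply: symmxD => //; exact: symmxZ.
have [t _|t t01] := @MVT_line _ _ f a d 1; first exact: F_derivable.
rewrite mul1r mulr1 F_derive// => e; exists t => //=; rewrite -aE -e.
by rewrite aE /f /= mul1r scale1r scale1r.
Qed.

(* At a boundary point [x], where nothing is assumed on the differentiability
   of [F], the derivative is obtained from the points [(1 - c) *: x]. *)
Lemma F_extension_derive x s p M N (g : J -> R) :
  (ecball 1 `\ 0) x -> symmx M -> symmx N ->
  {within jets (ecball 1 `\ 0), continuous g} ->
  (forall a, jets (eball 1 `\ 0) a -> g a = 'D_(0, 0, 0, N) f a) ->
  'D_N (F x s p) M = g (x, s, p, M).
Proof.
move=> Dx sM sN gc gd.
suff H : h^-1 *: ((F x s p \o shift M) (h *: N) - F x s p M) @[h --> (0 : R)^']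
    --> g (x, s, p, M) by exact: cvg_lim H.
apply/cvgrPdist_le => e e0.
have Da : jets (ecball 1 `\ 0) (x, s, p, M) by [].
have /nbhs_ballP[r /= r0 Hr] := within_cvg_near _ _ _ gc Da _ e0.
have N0 : 0 < `|N| + 1 by rewrite ltr_wpDl.
near=> h.
have h0 : h != 0 by near: h; exact: nbhs_dnbhs_neq.
have hr : `|h| < r / (`|N| + 1).
  by near: h; apply: dnbhs0_lt; rewrite divr_gt0.
have {}hr : `|h| * `|N| < r.
  apply: (@le_lt_trans _ _ (`|h| * (`|N| + 1))).
    by rewrite ler_wpM2l// lerDl.
  by rewrite -ltr_pdivlMr.
suff H : `|F x s p (M + h *: N) - F x s p M - h * g (x, s, p, M)| <= `|h| * e.
  rewrite /= /shift /= (addrC (h *: N)) -[_ *: _]/(_ * _).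
  have -> : g (x, s, p, M) - h^-1 * (F x s p (M + h *: N) - F x s p M) =
    - h^-1 * (F x s p (M + h *: N) - F x s p M - h * g (x, s, p, M)) by field.
  by rewrite normrM normrN normfV ler_pdivrMl ?normr_gt0.
(* With [h] fixed, [eta] is the price of replacing [x] by an interior point; it can be made
   arbitrarily small because [F] is continuous up to the sphere. *)
apply/ler_addgt0Pr => eta eta0.
have [fc _] := F_C1.
have eta20 : 0 < eta / 2 by rewrite divr_gt0.
have Da' : jets (ecball 1 `\ 0) (x, s, p, M + h *: N).
  by split => //; apply: symmxD => //; exact: symmxZ.
have /nbhs_ballP[r1 /= r10 H1] := within_cvg_near _ _ _ fc Da _ eta20.
have /nbhs_ballP[r2 /= r20 H2] := within_cvg_near _ _ _ fc Da' _ eta20.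
(* [2^-1] keeps [y] away from 0. The other bound changes each of the two values of [F] by less than
   [eta / 2], and leaves [g] at the intermediate jet within [e] of its value at the original one. *)
pose c := Num.min (2^-1) (Num.min r (Num.min r1 r2) / (`|x| + 1) / 2).
have x0 : 0 < `|x| + 1 by rewrite ltr_wpDl.
have m0 : 0 < Num.min r (Num.min r1 r2) by rewrite !lt_min r0 r10.
have c0 : 0 < c by rewrite lt_min invr_gt0 ltr0n !divr_gt0.
have c1 : c <= 2^-1 by rewrite ge_min lexx.
have cx : `|c *: x| < Num.min r (Num.min r1 r2).
  rewrite normrZ gtr0_norm//; apply: (@le_lt_trans _ _ (c * (`|x| + 1))).
    by rewrite ler_wpM2l ?lerDl// ltW.
  rewrite -ltr_pdivlMr//.
  apply: (@le_lt_trans _ _ (Num.min r (Num.min r1 r2) / (`|x| + 1) / 2)).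
    by rewrite ge_min lexx orbT.
  by have := divr_gt0 m0 x0; lra.
pose y := (1 - c) *: x.
have xy : `|x - y| < Num.min r (Num.min r1 r2).
  by have -> : x - y = c *: x by rewrite /y scalerBl scale1r opprB addrCA subrr addr0.
have Oy : (eball 1 `\ 0) y.
  have [x1 xn0] := Dx; have xn0' : x != 0 by apply/eqP.
  split; last first.
    move=> /eqP; rewrite scaler_eq0 (negbTE xn0') orbF subr_eq0 => /eqP e1.
    by move: c1; rewrite -e1; lra.
  rewrite /eball /= enormZ ger0_norm; last lra.
  have : 0 < enorm x by rewrite enorm_gt0.
  by move: x1; rewrite /ecball /=; nra.
have Djy M' : symmx M' -> jets (ecball 1 `\ 0) (y, s, p, M').
  by move=> ?; split => //; exact: punctured_closure.
have [t t01 /=] := F_mvt y s p M 0 0 (h *: N) Oy sM (symmxZ _ _ sN).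
rewrite !addr0 mulr0 scaler0 !addr0.
set b : J := (y, s, p, M + t *: (h *: N)).
have Ob : jets (eball 1 `\ 0) b.
  by split => //; apply: symmxD => //; do 2 apply: symmxZ.
rewrite -F_derive//; last exact: symmxZ.
have -> : (0, 0, 0, h *: N) = h *: ((0, 0, 0, N) : J).
  by apply: injective_projections => /=;
   [apply: injective_projections => /=; [apply: injective_projections => /=|]|];
   rewrite ?scaler0 ?mulr0.
have WN : jets setT ((0, 0, 0, N) : J) by [].
have [_ ->] := @is_derive_dirZ _ _ f b (0, 0, 0, N) h (F_derivable _ _ WN Ob).
rewrite -gd// => mvt.
have ballE (r' : R) M1 M2 : 0 < r' -> `|x - y| < r' -> `|M1 - M2| < r' ->
   ball ((x, s, p, M1) : J) r' ((y, s, p, M2) : J).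
  move=> r'0 h1 h2; split; [split; [split|]|] => /=.
  - by rewrite mx_norm_ball.
  - exact: ballxx.
  - exact: ballxx.
  - by rewrite mx_norm_ball.
move: xy; rewrite !lt_min => /and3P[xyr xyr1 xyr2].
have G : `|g b - g (x, s, p, M)| < e.
  apply: Hr; last exact: jets_closure.
  apply: ballE => //; rewrite opprD addrA subrr add0r normrN normrZ.
  rewrite normrZ; apply: le_lt_trans hr; rewrite ler_piMl ?mulr_ge0//.
  by rewrite ger0_norm; lra.
have F1 : `|F y s p M - F x s p M| < eta / 2.
  by apply: (H1 (y, s, p, M)); [apply: ballE => //; rewrite subrr normr0|exact: Djy].
have F2 : `|F y s p (M + h *: N) - F x s p (M + h *: N)| < eta / 2.
  apply: (H2 (y, s, p, M + h *: N)); first by apply: ballE => //; rewrite subrr normr0.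
  by apply: Djy; apply: symmxD => //; exact: symmxZ.
have -> : F x s p (M + h *: N) - F x s p M - h * g (x, s, p, M) =
  h * (g b - g (x, s, p, M)) + (F y s p M - F x s p M)
   - (F y s p (M + h *: N) - F x s p (M + h *: N)).
  by rewrite mulrBr -mvt; ring.
apply: le_trans (ler_normB _ _) _.
have := ler_normD (h * (g b - g (x, s, p, M))) (F y s p M - F x s p M).
rewrite normrM.
have : `|h| * `|g b - g (x, s, p, M)| <= `|h| * e by rewrite ler_wpM2l// ltW.
lra.
Unshelve. all: by end_near. Qed.

(** Ellipticity is assumed for genuine derivatives of [F], also at points of the sphere. Identifying
    these with the continuous extension shows that the extension is positive definite up to the
    sphere, and compactness can then give a uniform constant. *)
Lemma coefM_extension : exists2 A : J -> 'M[R]_n.+1,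
  (forall i j, {within jets (ecball 1 `\ 0), continuous (fun a => A a i j)}) &
  (forall a, jets (eball 1 `\ 0) a -> A a = coefM a) /\
  (forall a, jets (ecball 1 `\ 0) a -> posdefmx (A a)).
Proof.
have WM i j : jets setT (dirM i j) by split => //; exact: symmx_dir.
have /choice[g Hg] : forall ij : 'I_n.+1 * 'I_n.+1, exists g : J -> R,
    {within jets (ecball 1 `\ 0), continuous g} /\
    forall a, jets (eball 1 `\ 0) a -> g a = 'D_(dirM ij.1 ij.2) f a.
  by move=> ij; have [g gc gd] := F_extension _ (WM ij.1 ij.2); exists g.
pose A (a : J) : 'M[R]_n.+1 := \matrix_(i, j) g (i, j) a.
exists A.
  move=> i j; have -> : (fun a => A a i j) = g (i, j).
    by apply/funext => a; rewrite mxE.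
  by have [] := Hg (i, j).
split=> [a Oa|[[[x s] p] M] [Dx sM]].
  by apply/matrixP => i j; rewrite !mxE; have [_ ->] := Hg (i, j).
have -> : A (x, s, p, M) = dsym (F x s p) M; last exact: F_elliptic.
apply/matrixP => i j; rewrite !mxE.
have [gc gd] := Hg (i, j).
by rewrite (F_extension_derive _ _ _ _ _ _ Dx sM (symmx_dir i j) gc gd).
Qed.

Lemma F_monotone x s p M N : (eball 1 `\ 0) x -> symmx M -> symmx N ->
  (forall v, 0 <= qform N v) -> F x s p M <= F x s p (M + N).
Proof.
move=> Ox sM sN pN; rewrite -subr_ge0.
have [t t01 /=] := F_mvt x s p M 0 0 N Ox sM sN.
rewrite !addr0 => ->.
set a : J := (_, _, _, _).
have Oa : jets (eball 1 `\ 0) a.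
  by split => //; apply: symmxD => //; exact: symmxZ.
rewrite mulr0 addr0 edotC edot0l addr0.
apply: mxdot_psd_ge0 => // v.
have [A _ [AO AD]] := coefM_extension.
have [_ h] := AD a (jets_closure _ Oa).
have [->|v0] := eqVneq v 0; first by rewrite /qform mul0mx edot0l.
by rewrite -AO// -qform_mx ltW// h.
Qed.

Definition jet_box (rho K : R) : set J :=
  ([set x | rho <= enorm x <= 1] `*` [set s | - K <= s <= K] `*`
   [set p | `|p| <= K] `*` [set M | symmx M /\ `|M| <= K]).

Lemma compact_jet_box rho K : compact (jet_box rho K).
Proof.
apply: compact_setX; last exact: compact_symmx_norm_le.
apply: compact_setX; last exact: compact_norm_le.
apply: compact_setX; first exact: compact_shell.
have -> : [set s | - K <= s <= K] = `[- K, K]%classic.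
  by apply/seteqP; split=> s /=; rewrite in_itv.
exact: segment_compact.
Qed.

Lemma jet_box_sub rho K : 0 < rho -> jet_box rho K `<=` jets (ecball 1 `\ 0).
Proof.
move=> r0 [[[x s] p] M] /= [[[h1 _] _] [h2 _]]; split => //.
exact: shell_sub r0 _ h1.
Qed.

Lemma continuous_within_fst (T U : topologicalType) (g : T -> R) (A : set T)
  (B : set U) : {within A, continuous g} ->
  {within A `*` B, continuous (fun z => g z.1)}.
Proof.
move=> /subspace_continuousP gA; apply/subspace_continuousP => -[x y] [/= Ax By].
move=> S gS; have h := gA x Ax S gS.
have c : z.1 @[z --> (x, y)] --> x by exact: cvg_fst.
have {}h : \forall x' \near x, A x' -> S (g x') by exact: h.
have : \forall z \near (x, y), A z.1 -> S (g z.1) by exact: (c _ h).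
by rewrite /within /=; apply: filterS => z Hz [Az _]; exact: Hz.
Qed.

(** The minimum over [K] times the unit sphere is attained and positive; homogeneity does the
    rest. *)
Lemma uniform_ellipticity (A : J -> 'M[R]_n.+1) (K : set J) : compact K ->
  (forall i j, {within K, continuous (fun a => A a i j)}) ->
  (forall a, K a -> posdefmx (A a)) ->
  exists2 th : R, 0 < th & forall a v, K a -> th * edot v v <= qform (A a) v.
Proof.
move=> cK Ac Ap.
have [[a0 Ka0]|K0] := pselect (K !=set0); last first.
  by exists 1 => // a v Ka; exfalso; apply: K0; exists a.
pose S : set V := [set v | edot v v = 1].
have cS : compact S.
  apply: (@compact_ecball _ _ _ 1) => [|v Sv]; last first.
    by rewrite /ecball /= /enorm Sv sqrtr1.
  have -> : S = [set v | 1 <= enorm v] `&` ecball 1.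
    apply/seteqP; split=> v /=; rewrite /S /ecball /= /enorm.
      by move=> ->; rewrite sqrtr1.
    move=> [h1 h2]; rewrite -enorm_sqr /enorm.
    by rewrite (@le_anti _ _ (Num.sqrt (edot v v)) 1) ?h1 ?h2// expr1n.
  by apply: closedI; [exact: closed_le_enorm|exact: closed_ecball].
pose h (z : J * V) := qform (A z.1) z.2.
have hc : {within K `*` S, continuous h}.
  have -> : h = (fun z => \sum_i \sum_j A z.1 i j * (z.2 0 i * z.2 0 j)).
    by apply/funext => z; rewrite /h qformE.
  have c2 (i : 'I_n.+1) (z0 : J * V) :
      (fun z : J * V => z.2 0 i) z @[z --> within (K `*` S) (nbhs z0)] --> z0.2 0 i.
    apply: cvg_within_filter.
    apply: (@cvg_comp _ _ _ (fun z : J * V => z.2) (fun v : V => v 0 i)).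
      by case: z0 => ? ?; exact: cvg_snd.
    exact: continuous_coord.
  apply/subspace_continuousP => z0 Kz0.
  apply: cvg_bigsum => i; apply: cvg_bigsum => j.
  apply: cvgM; last by apply: cvgM; exact: c2.
  have /subspace_continuousP := continuous_within_fst _ _ _ K S (Ac i j).
  exact.
have ne : (K `*` S) !=set0.
  exists (a0, delta_mx 0 0); split => //=.
  rewrite /S /= /edot (bigD1 0)//= big1 => [|i i0].
    by rewrite mxE !eqxx mul1r addr0.
  by rewrite mxE (negbTE i0) andbF mul0r.
have [[a v] /set_mem[/= Ka Sv] hmin] := compact_EVT_min ne (compact_setX cK cS) hc.
have [_ av] := Ap a Ka.
have v0 : v != 0.
  by apply/eqP => v0; move: Sv; rewrite /S /= v0 edot0l => /esym/eqP; rewrite oner_eq0.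
exists (h (a, v)); first by rewrite /h /= -qform_mx; exact: av.
move=> b w Kb.
have [->|w0] := eqVneq w 0; first by rewrite edot0l mulr0 /qform mul0mx edot0l.
have w1 : 0 < enorm w by rewrite enorm_gt0.
have Sw : S ((enorm w)^-1 *: w).
  by rewrite /S /= edotZl edotZr -enorm_sqr; field; rewrite gt_eqF.
have := hmin (b, (enorm w)^-1 *: w); rewrite in_setE /h /= qform_scale.
move=> /(_ (conj Kb Sw)); rewrite exprVn mulrC ler_pdivlMr ?exprn_gt0//.
by rewrite enorm_sqr.
Qed.

(** On the shell the jets of [u] are bounded by some [K], and increments of size at most 1 keep the
    whole segment of jets in the compact box of size [K + 1]. Hence [th] and [C] depend on neither
    the point nor the increment, while the coefficients are those at an unknown jet of the
    segment. *)
Lemma linearization u (rho : R) : C2_on_punctured_cball u -> 0 < rho ->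
  exists th C : R, [/\ 0 < th, 0 < C & forall x s p N, rho <= enorm x < 1 ->
    symmx N -> `|s| <= 1 -> `|p| <= 1 -> `|N| <= 1 ->
    exists (A : 'M[R]_n.+1) (B : V) (c : R),
    [/\ forall v, th * edot v v <= qform A v,
        forall i j, `|A i j| <= C, forall i, `|B 0 i| <= C, `|c| <= C &
        F x (u x + s) (gradient u x + p) (hessian u x + N) -
        F x (u x) (gradient u x) (hessian u x) =
        mxdot A N + edot B p + c * s]].
Proof.
move=> u_C2 r0; have [K K0 HK] := C2_jet_bounded _ u_C2 _ r0.
pose Q := jet_box rho (K + 1).
have cQ : compact Q by exact: compact_jet_box.
have QD : Q `<=` jets (ecball 1 `\ 0) by exact: jet_box_sub.
have [A Ac [AO AD]] := coefM_extension.
have AcQ i j : {within Q, continuous (fun a => A a i j)}.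
  exact: continuous_subspaceW QD (Ac i j).
have [th th0 Hth] := uniform_ellipticity A Q cQ AcQ (fun a Qa => AD a (QD a Qa)).
have WS : jets setT dirS by split => //; exact: symmx0.
have WP i : jets setT (dirP i) by split => //; exact: symmx0.
have bound d : jets setT d -> exists K : R, forall a, Q a ->
    jets (eball 1 `\ 0) a -> `|'D_d f a| <= K.
  move=> Wd; have [g gc gd] := F_extension _ Wd.
  have [L HL] := compact_fun_bounded _ _ _ cQ (continuous_subspaceW QD gc).
  by exists L => a Qa Oa; rewrite -gd//; exact: HL.
have /choice[LP HLP] : forall i, exists L : R, forall a, Q a ->
    jets (eball 1 `\ 0) a -> `|'D_(dirP i) f a| <= L by move=> i; exact: bound.
have [LS HLS] := bound _ WS.
have /choice[LM HLM] : forall ij : 'I_n.+1 * 'I_n.+1, exists L : R, forall a, Q a ->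
    `|A a ij.1 ij.2| <= L.
  by move=> ij; exact: compact_fun_bounded cQ (AcQ ij.1 ij.2).
pose SP := \sum_i `|LP i|; pose SM := \sum_ij `|LM ij|.
have SP0 : 0 <= SP by exact: sumr_ge0.
have SM0 : 0 <= SM by exact: sumr_ge0.
pose C := `|LS| + SP + SM + 1.
have C0 : 0 < C by rewrite /C ltr_wpDl// !addr_ge0.
have CS : LS <= C by have := ler_norm LS; rewrite /C; lra.
have CP i : LP i <= C.
  have : LP i <= SP.
    apply: le_trans (ler_norm _) _.
    by rewrite /SP (bigD1 i)//= lerDl sumr_ge0.
  by have := normr_ge0 LS; rewrite /C; lra.
have CM ij : LM ij <= C.
  have : LM ij <= SM.
    apply: le_trans (ler_norm _) _.
    by rewrite /SM (bigD1 ij)//= lerDl sumr_ge0.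
  by have := normr_ge0 LS; rewrite /C; lra.
exists th, C; split => // x s p N xr sN s1 p1 N1.
have Ox : (eball 1 `\ 0) x.
  move: xr => /andP[h1 h2]; split => // x0; move: h1.
  by rewrite x0 enorm0 leNgt r0.
have sH := C2_hessian_sym _ u_C2 _ Ox.
have [t t01 /= ->] := F_mvt x (u x) (gradient u x) (hessian u x) s p N Ox sH sN.
set a : J := (_, _, _, _).
have Oa : jets (eball 1 `\ 0) a.
  by split => //; apply: symmxD => //; exact: symmxZ.
have [u1 g1 h1] := HK x xr.
have tle (r : R) : 0 <= r -> r <= 1 -> `|t| * r <= 1.
  by move=> r_ge0 r1; rewrite ger0_norm; [nra|lra].
have Qa : Q a.
  split; [split; [split|]|] => /=.
  - by move: xr => /andP[-> /ltW].
  - rewrite -ler_norml; apply: le_trans (ler_normD _ _) _.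
    by rewrite lerD// normrM tle.
  - apply: le_trans (ler_normD _ _) _.
    by rewrite lerD// normrZ tle.
  - split; first by apply: symmxD => //; exact: symmxZ.
    apply: le_trans (ler_normD _ _) _.
    by rewrite lerD// normrZ tle.
exists (A a), (coefP a), (coefS a); split.
- by move=> v; exact: Hth.
- by move=> i j; apply: le_trans (CM (i, j)); exact: (HLM (i, j)).
- by move=> i; rewrite mxE; apply: le_trans (CP i); exact: HLP.
- by apply: le_trans CS; exact: HLS.
- by rewrite AO.
Qed.

End Jets.

(** * Reflections and comparison *)

Section Mirror.
Context {R : realType} {n : nat}.
Implicit Types (x y p v : 'rV[R]_n.+1) (M N : 'M[R]_n.+1) (l t : R).

(** Written through [set_x1], so that it is literally the point at which the hypothesis on [F] is
    stated. *)
Definition mirror l x := set_x1 x (2 * l - x 0 0).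

Lemma hatvZ t v : hatv (t *: v) = t *: hatv v.
Proof. by apply/rowP => i; rewrite !mxE; case: ifP => _ //; rewrite mulrN. Qed.

Lemma hatvK p : hatv (hatv p) = p.
Proof. by apply/rowP => i; rewrite !mxE; case: (i == 0); rewrite ?opprK. Qed.

Lemma hatmxK M : hatmx (hatmx M) = M.
Proof. by apply/matrixP => i j; rewrite !mxE; case: (_ (+) _); rewrite ?opprK. Qed.

Lemma symmx_hat M : symmx M -> symmx (hatmx M).
Proof.
move=> sM; apply/matrixP => i j; rewrite !mxE addbC.
by have -> : M j i = M i j by rewrite -[in LHS]sM mxE.
Qed.

Lemma edot_hat p v : edot (hatv p) v = edot p (hatv v).
Proof.
by apply: eq_bigr => i _; rewrite !mxE; case: ifP => _ //; rewrite mulNr mulrN.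
Qed.

Lemma qform_hat M v : qform (hatmx M) v = qform M (hatv v).
Proof.
rewrite !qformE; apply: eq_bigr => i _; apply: eq_bigr => j _; rewrite !mxE.
by case: (i == 0); case: (j == 0) => //=; ring.
Qed.

Lemma mirror00 l x : mirror l x 0 0 = 2 * l - x 0 0.
Proof. by rewrite mxE eqxx. Qed.

Lemma mirrorE l x i : i != 0 -> mirror l x 0 i = x 0 i.
Proof. by rewrite mxE => /negbTE ->. Qed.

Lemma mirrorK l x : mirror l (mirror l x) = x.
Proof.
apply/rowP => i; rewrite mxE mirror00.
by case: eqVneq => [->|i0]; [ring|exact: mirrorE].
Qed.

Lemma mirror_fix l x : x 0 0 = l -> mirror l x = x.
Proof.
by move=> e; apply/rowP => i; rewrite mxE; case: eqVneq => // ->; rewrite e; ring.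
Qed.

Lemma mirrorD l x v : mirror l (x + v) = mirror l x + hatv v.
Proof. by apply/rowP => i; rewrite !mxE; case: eqVneq => [->|_ //]; ring. Qed.

Lemma mirrorB l x y : mirror l x - mirror l y = hatv (x - y).
Proof.
have {1}-> : x = y + (x - y) by rewrite addrCA subrr addr0.
by rewrite mirrorD addrAC subrr add0r.
Qed.

Lemma enorm_hatv v : enorm (hatv v) = enorm v.
Proof. by rewrite /enorm edot_hat hatvK. Qed.

Lemma edot_mirror l x :
  edot (mirror l x) (mirror l x) = edot x x - 4 * l * (x 0 0 - l).
Proof.
rewrite /edot (bigD1 0)//= [in RHS](bigD1 0)//= mirror00.
rewrite (eq_bigr (fun i => x 0 i * x 0 i)); last by move=> i i0; rewrite mirrorE.
by ring.
Qed.

Lemma enorm_mirror_lt l x : 0 < l -> l < x 0 0 -> enorm (mirror l x) < enorm x.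
Proof.
move=> l0 lx; rewrite -(@ltr_pXn2r _ 2)// ?nnegrE ?enorm_ge0//.
by rewrite !enorm_sqr edot_mirror; nra.
Qed.

Lemma enorm_mirror_le l x : 0 < l -> l <= x 0 0 -> enorm (mirror l x) <= enorm x.
Proof.
by move=> l0; rewrite le_eqVlt => /predU1P[->|/(enorm_mirror_lt _ _ l0)/ltW//];
  rewrite mirror_fix.
Qed.

Lemma continuous_mirror l : continuous (mirror l : 'rV[R]_n.+1 -> 'rV[R]_n.+1).
Proof.
move=> x P /nbhs_enorm[r r0 h]; apply/nbhs_enorm; exists r => // y yx.
by apply: h; rewrite mirrorB enorm_hatv.
Qed.

Lemma jet2_mirror l (f : 'rV[R]_n.+1 -> R) x p M : jet2 f (mirror l x) p M ->
  jet2 (fun y => f (mirror l y)) x (hatv p) (hatmx M).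
Proof.
move=> h v; rewrite qform_hat.
have -> : (fun t : R => (f (mirror l (x + t *: v)) - f (mirror l x)
     - t * edot (hatv p) v) / t ^+ 2) =
   (fun t : R => (f (mirror l x + t *: hatv v) - f (mirror l x)
     - t * edot p (hatv v)) / t ^+ 2).
  by apply/funext => t; rewrite mirrorD hatvZ edot_hat.
exact: h.
Qed.

Lemma jet2_cst (c : R) x : jet2 (cst c) x 0 (0 : 'M[R]_n.+1).
Proof.
move=> v; have -> : (fun t : R => (cst c (x + t *: v) - cst c x - t * edot 0 v)
    / t ^+ 2) = cst 0.
  by apply/funext => t; rewrite /= edot0l mulr0 !subrr mul0r.
by rewrite /qform mulmx0 edot0l mul0r; exact: cvg_cst.
Qed.

Definition cap l : set 'rV[R]_n.+1 := [set x | enorm x < 1 /\ l < x 0 0].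

Lemma near_cap l x : cap l x -> \forall y \near x, cap l y.
Proof.
move=> [h1 h2]; apply: filterI.
  by have := open_nbhs_nbhs (conj (@open_eball R n 1) h1).
exact: (cvgr_gt _ (@continuous_coord R n 0 x)).
Qed.

Lemma cap_coord x l : cap l x -> x 0 0 < 1.
Proof.
move=> [h _]; apply: le_lt_trans h; apply: le_trans (coord_le_enorm x 0).
exact: ler_norm.
Qed.

Lemma cap_punctured l x : 0 < l -> cap l x -> (eball 1 `\ 0) x.
Proof.
move=> l0 [h1 h2]; split => // x0; move: h2; rewrite x0 mxE => h2.
by have := lt_trans l0 h2; rewrite ltxx.
Qed.

Lemma cap_mirror l x : 0 < l -> cap l x -> enorm (mirror l x) < 1.
Proof. by move=> l0 [h1 h2]; apply: lt_trans h1; exact: enorm_mirror_lt. Qed.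

End Mirror.

(** The tangent to the exponential at [- b] lies below its graph. This turns the Hopf barrier, a
    difference of two exponentials, into a multiple of [r0 ^+ 2 - enorm (x - e) ^+ 2]. *)
Lemma expRB_ge {R : realType} (a b : R) : expR (- b) * (b - a) <= expR (- a) - expR (- b).
Proof.
have -> : expR (- a) = expR (- b) * expR (b - a).
  by rewrite -expRD; congr expR; ring.
rewrite -{3}[expR (- b)]mulr1 -mulrBr ler_pM2l ?expR_gt0//.
by have := expR_ge1Dx (b - a); lra.
Qed.

Lemma cvg_gauss {R : realType} {T : Type} (F : set_system T) {FF : Filter F}
  (a l : R) (f : T -> R) : f x @[x --> F] --> l ->
  expR (- a * f x ^+ 2) @[x --> F] --> expR (- a * l ^+ 2).
Proof.
move=> fl; have h : - a * (f x * f x) @[x --> F] --> - a * (l * l).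
  exact: (cvgM (cvg_cst _) (cvgM fl fl)).
exact: (continuous_cvg _ (@continuous_expR R _) h).
Qed.

Lemma continuous_enormB {R : realType} {n : nat} (e : 'rV[R]_n.+1) :
  continuous (fun x : 'rV[R]_n.+1 => enorm (x - e)).
Proof.
apply: (@lipschitz_enorm_continuous _ _ _ 1) => x y; rewrite mul1r ler_norml.
have exy : (x - e) - (y - e) = x - y by rewrite opprB addrA subrK.
have := ler_enorm_dist (x - e) (y - e); have := ler_enorm_dist (y - e) (x - e).
rewrite (enormB (y - e)) exy => ? ?; apply/andP; split; lra.
Qed.

(** * Comparison of [u] with its reflection: Hopf's lemma and narrow strips *)

Section Comparison.
Context {R : realType} {n : nat}.
Notation V := 'rV[R]_n.+1.
Implicit Types (x y e v p : V) (N : 'M[R]_n.+1) (l : R).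
Variables (F : V -> R -> V -> 'M[R]_n.+1 -> R) (u : V -> R).
Hypothesis F_C1 : C1_on_jets F.
Hypothesis F_elliptic : forall (x : V) (s : R) (p : V) (M : 'M[R]_n.+1),
  (ecball 1 `\ 0) x -> symmx M -> posdefmx (dsym (F x s p) M).
Hypothesis F_reflect : forall (x : V) (t : R), eball 1 x -> 0 < x 0 0 < 1 ->
  -1 < t <= x 0 0 -> 0 < x 0 0 + t -> set_x1 x t != 0 ->
  forall (s : R) (p : V) (M : 'M[R]_n.+1), symmx M ->
  F x s p M <= F (set_x1 x t) s (hatv p) (hatmx M).
Hypothesis u_C2 : C2_on_punctured_cball u.
Hypothesis u_eq : forall x, (eball 1 `\ 0) x ->
  F x (u x) (gradient u x) (hessian u x) = 0.
Hypothesis u_pos : forall x, (eball 1 `\ 0) x -> 0 < u x.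
Hypothesis u_bdry : forall x, esphere 1 x -> u x = 0.

Lemma u_continuous x : (eball 1 `\ 0) x -> u y @[y --> x] --> u x.
Proof.
move=> Ox; apply/(@cvgrPdist_lt _ _ _ (nbhs x) (nbhs_filter x)) => e e0.
have := within_continuous_near _ _ _ (C2_continuous _ u_C2) (punctured_closure _ Ox) _ e0.
have := near_punctured _ Ox; apply: filterS2 => y Oy + .
by rewrite distrC; apply; exact: punctured_closure.
Qed.

Lemma u_mirror_continuous l x : 0 < l -> cap l x -> mirror l x != 0 ->
  u (mirror l y) @[y --> x] --> u (mirror l x).
Proof.
move=> l0 cx /eqP mx.
have Om : (eball 1 `\ 0) (mirror l x) by split; [exact: cap_mirror|].
exact: (cvg_comp _ _ (@continuous_mirror R n l x) (u_continuous _ Om)).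
Qed.

(** At a touching point the gradients agree and the Hessians are ordered. By ellipticity [F] at the
    jet of [u + g] is at most [F] at the jet of the reflected function, and by the hypothesis on [F]
    this is at most the value of the equation for [u] at [mirror l x], which is 0. *)
Lemma touch_le l x (g : V -> R) p N : 0 < l -> cap l x -> mirror l x != 0 ->
  jet2 g x p N -> symmx N -> (\forall y \near x, u y + g y <= u (mirror l y)) ->
  u x + g x = u (mirror l x) ->
  F x (u x + g x) (gradient u x + p) (hessian u x + N) <= 0.
Proof.
move=> l0 lx mx0 gx sN le_near eq_x.
have Ox := cap_punctured _ _ l0 lx.
have Om : (eball 1 `\ 0) (mirror l x).
  by split; [exact: cap_mirror|apply/eqP].
have ju := C2_jet2 _ u_C2 _ Ox.
have jm := jet2_mirror _ _ _ _ _ (C2_jet2 _ u_C2 _ Om).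
have j := jet2D _ _ _ _ _ _ _ jm (jet2Z _ _ _ _ (-1) (jet2D _ _ _ _ _ _ _ ju gx)).
have [|e1 psd] := jet2_min _ _ _ _ j.
  apply: filterS le_near => y hy /=.
  by rewrite -eq_x !mulN1r; lra.
move: e1; rewrite scaleN1r => /eqP; rewrite subr_eq0 => /eqP e1.
have sH := C2_hessian_sym _ u_C2 _ Ox.
have sHm := C2_hessian_sym _ u_C2 _ Om.
have sD : symmx (hatmx (hessian u (mirror l x)) + -1 *: (hessian u x + N)).
  by apply: symmxD; [exact: symmx_hat|apply: symmxZ; exact: symmxD].
have sHN : symmx (hessian u x + N) by exact: symmxD.
have := F_monotone _ F_C1 F_elliptic x (u x + g x) (gradient u x + p) _ _ Ox sHN sD psd.
rewrite scaleN1r addrCA subrr addr0 -e1 eq_x => /le_trans; apply.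
rewrite -(u_eq _ Om).
have x1 := cap_coord _ _ lx; have [xb xl] := lx.
have := F_reflect x (2 * l - x 0 0) xb.
rewrite -/(mirror l x) => h.
have := h _ _ _ mx0 (u (mirror l x)) (hatv (gradient u (mirror l x))) _
  (symmx_hat _ sHm).
rewrite hatvK hatmxK; apply.
- by rewrite x1 (lt_trans l0).
- by apply/andP; split; lra.
- by lra.
Qed.

(** Here [y] is the position relative to the centre of the Gaussian, [E] its scaled value and [s]
    the value of the test function. As [y] keeps the distance [r] from the centre, the second-order
    term contributes at least [4 * alpha ^+ 2 * th * r ^+ 2] times [E], while the other terms are at
    most linear in [alpha]. *)
Lemma gauss_strict (th C r : R) : 0 < th -> 0 < C -> 0 < r ->
  exists2 alpha : R, 1 <= alpha & forall (A : 'M[R]_n.+1) (B : V) (c s E : R) y,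
    (forall v, th * edot v v <= qform A v) ->
    (forall i j, `|A i j| <= C) -> (forall i, `|B 0 i| <= C) -> `|c| <= C ->
    r <= enorm y <= 1 -> 0 < E -> 0 <= s <= E ->
    0 < mxdot A (E *: ((4 * alpha ^+ 2) *: (y^T *m y) - (2 * alpha)%:M))
        + edot B (- (2 * alpha) * E *: y) + c * s.
Proof.
move=> th0 C0 r0.
pose m : R := n.+1%:R.
have m0 : 0 < m by rewrite ltr0n.
pose k := th * r ^+ 2; have k0 : 0 < k by rewrite mulr_gt0// exprn_gt0.
(* Up to the factor [E], the trace and the first-order term cost at most [2 * alpha * m * C] each
   and the zeroth-order term at most [C]; [alpha * k > (4 * m + 1) * C] together with [alpha >= 1]
   covers the sum. *)
exists (1 + (4 * m + 1) * C / k).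
  by rewrite lerDl divr_ge0 ?ltW// mulr_gt0// addr_gt0// mulr_gt0.
set alpha := 1 + _.
have a1 : 1 <= alpha by rewrite lerDl divr_ge0 ?ltW// mulr_gt0// addr_gt0// mulr_gt0.
have ak : (4 * m + 1) * C < alpha * k.
  by rewrite [ltRHS]mulrDl mul1r divfK ?gt_eqF// ltrDr.
clearbody alpha.
move=> A B c s E y hA AC BC cC /andP[yr y1] E0 /andP[s0 sE].
rewrite mxdotZr mxdotDr mxdotZr mxdot_outer edotZr.
have trA : mxdot A (- (2 * alpha)%:M) = - (2 * alpha) * \tr A.
  rewrite -scaleN1r mxdotZr mulN1r mulNr; congr (- _).
  rewrite -scalemx1 mxdotZr; congr (_ * _); apply: eq_bigr => i _.
  rewrite (bigD1 i)//= big1 => [|j ji]; first by rewrite mxE eqxx mulr1 addr0.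
  by rewrite mxE eq_sym (negbTE ji) mulr0.
have trAC : \tr A <= m * C.
  rewrite /m -[n.+1 in leRHS](card_ord) mulr_natl -sumr_const.
  by apply: ler_sum => i _; apply: le_trans (AC i i); exact: ler_norm.
have BY : `|edot B y| <= m * C.
  apply: (@le_trans _ _ (\sum_(i < n.+1) C)); last first.
    by rewrite sumr_const card_ord mulr_natl.
  apply: le_trans (ler_norm_sum _ _ _) _; apply: ler_sum => i _.
  rewrite normrM; apply: (@le_trans _ _ (C * 1)); last by rewrite mulr1.
  apply: ler_pM => //; apply: le_trans y1; exact: coord_le_enorm.
have qA : k <= qform A y.
  apply: le_trans (hA y); rewrite ler_pM2l// -enorm_sqr.
  by rewrite ler_pXn2r ?nnegrE ?enorm_ge0// ltW.
have cs : - (E * C) <= c * s.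
  have : `|c * s| <= C * E by rewrite normrM (ger0_norm s0) ler_pM.
  by rewrite ler_norml => /andP[+ _]; rewrite mulrC.
rewrite trA.
have h : 0 < 4 * alpha ^+ 2 * qform A y + - (2 * alpha) * \tr A
     - 2 * alpha * edot B y - C.
  have b : edot B y <= m * C by apply: le_trans BY; exact: ler_norm.
  have a2 : alpha ^+ 2 * k <= alpha ^+ 2 * qform A y.
    by rewrite ler_pM2l// exprn_gt0//; lra.
  have a3 : alpha * ((4 * m + 1) * C) < alpha * (alpha * k).
    by rewrite ltr_pM2l//; lra.
  have a4 : alpha * \tr A <= alpha * (m * C) by rewrite ler_pM2l//; lra.
  have a5 : alpha * edot B y <= alpha * (m * C) by rewrite ler_pM2l//; lra.
  have a6 : C <= alpha * C by rewrite ler_peMl// ltW.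
  have a7 : 0 < alpha * (m * C) by rewrite !mulr_gt0//; lra.
  lra.
have := mulr_gt0 E0 h; move: cs; lra.
Qed.

Lemma gauss_norm_le (alpha E : R) y : 0 <= alpha -> 0 <= E -> enorm y <= 1 ->
  `|- (2 * alpha) * E *: y| <= E * (4 * alpha ^+ 2 + 2 * alpha) /\
  `|E *: ((4 * alpha ^+ 2) *: (y^T *m y) - (2 * alpha)%:M)|
     <= E * (4 * alpha ^+ 2 + 2 * alpha).
Proof.
move=> a0 E0 y1.
have yi i : `|y 0 i| <= 1 by apply: le_trans y1; exact: coord_le_enorm.
have a20 : 0 <= alpha ^+ 2 by exact: sqr_ge0.
split.
  rewrite normrZ normrM normrN (ger0_norm E0) [`|2 * alpha|]ger0_norm ?mulr_ge0//.
  have ny : `|y| <= 1 by apply: le_trans (norm_le_enorm y) y1.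
  apply: (@le_trans _ _ (2 * alpha * E * 1)).
    by rewrite ler_wpM2l// !mulr_ge0.
  by rewrite mulr1 mulrC ler_wpM2l// lerDr mulr_ge0.
rewrite normrZ (ger0_norm E0) ler_wpM2l//; apply: mx_norm_leP => [|i j].
  by rewrite addr_ge0 ?mulr_ge0.
rewrite !mxE big_ord1 !mxE.
apply: le_trans (ler_normB _ _) _; apply: lerD.
  rewrite normrM [`|4 * _|]ger0_norm ?mulr_ge0// ler_piMr ?mulr_ge0//.
  by rewrite normrM mulr_ile1.
by rewrite normrMn ger0_norm ?mulr_ge0//; case: (i == j) => //=; rewrite mulr0n mulr_ge0.
Qed.

(* Only the ball is assumed to avoid the reflected singularity, not its
   closure: this is what allows it to touch the singularity. *)
Lemma hopf l (r r0 m : R) : 0 < l -> 0 < r -> r < r0 -> r0 <= 1 -> 0 < m ->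
  exists2 c : R, 0 < c & forall e,
    (forall x, enorm (x - e) < r0 -> cap l x /\ mirror l x != 0) ->
    (forall x, enorm (x - e) < r0 -> u x <= u (mirror l x)) ->
    (forall x, enorm (x - e) <= r -> u x + m <= u (mirror l x)) ->
    forall x, enorm (x - e) < r0 ->
      c * (r0 ^+ 2 - enorm (x - e) ^+ 2) <= u (mirror l x) - u x.
Proof.
move=> l0 r_gt0 rr0 r01 m0.
have [th [C [th0 C0 lin]]] := linearization _ F_C1 F_elliptic u l u_C2 l0.
have [alpha a1 strict] := gauss_strict th C r th0 C0 r_gt0.
have r0_gt0 : 0 < r0 by exact: lt_trans rr0.
have a0 : 0 < alpha by lra.
pose D := 4 * alpha ^+ 2 + 2 * alpha + 1.
have D1 : 1 <= D by have := sqr_ge0 alpha; rewrite /D; lra.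
have D0 : 0 < D by lra.
(* [eps <= m] keeps the barrier below the difference on the inner ball; [eps * D <= 1] scales its
   jet into the range of the linearization. *)
pose eps := Num.min m D^-1.
have eps0 : 0 < eps by rewrite lt_min m0 invr_gt0.
have epsm : eps <= m by rewrite ge_min lexx.
have epsD : eps * D <= 1 by rewrite -ler_pdivlMr// div1r ge_min lexx orbT.
pose c0 := expR (- (alpha * r0 ^+ 2)).
have c0_gt0 : 0 < c0 by exact: expR_gt0.
exists (eps * c0 * alpha); first by rewrite !mulr_gt0.
move=> e He Hpos Hin x xe.
pose E y := expR (- alpha * edot (y - e) (y - e)).
pose w y := u (mirror l y) - u y.
suff H : eps * (E x - c0) <= w x.
  apply: le_trans H; rewrite -!mulrA ler_pM2l// enorm_sqr /E /c0 mulNr.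
  apply: le_trans (expRB_ge _ _); rewrite ler_pM2l ?expR_gt0//.
  by rewrite mulrBr.
rewrite leNgt; apply/negP => bad.
pose eta := eps * (E x - c0) - w x.
have eta0 : 0 < eta by rewrite subr_gt0.
(* In the part of the ball outside this compact set, the barrier [eps * (E y - c0)] is below
   [eta / 2] and [w] is nonnegative. A minimum over [K] that is at most [- eta] is therefore one
   over the whole open ball, without recourse to its boundary. *)
pose K : set V := [set y | c0 + eta / (2 * eps) <= E y].
have inball y : c0 < E y -> enorm (y - e) < r0.
  rewrite /c0 /E ltr_expR mulNr ltrN2 ltr_pM2l// -enorm_sqr.
  by rewrite ltr_pXn2r ?nnegrE ?enorm_ge0// ltW.
have q0 : 0 < eta / (2 * eps) by rewrite divr_gt0// mulr_gt0.
have Kball y : K y -> enorm (y - e) < r0.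
  by move=> Ky; apply: inball; apply: lt_le_trans Ky; rewrite ltrDl.
have E1 y : E y <= 1.
  by rewrite -expR0 ler_expR mulNr oppr_le0 mulr_ge0 ?edotxx_ge0// ltW.
have E0 y : 0 < E y by exact: expR_gt0.
have Ec y : E z @[z --> y] --> E y.
  have EE : E = (fun z => expR (- alpha * enorm (z - e) ^+ 2)).
    by apply/funext => z; rewrite enorm_sqr.
  have ec : enorm (z - e) @[z --> y] --> enorm (y - e) by exact: continuous_enormB.
  by rewrite EE; exact: (cvg_gauss _ _ _ _ ec).
have wc y : enorm (y - e) < r0 -> w z @[z --> y] --> w y.
  move=> ye; have [cy my] := He y ye.
  exact: (cvgB (u_mirror_continuous _ _ l0 cy my)
    (u_continuous _ (cap_punctured _ _ l0 cy))).
have cK : compact K.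
  apply: (@compact_ecball _ _ _ (enorm e + r0)) => [|y Ky].
    have := @preimage_closed _ _ E [set z : R | c0 + eta / (2 * eps) <= z].
    by apply; [move=> y _; exact: Ec|exact: closed_ge].
  rewrite /ecball /=; apply: le_trans (ler_enorm_dist y e) _.
  by rewrite lerD2l ltW// Kball.
have w0 y : enorm (y - e) < r0 -> 0 <= w y by move=> h; rewrite subr_ge0 Hpos.
have Kx : K x.
  rewrite /K /= -lerBrDl ler_pdivrMr ?mulr_gt0//.
  have : eta <= eps * (E x - c0) by have := w0 x xe; rewrite /eta; lra.
  lra.
have fc : {within K, continuous (fun y => w y - eps * (E y - c0))}.
  apply/subspace_continuousP => y Ky; apply: cvg_within_filter.
  apply: cvgB; first exact: wc (Kball y Ky).
  apply: cvgM; first exact: cvg_cst.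
  by apply: cvgB; [exact: Ec|exact: cvg_cst].
have [x1 /set_mem Kx1 hmin] := compact_EVT_min (ex_intro K x Kx) cK fc.
have x1e := Kball x1 Kx1.
pose v1 := w x1 - eps * (E x1 - c0).
have v1eta : v1 <= - eta.
  by have := hmin x; rewrite in_setE => /(_ Kx); rewrite /v1 /eta; lra.
have [cx1 mx1] := He x1 x1e.
(* In the inner ball [w] is at least [m >= eps], hence above the barrier, since [E <= 1]. *)
have rx1 : r <= enorm (x1 - e).
  rewrite leNgt; apply/negP => /ltW/Hin h.
  have : m <= w x1 by rewrite lerBrDl.
  have : eps * (E x1 - c0) <= eps * 1 by rewrite ler_pM2l//; have := E1 x1; lra.
  by have := v1eta; rewrite /v1; lra.
pose g y := eps * E y + (v1 - eps * c0).
have jg := jet2D _ _ _ _ _ _ _ (jet2Z _ _ _ _ eps (jet2_gauss alpha e x1))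
  (jet2_cst (v1 - eps * c0) x1).
rewrite -/(E x1) !addr0 !scalerA in jg.
have near1 : \forall y \near x1, u y + g y <= u (mirror l y).
  have : nbhs (x1 : V) (fun y : V => enorm (y - e) < r0).
    exact: (cvgr_lt _ (@continuous_enormB R n e x1)).
  apply: filterS => y ye.
  suff : v1 <= w y - eps * (E y - c0) by rewrite /g /w; lra.
  have [Ky|nKy] := pselect (K y).
    by apply: hmin; rewrite in_setE.
  have : E y < c0 + eta / (2 * eps) by rewrite ltNge; apply/negP.
  rewrite -ltrBlDl ltr_pdivlMr ?mulr_gt0// => h1.
  by have := w0 y ye; lra.
have eq1 : u x1 + g x1 = u (mirror l x1) by rewrite /g /v1 /w; ring.
have Ox1 := cap_punctured _ _ l0 cx1.
pose N : 'M[R]_n.+1 := (eps * E x1) *: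
  ((4 * alpha ^+ 2) *: ((x1 - e)^T *m (x1 - e)) - (2 * alpha)%:M).
pose p := - (2 * alpha) * (eps * E x1) *: (x1 - e).
have sN : symmx N.
  apply: symmxZ; apply: symmxD; last by rewrite /symmx /= linearN /= tr_scalar_mx.
  by apply: symmxZ; rewrite /symmx /= trmx_mul trmxK.
have jg' : jet2 g x1 p N.
  by rewrite /p mulrCA.
have le0 := touch_le l x1 g p N l0 cx1 mx1 jg' sN near1 eq1.
have gx1 : g x1 = w x1 by rewrite /g /v1; ring.
(* [gauss_strict] wants [g x1] between 0 and [eps * E x1]: it equals [w x1], which is nonnegative,
   and the constant [v1 - eps * c0] is negative. *)
have g0 : 0 <= g x1 by rewrite gx1 w0.
have gE : g x1 <= eps * E x1.
  have : 0 < eps * c0 by rewrite mulr_gt0.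
  by rewrite /g; lra.
have eE : eps * E x1 <= eps by rewrite ler_piMr// ltW.
have eE0 : 0 < eps * E x1 by rewrite mulr_gt0.
have D' : eps * E x1 * (4 * alpha ^+ 2 + 2 * alpha) <= 1.
  apply: le_trans epsD; apply: ler_pM => //; first exact: ltW.
    by rewrite addr_ge0// mulr_ge0 ?sqr_ge0// ltW.
  by rewrite lerDl.
have x1e1 : enorm (x1 - e) <= 1 by apply: le_trans r01; exact: ltW.
have [np nN] := gauss_norm_le alpha (eps * E x1) (x1 - e) (ltW a0) (ltW eE0) x1e1.
have g1 : `|g x1| <= 1.
  rewrite ger0_norm//; apply: le_trans gE _; apply: le_trans eE _.
  by apply: le_trans epsD; rewrite ler_peMr// ltW.
have x1l : l <= enorm x1 < 1.
  case: cx1 => h1 h2; rewrite h1 andbT; apply: ltW; apply: lt_le_trans h2 _.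
  by apply: le_trans (coord_le_enorm x1 0); exact: ler_norm.
have [A [B [c [hA AC BC cC hF]]]] :=
  lin x1 (g x1) p N x1l sN g1 (le_trans np D') (le_trans nN D').
have rx1' : r <= enorm (x1 - e) <= 1 by rewrite rx1.
have gs : 0 <= g x1 <= eps * E x1 by rewrite g0.
have := strict A B c (g x1) (eps * E x1) (x1 - e) hA AC BC cC rx1' eE0 gs.
by rewrite -/N -/p -hF (u_eq _ Ox1) subr0 ltNge le0.
Qed.


(** [t] is the distance to the plane and [- k] the value there of a negative multiple of
    [expR (- a * t ^+ 2)], whose derivatives appear. In the strip [4 * a * t <= 1] the second-order
    term is at least [k * (a * th)], and [a * th > 2 * C] outweighs the other two terms, which cost
    at most [k * C] each. *)
Lemma strip_strict (th C a t : R) (A : 'M[R]_n.+1) (B : V) (c k : R) :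
  0 < th -> 0 < C -> 1 <= a -> 2 * C < a * th -> 0 <= t -> 4 * a * t <= 1 ->
  (forall v, th * edot v v <= qform A v) -> (forall i, `|B 0 i| <= C) ->
  `|c| <= C -> 0 < k ->
  0 < mxdot A (- k * (4 * a ^+ 2 * t ^+ 2 - 2 * a) *: delta_mx 0 0)
      + edot B (- (- (2 * a) * k * t) *: delta_mx 0 0) + c * - k.
Proof.
move=> th0 C0 a1 aC t0 at1 hA BC cC k0.
have d00 (M : 'M[R]_n.+1) : mxdot M (delta_mx 0 0) = M 0 0.
  rewrite /mxdot (bigD1 0)//= (bigD1 0)//= big1 => [|l l0].
    rewrite big1 => [|l l0]; first by rewrite mxE !eqxx mulr1 !addr0.
    by rewrite big1// => l' _; rewrite mxE (negbTE l0) mulr0.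
  by rewrite mxE (negbTE l0) andbF mulr0.
have e00 (v : V) : edot v (delta_mx 0 0) = v 0 0.
  rewrite /edot (bigD1 0)//= big1 => [|i i0].
    by rewrite mxE !eqxx mulr1 addr0.
  by rewrite mxE (negbTE i0) andbF mulr0.
rewrite mxdotZr d00 -[edot B _]/(edot B ((- (- (2 * a) * k * t)) *: delta_mx 0 0)).
rewrite (edotZr (- (- (2 * a) * k * t)) B) e00.
have A00 : th <= A 0 0.
  have := hA (delta_mx 0 0); rewrite -mxdot_outer e00 mxE !eqxx mulr1.
  by rewrite trmx_delta mul_delta_mx d00.
have : `|B 0 0| <= C by []; rewrite ler_norml => /andP[B1 B2].
move: cC; rewrite ler_norml => /andP[c1 c2].
have at2 : 4 * a ^+ 2 * t ^+ 2 <= a.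
  have h1 : a * t <= 1 by nra.
  have h2 : 0 <= a * t by rewrite mulr_ge0//; lra.
  have -> : 4 * a ^+ 2 * t ^+ 2 = (4 * a * t) * (a * t) by ring.
  by apply: (@le_trans _ _ (1 * 1)); [apply: ler_pM => //; nra|lra].
have h : 0 < (2 * a - 4 * a ^+ 2 * t ^+ 2) * A 0 0 + 2 * a * t * B 0 0 - c.
  have h1 : a * th <= (2 * a - 4 * a ^+ 2 * t ^+ 2) * A 0 0.
    by apply: ler_pM => //; lra.
  have h2 : - C <= 2 * a * t * B 0 0.
    have X0 : 0 <= 2 * a * t by rewrite !mulr_ge0//; lra.
    have X1 : 0 <= 1 - 2 * a * t by nra.
    have BC0 : 0 <= B 0 0 + C by lra.
    have := mulr_ge0 X0 BC0; have := mulr_ge0 X1 (ltW C0); lra.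
  by lra.
have := mulr_gt0 k0 h; lra.
Qed.

Lemma mirror_punctured l x : 0 < l -> enorm x <= 1 -> l <= x 0 0 ->
  mirror l x != 0 -> (ecball 1 `\ 0) (mirror l x).
Proof.
move=> l0 x1 lx mx; split; last exact/eqP.
exact: le_trans (enorm_mirror_le _ _ l0 lx) x1.
Qed.

(* Near the hyperplane [x_1 = l] a maximum principle holds whatever the sign
   of the zeroth order coefficient: a Gaussian weight in [x_1 - l] is a strict
   supersolution of every operator with the given bounds. *)
Lemma strip (l0 : R) : 0 < l0 -> exists d eta : R, [/\ 0 < d, 0 < eta &
  forall l, l0 <= l -> l < 1 ->
  (forall x, enorm x <= 1 -> l <= x 0 0 -> mirror l x != 0 ->
     u x < u (mirror l x) \/
     x 0 0 < l + d /\ `|u (mirror l x) - u x| < eta) ->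
  forall x, cap l x -> mirror l x != 0 -> u x <= u (mirror l x)].
Proof.
move=> l00.
have [th [C [th0 C0 lin]]] := linearization _ F_C1 F_elliptic u l0 u_C2 l00.
pose a := 2 * C / th + 1.
have a1 : 1 <= a by rewrite lerDr divr_ge0 ?mulr_ge0 ?ltW.
have a0 : 0 < a by lra.
have ath : 2 * C < a * th by rewrite [ltRHS]mulrDl mul1r divfK ?gt_eqF// ltrDl.
(* [4 * a * d <= 1] is what [strip_strict] asks; [d <= l0 / 2] keeps the reflected origin, whose
   first coordinate is [2 * l], out of the strip. *)
pose d := Num.min (4 * a)^-1 (l0 / 2).
have d0 : 0 < d by rewrite lt_min invr_gt0 mulr_gt0// divr_gt0.
have da : 4 * a * d <= 1.
  by rewrite mulrC -ler_pdivlMr ?mulr_gt0// div1r ge_min lexx.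
have dl0 : d <= l0 / 2 by rewrite ge_min lexx orbT.
(* The second constant bounds [k * G x1] below, so that the jet of the test function [- k * G] has
   size at most [k * G x1 * (2 * a) <= 1]. *)
exists d, (2 * a)^-1; split => //; first by rewrite invr_gt0 mulr_gt0.
move=> l l0l l1 good x cx mx; rewrite leNgt; apply/negP => bad.
have l_gt0 : 0 < l by exact: lt_le_trans l0l.
pose w y := u (mirror l y) - u y.
pose G (y : V) := expR (- a * (y 0 0 - l) ^+ 2).
have G0 y : 0 < G y by exact: expR_gt0.
pose K : set V := [set y | enorm y <= 1] `&` ([set y | l <= y 0 0] `&`
  [set y | y 0 0 <= l + d]).
have cK : compact K.
  apply: (@compact_ecball _ _ _ 1) => [|y []//].
  apply: closedI; first exact: closed_ecball.
  apply: closedI.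
    have := @preimage_closed _ _ (fun y : V => y 0 0) [set z : R | l <= z].
    by apply; [move=> y _; exact: continuous_coord|exact: closed_ge].
  have := @preimage_closed _ _ (fun y : V => y 0 0) [set z : R | z <= l + d].
  by apply; [move=> y _; exact: continuous_coord|exact: closed_le].
have mK y : K y -> mirror l y != 0.
  move=> [_ [/= y1 y2]]; apply/eqP => e; have := mirror00 l y; rewrite e mxE.
  by lra.
have Kx : K x.
  have [x1 xl] := cx; split; first exact: ltW.
  split; first exact: ltW.
  have [h|[h _]] := good x (ltW x1) (ltW xl) mx; last exact: ltW.
  by have := lt_trans h bad; rewrite ltxx.
have KD y : K y -> (ecball 1 `\ 0) y.
  move=> [y1 [/= y2 _]]; split => // y0; move: y2; rewrite y0 mxE; lra.
have KDm y : K y -> (ecball 1 `\ 0) (mirror l y).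
  by move=> Ky; have [y1 [y2 _]] := Ky; apply: mirror_punctured => //; exact: mK.
have fc : {within K, continuous (fun y => w y / G y)}.
  apply/subspace_continuousP => y Ky.
  have c1 : u z @[z --> within K (nbhs y)] --> u y.
    have /subspace_continuousP h := continuous_subspaceW KD (C2_continuous _ u_C2).
    exact: h.
  have c2 : u (mirror l z) @[z --> within K (nbhs y)] --> u (mirror l y).
    have /subspace_continuousP h := C2_continuous _ u_C2.
    move=> S /(h _ (KDm y Ky)); rewrite /within /= => HS.
    have {}HS : \forall z \near mirror l y, (ecball 1 `\ 0) z -> S (u z) by exact: HS.
    have : \forall z \near y, (ecball 1 `\ 0) (mirror l z) -> S (u (mirror l z)).
      exact: (@continuous_mirror R n l y _ HS).
    by apply: filterS => z Hz Kz; apply: Hz; exact: KDm.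
  have c3 : (G z)^-1 @[z --> within K (nbhs y)] --> (G y)^-1.
    apply: cvgV; first by rewrite gt_eqF.
    apply: cvg_within_filter.
    apply: cvg_gauss.
    by apply: cvgB; [exact: continuous_coord|exact: cvg_cst].
  by apply: cvgM => //; exact: cvgB.
have [x1 /set_mem Kx1 hmin] := compact_EVT_min (ex_intro K x Kx) cK fc.
(* The negative minimum [- k] of [w / G] is attained neither on the plane, where [w = 0], nor on the
   sphere, where [w > 0], nor on the far face of the strip, which [good] excludes where [w < 0]. *)
pose k := - (w x1 / G x1).
have k0 : 0 < k.
  rewrite oppr_gt0; have := hmin x; rewrite in_setE => /(_ Kx) h.
  apply: (le_lt_trans h); rewrite pmulr_llt0 ?invr_gt0//.
  by rewrite subr_lt0.
have wk : w x1 = - (k * G x1) by rewrite /k mulNr opprK divfK ?gt_eqF.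
have wneg : w x1 < 0 by rewrite wk oppr_lt0 mulr_gt0.
have [x1n [/= x1l x1d]] := Kx1.
have mx1 := mK x1 Kx1.
have x1lt : l < x1 0 0.
  rewrite lt_neqAle x1l andbT; apply/eqP => e.
  by move: wneg; rewrite /w mirror_fix// subrr ltxx.
have x1n1 : enorm x1 < 1.
  rewrite lt_neqAle [_ <= _]x1n andbT; apply/eqP => e.
  move: wneg; rewrite /w (u_bdry x1 e) subr0 ltNge => /negP; apply.
  apply/ltW/u_pos; split; last exact/eqP.
  by rewrite /eball /= -e; exact: enorm_mirror_lt.
have [x1d' weta] : x1 0 0 < l + d /\ `|w x1| < (2 * a)^-1.
  have [h|//] := good x1 x1n x1l mx1.
  by move: wneg; rewrite subr_lt0 ltNge (ltW h).
have cx1 : cap l x1 by [].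
pose t := x1 0 0 - l.
have t0 : 0 <= t by rewrite subr_ge0.
have at1 : 4 * a * t <= 1.
  apply: le_trans da; rewrite ler_pM2l ?mulr_gt0//; rewrite /t; lra.
pose g y := - k * G y.
have jg := jet2Z _ _ _ _ (- k) (jet2_gauss1 a l x1).
rewrite -/(G x1) -/t !scalerA in jg.
have near1 : \forall y \near x1, u y + g y <= u (mirror l y).
  have n1 := near_cap _ _ cx1.
  have n2 : nbhs (x1 : V) (fun y : V => y 0 0 < l + d).
    exact: (cvgr_lt _ (@continuous_coord R n 0 x1)).
  move: n2; apply: filterS2 n1 => y [y1 y2] y3.
  have Ky : K y by split; [exact: ltW|split; exact: ltW].
  have := hmin y; rewrite in_setE => /(_ Ky) h.
  suff : - k * G y <= w y by rewrite /g /w; lra.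
  by rewrite -ler_pdivlMr// /k opprK.
have eq1 : u x1 + g x1 = u (mirror l x1) by rewrite /g mulNr -wk /w; ring.
have Ox1 := cap_punctured _ _ l_gt0 cx1.
have sd (r : R) : symmx (r *: delta_mx 0 0 : 'M[R]_n.+1).
  by apply: symmxZ; rewrite /symmx /= trmx_delta.
have le0 := touch_le l x1 g _ _ l_gt0 cx1 mx1 jg (sd _) near1 eq1.
have kG0 : 0 < k * G x1 by rewrite mulr_gt0.
have kGa : k * G x1 * (2 * a) < 1.
  by rewrite -ltr_pdivlMr ?mulr_gt0// div1r; move: weta; rewrite wk normrN gtr0_norm.
have gs : g x1 = - (k * G x1) by rewrite /g mulNr.
have kG1 : k * G x1 <= 1.
  apply: le_trans (ltW kGa); rewrite ler_peMr ?ltW//; lra.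
have delta_le (r : R) m1 m2 (i : 'I_m1.+1) (j : 'I_m2.+1) : `|r| <= 1 ->
    `|r *: delta_mx i j : 'M[R]_(m1.+1, m2.+1)| <= 1.
  move=> r1; apply: mx_norm_leP => // i' j'; rewrite !mxE.
  by case: (_ && _); rewrite ?mulr1// mulr0 normr0.
have x1b : l0 <= enorm x1 < 1.
  rewrite x1n1 andbT; apply: le_trans l0l _; apply: le_trans x1l _.
  by apply: le_trans (coord_le_enorm x1 0); exact: ler_norm.
have g1 : `|g x1| <= 1 by rewrite gs normrN gtr0_norm.
have p1 : `|- k * (- (2 * a) * G x1 * t)| <= 1.
  have -> : - k * (- (2 * a) * G x1 * t) = (k * G x1) * (2 * a * t) by ring.
  have X0 : 0 <= 2 * a * t by apply: mulr_ge0 => //; lra.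
  rewrite normrM (gtr0_norm kG0) (ger0_norm X0).
  by apply: mulr_ile1 => //; [exact: ltW|lra].
have N1 : `|- k * (G x1 * (4 * a ^+ 2 * t ^+ 2 - 2 * a))| <= 1.
  have -> : - k * (G x1 * (4 * a ^+ 2 * t ^+ 2 - 2 * a)) =
    (k * G x1) * (2 * a - (4 * a * t) * (a * t)) by ring.
  rewrite normrM (gtr0_norm kG0); apply: le_trans (ltW kGa).
  have h2 : 0 <= a * t by apply: mulr_ge0 => //; exact: ltW.
  have h3 : (4 * a * t) * (a * t) <= a * t by rewrite ler_piMl.
  have h4 : 0 <= (4 * a * t) * (a * t).
    by apply: mulr_ge0 => //; apply: mulr_ge0 => //; lra.
  rewrite ler_pM2l// ger0_norm; nra.
have p1' : `|(- k * (- (2 * a) * G x1 * t)) *: delta_mx 0 0 : V| <= 1.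
  exact: delta_le.
have N1' : `|(- k * (G x1 * (4 * a ^+ 2 * t ^+ 2 - 2 * a))) *:
    delta_mx 0 0 : 'M[R]_n.+1| <= 1 by exact: delta_le.
have [A [B [c [hA AC BC cC hF]]]] := lin x1 (g x1) _ _ x1b (sd _) g1 p1' N1'.
have := strip_strict th C a t A B c (k * G x1) th0 C0 a1 ath t0 at1 hA BC cC kG0.
have -> : - (k * G x1) * (4 * a ^+ 2 * t ^+ 2 - 2 * a) =
  - k * (G x1 * (4 * a ^+ 2 * t ^+ 2 - 2 * a)) by ring.
have -> : - (- (2 * a) * (k * G x1) * t) = - k * (- (2 * a) * G x1 * t) by ring.
by rewrite -gs -hF (u_eq _ Ox1) subr0 ltNge le0.
Qed.

End Comparison.

(** * Moving planes *)

(** Connectedness of [[a, b]] in the form suited to chains of balls: near each [t] the property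
    passes between any two points, so the infimum of the set where it holds can only be [a], and is
    attained. *)
Lemma interval_induct {R : realType} (P : R -> Prop) (a b : R) : a <= b ->
  (forall t, a <= t <= b -> exists2 d : R, 0 < d & forall s s',
     a <= s <= b -> a <= s' <= b -> `|s - t| < d -> `|s' - t| < d -> P s -> P s') ->
  P b -> P a.
Proof.
move=> ab loc Pb.
pose S := [set t | a <= t <= b /\ P t].
have Sb : S b by split => //; rewrite ab lexx.
have S0 : has_inf S.
  by split; [exists b|exists a => t [/andP[]]].
pose t := inf S.
have at_ : a <= t by apply: lb_le_inf; [exists b|move=> s [/andP[]]].
have tb : t <= b by apply: ge_inf => //; case: S0.
have [d d0 Hd] := loc t (introT andP (conj at_ tb)).
have [s Ss std] := inf_adherent d0 S0.
have ts : t <= s by apply: ge_inf => //; case: S0.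
have [sab Ps] := Ss.
have sd : `|s - t| < d by rewrite ger0_norm ?subr_ge0// ltrBlDl.
pose s' := Num.max a (t - d / 2).
have s'ab : a <= s' <= b.
  by rewrite le_max lexx ge_max ab /=; lra.
have s't : s' <= t by rewrite ge_max at_; lra.
have s'd : `|s' - t| < d.
  rewrite ler0_norm ?subr_le0// opprB ltrBlDl -ltrBlDr lt_max.
  by apply/orP; right; lra.
have Ps' := Hd s s' sab s'ab sd s'd Ps.
have : t <= s' by apply: ge_inf => //; case: S0.
rewrite le_max => /orP[ta|]; last by lra.
have ea : t = a by apply/eqP; rewrite eq_le ta at_.
have aab : a <= a <= b by rewrite lexx ab.
have atd : `|a - t| < d by rewrite ea subrr normr0.
exact: Hd s a sab aab sd atd Ps.
Qed.

Section MovingPlanes.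
Context {R : realType} {n : nat}.
Notation V := 'rV[R]_n.+1.
Implicit Types (x y z e v p : V) (N : 'M[R]_n.+1) (l : R).
Variables (F : V -> R -> V -> 'M[R]_n.+1 -> R) (u : V -> R).
Hypothesis F_C1 : C1_on_jets F.
Hypothesis F_elliptic : forall (x : V) (s : R) (p : V) (M : 'M[R]_n.+1),
  (ecball 1 `\ 0) x -> symmx M -> posdefmx (dsym (F x s p) M).
Hypothesis F_reflect : forall (x : V) (t : R), eball 1 x -> 0 < x 0 0 < 1 ->
  -1 < t <= x 0 0 -> 0 < x 0 0 + t -> set_x1 x t != 0 ->
  forall (s : R) (p : V) (M : 'M[R]_n.+1), symmx M ->
  F x s p M <= F (set_x1 x t) s (hatv p) (hatmx M).
Hypothesis u_C2 : C2_on_punctured_cball u.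
Hypothesis u_super : exists2 rbar : R, 0 < rbar <= 1 &
  forall (v : V) (r : R), 0 < r < rbar ->
  inf_eq_min (eball r `\ 0) (esphere r) (fun x => u x + edot v x).
Hypothesis u_eq : forall x, (eball 1 `\ 0) x ->
  F x (u x) (gradient u x) (hessian u x) = 0.
Hypothesis u_pos : forall x, (eball 1 `\ 0) x -> 0 < u x.
Hypothesis u_bdry : forall x, esphere 1 x -> u x = 0.

Let e0 : V := delta_mx 0 0.
Let Hopf := hopf F u F_C1 F_elliptic F_reflect u_C2 u_eq.

Lemma e00 : e0 0 0 = 1.
Proof. by rewrite mxE !eqxx. Qed.

Lemma edot_e0 x : edot x e0 = x 0 0.
Proof.
rewrite /edot (bigD1 0)//= big1 => [|i i0].
  by rewrite e00 mulr1 addr0.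
by rewrite mxE (negbTE i0) andbF mulr0.
Qed.

Lemma enorm_e0 : enorm e0 = 1.
Proof. by rewrite /enorm edot_e0 e00 sqrtr1. Qed.

Lemma enorm_te0 (t : R) : enorm (t *: e0) = `|t|.
Proof. by rewrite enormZ enorm_e0 mulr1. Qed.

Lemma coord_te0 x (t : R) : (x + t *: e0) 0 0 = x 0 0 + t.
Proof. by rewrite !mxE !eqxx mulr1. Qed.

(** [jet2] expands along one line at a time; here continuity of the gradient makes the expansion
    uniform in the direction, as the comparison on whole spheres about the origin requires. *)
Lemma C2_frechet x : (eball 1 `\ 0) x -> forall eps : R, 0 < eps ->
  exists2 d : R, 0 < d & forall h, enorm h < d ->
    `|u (x + h) - u x - edot (gradient u x) h| <= eps * enorm h.
Proof.
move=> Ox eps eps0.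
have n0 : 0 < n.+1%:R :> R by rewrite ltr0n.
have epsn : 0 < eps / n.+1%:R by rewrite divr_gt0.
have /filter_forall h1 : forall i, \forall y \near x,
    `|partial i u y - partial i u x| < eps / n.+1%:R.
  move=> i; have [_ h] := C2_C1_at _ u_C2 _ Ox (delta_mx 0 i) I.
  by apply: filterS (h _ epsn) => y; apply.
have h2 : nbhs x (fun y => (eball 1 `\ 0) y /\ forall i : 'I_n.+1,
    `|partial i u y - partial i u x| < eps / n.+1%:R).
  exact: filterI (near_punctured _ Ox) h1.
have [d d0 Hd] := (nbhs_enorm _ _).1 h2.
exists d => // h hd.
have near_h s : 0 <= s <= 1 -> enorm ((x + (s * 1) *: h) - x) < d.
  move=> /andP[s0 s1]; rewrite addrAC subrr add0r enormZ mulr1 ger0_norm//.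
  by apply: le_lt_trans hd; rewrite ler_piMl// enorm_ge0.
have [s s01|s s01] := @MVT_line _ _ u x h 1.
  by apply: C2_derivable => //; have [] := Hd _ (near_h s s01).
have [Os Hs] := Hd _ (near_h s s01).
rewrite scale1r mul1r => ->; rewrite (C2_derive_gradient _ u_C2 _ _ Os).
rewrite -edotNl -edotDl; apply: le_trans (normr_edot_le _ _) _.
rewrite ler_wpM2r ?enorm_ge0//; apply: le_trans (enorm_le_norm _) _.
rewrite mulrC -ler_pdivlMr//; apply: mx_norm_leP => [|i j]; first exact: ltW.
by rewrite (ord1 i) !mxE; apply/ltW/Hs.
Qed.

Lemma super_sphere : exists2 rbar : R, 0 < rbar <= 1 &
  forall v (r : R), 0 < r < rbar -> exists2 y, enorm y = r &
    forall x, x != 0 -> enorm x < r -> u y + edot v y <= u x + edot v x.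
Proof.
have [rbar rb0 h] := u_super; exists rbar => // v r r0.
have [m [[y yr ym] _ infm]] := h v r r0.
exists y => // x /eqP x0 xr; rewrite ym -lee_fin -infm.
by apply: ereal_inf_lbound; exists x.
Qed.

(** With [V = 0] the hypothesis bounds [u] near the origin from below by its minimum on a sphere, a
    value at a point where [u] is positive. *)
Lemma lower_origin : exists2 m : R, 0 < m & exists2 r : R, 0 < r &
  forall y, y != 0 -> enorm y < r -> m <= u y.
Proof.
have [rbar /andP[rb0 rb1] h] := super_sphere.
have r0 : 0 < rbar / 2 < rbar by apply/andP; split; lra.
have [y yr hy] := h 0 _ r0; have [r_gt0 r_lt] := andP r0.
have y0 : y != 0 by rewrite -enorm_gt0 yr.
exists (u y); last first.
  exists (rbar / 2) => // x x0 xr; have := hy x x0 xr.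
  by rewrite !edot0l !addr0.
apply: u_pos; split; last exact/eqP.
by rewrite /eball /= yr; lra.
Qed.

Lemma lower_positive y0 : enorm y0 < 1 -> exists2 c : R, 0 < c &
  exists2 r : R, 0 < r & forall y, y != 0 -> enorm (y - y0) < r -> c < u y.
Proof.
move=> y01; have [->|y00] := eqVneq y0 0.
  have [m m0 [r r0 h]] := lower_origin.
  exists (m / 2); first by rewrite divr_gt0.
  exists r => // y yn; rewrite subr0 => yr.
  by have := h y yn yr; lra.
have Oy : (eball 1 `\ 0) y0 by split => //; exact/eqP.
have uy := u_pos _ Oy.
exists (u y0 / 2); first by rewrite divr_gt0.
have /nbhs_enorm[r r0 h] : nbhs y0 (fun y => u y0 / 2 < u y).
  by apply: (cvgr_gt _ (u_continuous _ u_C2 _ Oy)); lra.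
by exists r => // y _; exact: h.
Qed.

(** * Strict inequality in balls and along rays *)

Definition pos_reflect l := forall x, cap l x -> mirror l x != 0 ->
  u x <= u (mirror l x).

Definition good_ball l q (r : R) := forall x, enorm (x - q) < r ->
  cap l x /\ mirror l x != 0.

Lemma good_ball_exists l q : cap l q -> mirror l q != 0 ->
  exists2 r : R, 0 < r <= 1 & good_ball l q r.
Proof.
move=> cq mq.
have h1 := near_cap _ _ cq.
have h2 : nbhs q (fun x => mirror l x != 0).
  have : open [set x : V | x != 0].
    have -> : [set x : V | x != 0] = [set x | 0 < enorm x].
      by apply/seteqP; split=> x /=; rewrite enorm_gt0.
    have := @open_comp _ _ (@enorm R n) [set y : R | 0 < y].
    by apply; [move=> ? _; exact: continuous_enorm|exact: open_gt].
  move=> o; exact: (@continuous_mirror R n l q _ (open_nbhs_nbhs (conj o mq))).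
have h3 : nbhs q (fun x => cap l x /\ mirror l x != 0) by exact: filterI h1 h2.
have [r r0 h] := (nbhs_enorm _ _).1 h3.
exists (Num.min r 1); first by rewrite lt_min r0 ltr01 ge_min lexx orbT.
by move=> x; rewrite lt_min => /andP[xr _]; exact: h.
Qed.

(** A strong maximum principle: by continuity the difference is at least [m] on a small ball about
    [q], and the barrier of [hopf] is then positive in the whole open ball. *)
Lemma propagate l q (r0 : R) : 0 < l -> pos_reflect l -> 0 < r0 <= 1 ->
  good_ball l q r0 -> u q < u (mirror l q) ->
  forall x, enorm (x - q) < r0 -> u x < u (mirror l x).
Proof.
move=> l0 pos /andP[r00 r01] gb wq x xq.
have qq : enorm (q - q) < r0 by rewrite subrr enorm0.
have [cq mq] := gb q qq.
pose w y := u (mirror l y) - u y; pose m := w q / 2.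
have wq0 : 0 < w q by rewrite subr_gt0.
have m0 : 0 < m by rewrite divr_gt0.
have wc : w y @[y --> q] --> w q.
  exact: (cvgB (u_mirror_continuous _ u_C2 _ _ l0 cq mq)
    (u_continuous _ u_C2 _ (cap_punctured _ _ l0 cq))).
have /nbhs_enorm[r1 r10 h1] : nbhs q (fun y => m < w y).
  by apply: (cvgr_gt _ wc); rewrite /m; lra.
pose r := Num.min r1 r0 / 2.
have mr : 0 < Num.min r1 r0 by rewrite lt_min r10.
have r_gt0 : 0 < r by rewrite divr_gt0.
have r_lt : r < Num.min r1 r0 by rewrite /r; lra.
move: (r_lt); rewrite lt_min => /andP[rr1 rr0].
have [c c0 Hc] := Hopf l r r0 m l0 r_gt0 rr0 r01 m0.
rewrite -subr_gt0; apply: lt_le_trans (Hc q gb _ _ x xq).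
- by rewrite mulr_gt0// subr_gt0 ltr_pXn2r ?nnegrE ?enorm_ge0// ltW.
- by move=> y yq; have [cy my] := gb y yq; exact: pos.
- move=> y yq; have := h1 y (le_lt_trans yq rr1); rewrite /w; lra.
Qed.

Lemma segment_pos l x (b : R) : 0 < l -> pos_reflect l -> 0 <= b ->
  (forall t, 0 <= t <= b -> cap l (x + t *: e0) /\ mirror l (x + t *: e0) != 0) ->
  u (x + b *: e0) < u (mirror l (x + b *: e0)) -> u x < u (mirror l x).
Proof.
move=> l0 pos b0 good ub.
suff : u (x + 0 *: e0) < u (mirror l (x + 0 *: e0)) by rewrite scale0r addr0.
apply: (interval_induct (fun t => u (x + t *: e0) < u (mirror l (x + t *: e0)))
  0 b b0) => // t tb.
have [ct mt] := good t tb.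
have [r /andP[r0 r1] gb] := good_ball_exists _ _ ct mt.
(* The ball of radius [2 * r / 3] about [x + s *: e0] lies in the good ball of radius [r] about
   [x + t *: e0], and it contains [x + s' *: e0]. *)
exists (r / 3); first by rewrite divr_gt0.
move=> s s' sb s'b st s't us.
have dist (a a' : R) : enorm (x + a *: e0 - (x + a' *: e0)) = `|a - a'|.
  by rewrite opprD addrACA subrr add0r -scalerBl enorm_te0.
have r01 : 0 < 2 * r / 3 <= 1 by apply/andP; split; lra.
apply: (propagate l (x + s *: e0) _ l0 pos r01 _ us).
  move=> y ys; apply: gb.
  have -> : y - (x + t *: e0) = (y - (x + s *: e0)) + (x + s *: e0 - (x + t *: e0)).
    by rewrite addrA subrK.
  by apply: le_lt_trans (ler_enormD _ _) _; rewrite dist; lra.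
rewrite dist; have -> : s' - s = (s' - t) - (s - t) by ring.
by apply: le_lt_trans (ler_normB _ _) _; lra.
Qed.

Lemma dist_mirror l l' x x' :
  enorm (mirror l' x' - mirror l x) <= enorm (x' - x) + 2 * `|l' - l|.
Proof.
have -> : mirror l' x' - mirror l x = hatv (x' - x) + (2 * (l' - l)) *: e0.
  apply/rowP => i; rewrite !mxE.
  by case: eqVneq => [->|i0] /=; rewrite ?mulr1 ?mulr0; ring.
apply: le_trans (ler_enormD _ _) _.
by rewrite enorm_hatv enorm_te0 normrM ger0_norm.
Qed.

(* When [mirror l x = 0] the value of [u] there is meaningless, and this says
   that [u x] is below the lower limit of [u] at the origin. *)
Definition strict_at l x := exists2 c : R, u x < c &
  exists2 r : R, 0 < r & forall y, y != 0 -> enorm (y - mirror l x) < r -> c < u y.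

(** Openness in the point and in the plane at once: rays use it to enter the ball from the sphere,
    and the compactness argument to move the plane. *)
Lemma near_strict l x : 0 < l -> enorm x <= 1 -> l < x 0 0 -> strict_at l x ->
  exists2 d : R, 0 < d & forall x' l', enorm (x' - x) < d -> `|l' - l| < d ->
    enorm x' <= 1 -> mirror l' x' != 0 -> u x' < u (mirror l' x').
Proof.
move=> l0 x1 lx [c uc [r r0 hr]].
have Dx : (ecball 1 `\ 0) x.
  by split => // x0; move: lx; rewrite x0 mxE => /(lt_trans l0); rewrite ltxx.
have cu : 0 < c - u x by rewrite subr_gt0.
have /nbhs_enorm[d1 d10 h1] :=
  within_continuous_near _ _ _ (C2_continuous _ u_C2) Dx _ cu.
have x0 : 0 < x 0 0 by exact: lt_trans lx.
have m0 : 0 < Num.min d1 (Num.min (r / 3) (x 0 0)).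
  by rewrite !lt_min d10 x0 divr_gt0.
exists (Num.min d1 (Num.min (r / 3) (x 0 0))) => // x' l'.
rewrite !lt_min => /and3P[a1 a2 a3] /and3P[_ b2 _] x'1 mx'.
apply: (@lt_trans _ _ c).
  have Dx' : (ecball 1 `\ 0) x'.
    split => // x'0; move: a3; rewrite x'0 sub0r enormN.
    by rewrite ltNge (le_trans (ler_norm _) (coord_le_enorm x 0)).
  have := h1 x' a1 Dx'; rewrite ltr_norml => /andP[_]; lra.
by apply: hr => //; apply: le_lt_trans (dist_mirror _ _ _ _) _; lra.
Qed.

Lemma strict_boundary l x : 0 < l -> enorm x = 1 -> l < x 0 0 -> strict_at l x.
Proof.
move=> l0 x1 lx.
have m1 : enorm (mirror l x) < 1 by rewrite -x1; exact: enorm_mirror_lt.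
have [c c0 h] := lower_positive _ m1.
by exists c; [rewrite u_bdry|].
Qed.

Lemma strict_interior l x : 0 < l -> cap l x -> mirror l x != 0 ->
  u x < u (mirror l x) -> strict_at l x.
Proof.
move=> l0 cx mx ux; exists ((u x + u (mirror l x)) / 2); first lra.
have Om : (eball 1 `\ 0) (mirror l x) by split; [exact: cap_mirror|exact/eqP].
have /nbhs_enorm[r r0 h] : nbhs (mirror l x) (fun y => (u x + u (mirror l x)) / 2 < u y).
  by apply: (cvgr_gt _ (u_continuous _ u_C2 _ Om)); lra.
by exists r => // y _; exact: h.
Qed.

(** The ray in the direction [e0] reaches the sphere, where the inequality is strict and remains so
    shortly before; [segment_pos] brings it back to [x]. *)
Lemma ray_pos l x : 0 < l -> pos_reflect l -> cap l x ->
  (forall t : R, 0 <= t -> cap l (x + t *: e0) -> mirror l (x + t *: e0) != 0) ->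
  u x < u (mirror l x).
Proof.
move=> l0 pos cx mt; have [x1 xl] := cx.
have x0 : 0 < x 0 0 by exact: lt_trans xl.
have xx : x 0 0 ^+ 2 <= enorm x ^+ 2 by rewrite enorm_sqr coord_le_edot.
have x12 : enorm x ^+ 2 < 1 by rewrite expr_lt1 ?enorm_ge0.
(* [Num.sqrt D] is the first coordinate of the point where the ray meets the sphere. *)
pose D := 1 - enorm x ^+ 2 + x 0 0 ^+ 2.
have D0 : 0 <= D by rewrite /D; have := sqr_ge0 (x 0 0); lra.
pose b := Num.sqrt D - x 0 0.
have sD : Num.sqrt D ^+ 2 = D by rewrite sqr_sqrtr.
have s0 : 0 <= Num.sqrt D by exact: sqrtr_ge0.
have b0 : 0 < b.
  by rewrite subr_gt0 -(@ltr_pXn2r _ 2)// ?nnegrE ?ltW// sD /D; lra.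
have nt (t : R) : enorm (x + t *: e0) ^+ 2 = enorm x ^+ 2 - x 0 0 ^+ 2 + (x 0 0 + t) ^+ 2.
  rewrite !enorm_sqr edotDl !edotDr !edotZl !edotZr (edotC e0) !edot_e0 e00.
  by ring.
have nb : enorm (x + b *: e0) = 1.
  apply: (@pexpIrn _ 2) => //; rewrite ?nnegrE ?enorm_ge0//.
  by rewrite nt /b addrCA subrr addr0 sD expr1n /D; ring.
have capt t : 0 <= t < b -> cap l (x + t *: e0).
  move=> /andP[t0 tb]; split; last by rewrite coord_te0; lra.
  rewrite -nb -(@ltr_pXn2r _ 2)// ?nnegrE ?enorm_ge0// !nt ltrD2l.
  by rewrite ltr_pXn2r ?nnegrE//; lra.
have lb : l < (x + b *: e0) 0 0 by rewrite coord_te0; lra.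
have nb1 : enorm (x + b *: e0) <= 1 by rewrite nb.
have [d d0 hd] := near_strict _ _ l0 nb1 lb (strict_boundary _ _ l0 nb lb).
pose t := Num.max 0 (b - d / 2).
have t0 : 0 <= t by rewrite le_max lexx.
have tb : t < b by rewrite gt_max b0; lra.
apply: (segment_pos l x t l0 pos t0).
  move=> s /andP[s_ge0 st].
  have cs : cap l (x + s *: e0) by apply: capt; rewrite s_ge0 (le_lt_trans st).
  by split => //; exact: mt.
apply: hd.
- rewrite opprD addrACA subrr add0r -scalerBl enorm_te0 distrC.
  rewrite ger0_norm ?subr_ge0 ?ltW// ltrBlDl -ltrBlDr lt_max.
  by apply/orP; right; lra.
- by rewrite subrr normr0.
- by apply/ltW; case: (capt t); rewrite ?t0.
- by apply: mt => //; apply: capt; rewrite t0.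
Qed.

(** * The reflection of the origin *)

Lemma mirror_eq0 l x : (mirror l x == 0) = (x == (2 * l) *: e0).
Proof.
apply/eqP/eqP => [h|->].
  rewrite -(mirrorK l x) h; apply/rowP => i; rewrite !mxE.
  by case: (i == 0); rewrite ?mulr1 ?mulr0 ?subr0.
apply/rowP => i; rewrite !mxE.
by case: (i == 0); rewrite /= ?mulr1 ?mulr0 ?subrr.
Qed.

Lemma mirror0 l : mirror l 0 = (2 * l) *: e0.
Proof. by apply/eqP; rewrite -mirror_eq0 mirrorK. Qed.

(* The tilt [T] serves the case of the line, where Hopf's lemma bounds the
   difference from one side only; otherwise [T = 0]. *)
Lemma singular_lower l (T : V) (c d : R) : 0 < l -> cap l ((2 * l) *: e0) ->
  0 < c -> 0 < d ->
  (forall y, y != 0 -> enorm y < d ->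
     c * enorm y <= u y - u (mirror l y) - edot T y) ->
  strict_at l ((2 * l) *: e0).
Proof.
move=> l0 cz c0 d0 hT.
set z := (2 * l) *: e0.
have Oz := cap_punctured _ _ l0 cz.
(* [G] is the gradient at [y = 0] of the function [u (mirror l y)]. *)
pose G := hatv (gradient u z).
have c20 : 0 < c / 2 by rewrite divr_gt0.
have [d1 d10 h1] := C2_frechet _ Oz _ c20.
have [rbar /andP[rb0 rb1] hs] := super_sphere.
pose r := Num.min rbar (Num.min d d1) / 2.
have m0 : 0 < Num.min rbar (Num.min d d1) by rewrite !lt_min rb0 d0.
have r0 : 0 < r by rewrite divr_gt0.
have : r < Num.min rbar (Num.min d d1) by rewrite /r; lra.
rewrite !lt_min => /and3P[rrb rd rd1].
have [|y yr hy] := hs (- (G + T)) r; first by rewrite r0.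
have y0 : y != 0 by rewrite -enorm_gt0 yr.
have yd : enorm y < d by rewrite yr.
have hTy := hT y y0 yd.
have vy : u z + edot G y - c / 2 * r <= u (mirror l y).
  have hy1 : enorm (hatv y) < d1 by rewrite enorm_hatv yr.
  have := h1 _ hy1; rewrite enorm_hatv yr ler_norml => /andP[+ _].
  have -> : z + hatv y = mirror l y by rewrite -[y in RHS]add0r mirrorD mirror0.
  by rewrite edot_hat; lra.
(* Half of the growth [c * r] on the sphere is lost to the Taylor remainder. The other half is
   [2 * k]: one [k] absorbs the linear term near the origin, the other is the strict gain over
   [u z]. *)
pose k := c * r / 4.
have k0 : 0 < k by rewrite divr_gt0// mulr_gt0.
have key x : x != 0 -> enorm x < r -> u z + 2 * k + edot (G + T) x <= u x.
  move=> x0 xr; have := hy x x0 xr; rewrite !edotNl !edotDl.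
  rewrite yr in hTy; rewrite /k; lra.
exists (u z + k); first by rewrite ltrDl.
have q0 : 0 < enorm (G + T) + 1 by have := enorm_ge0 (G + T); lra.
exists (Num.min r (k / (enorm (G + T) + 1))); first by rewrite lt_min r0 divr_gt0.
have -> : mirror l z = 0 by apply/eqP; rewrite mirror_eq0.
move=> x x0; rewrite subr0 lt_min => /andP[xr]; rewrite ltr_pdivlMr// => xk.
apply: lt_le_trans (key x x0 xr).
have := normr_edot_le (G + T) x; rewrite ler_norml => /andP[+ _].
have : enorm (G + T) * enorm x <= enorm x * (enorm (G + T) + 1).
  by rewrite mulrC ler_wpM2l ?enorm_ge0// lerDl.
lra.
Qed.

(** The ball of radius [d] centred at distance [d] from [z] in the direction [v] touches [z], and at
    [z + v] the barrier of [hopf] is linear in [enorm v], as [d ^+ 2 - (d - enorm v) ^+ 2 >= d *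
    enorm v]. The inner balls lie in an annulus about [z]; compactness of its part in [C], where
    strictness is already known, makes the constant independent of [v]. *)
Lemma singular_hopf l (C : set V) (d : R) : 0 < l -> pos_reflect l ->
  0 < d <= 1 -> closed C ->
  (forall x, enorm (x - (2 * l) *: e0) < 2 * d -> cap l x) ->
  (forall x, C x -> cap l x -> mirror l x != 0 -> u x < u (mirror l x)) ->
  exists2 c : R, 0 < c & forall v, v != 0 -> enorm v < d ->
    (forall x, enorm (x - ((2 * l) *: e0 + (d / enorm v) *: v)) <= d / 2 -> C x) ->
    c * enorm v <= u (mirror l ((2 * l) *: e0 + v)) - u ((2 * l) *: e0 + v).
Proof.
move=> l0 pos /andP[d0 d1] cC capz posC.
set z := (2 * l) *: e0.
pose w y := u (mirror l y) - u y.
pose K := [set x | d / 2 <= enorm (x - z)] `&`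
  ([set x | enorm (x - z) <= 3 * d / 2] `&` C).
have cK : compact K.
  apply: (@compact_ecball _ _ _ (enorm z + 3 * d / 2)) => [|y [_ [/= h _]]]; last first.
    by rewrite /ecball /=; apply: le_trans (ler_enorm_dist y z) _; rewrite lerD2l.
  apply: closedI.
    have := @preimage_closed _ _ (fun x => enorm (x - z)) [set t : R | d / 2 <= t].
    by apply; [move=> y _; exact: continuous_enormB|exact: closed_ge].
  apply: closedI => //.
  have := @preimage_closed _ _ (fun x => enorm (x - z)) [set t : R | t <= 3 * d / 2].
  by apply; [move=> y _; exact: continuous_enormB|exact: closed_le].
have Kgood x : K x -> cap l x /\ mirror l x != 0.
  move=> [/= h1 [/= h2 _]]; split; first by apply: capz; lra.
  by rewrite mirror_eq0 -subr_eq0 -enorm_gt0 -/z; lra.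
have fc : {within K, continuous w}.
  apply/subspace_continuousP => y Ky; apply: cvg_within_filter.
  have [cy my] := Kgood y Ky.
  exact: (cvgB (u_mirror_continuous _ u_C2 _ _ l0 cy my)
    (u_continuous _ u_C2 _ (cap_punctured _ _ l0 cy))).
have [m m0 hm] : exists2 m : R, 0 < m & forall x, K x -> m <= w x.
  have [[x0 Kx0]|K0] := pselect (K !=set0); last first.
    by exists 1 => // x Kx; exfalso; apply: K0; exists x.
  have [x1 /set_mem Kx1 hmin] := compact_EVT_min (ex_intro K x0 Kx0) cK fc.
  exists (w x1); last by move=> x Kx; apply: hmin; rewrite in_setE.
  have [c1 mm1] := Kgood x1 Kx1; rewrite subr_gt0; apply: posC => //.
  by case: Kx1 => _ [].
have d20 : 0 < d / 2 by rewrite divr_gt0.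
have d2d : d / 2 < d by lra.
have [c c0 Hc] := Hopf l (d / 2) d m l0 d20 d2d d1 m0.
exists (c * d); first by rewrite mulr_gt0.
move=> v v0 vd Cv.
have v_gt0 : 0 < enorm v by rewrite enorm_gt0.
set e := z + _ in Cv.
have ez : enorm (e - z) = d.
  rewrite /e addrAC subrr add0r enormZ ger0_norm; first by field; rewrite gt_eqF.
  by rewrite divr_ge0// ltW.
have near_e x : enorm (x - z) <= enorm (x - e) + d.
  by rewrite -ez; apply: le_trans (ler_enormD _ _); rewrite addrA subrK.
have far_e x : d <= enorm (x - e) + enorm (x - z).
  rewrite -ez -[x - e]opprB enormN; apply: le_trans (ler_enormD _ _).
  by rewrite addrA subrK.
have gb : good_ball l e d.
  move=> x xe; split; first by apply: capz; have := near_e x; lra.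
  by rewrite mirror_eq0 -subr_eq0 -enorm_gt0 -/z; have := far_e x; lra.
have ve : enorm (z + v - e) = d - enorm v.
  have -> : z + v - e = (1 - d / enorm v) *: v.
    by rewrite /e opprD addrACA subrr add0r scalerBl scale1r.
  rewrite enormZ ler0_norm; first by rewrite opprB mulrBl mul1r divfK ?gt_eqF.
  by rewrite subr_le0 ler_pdivlMr// mul1r ltW.
have := Hc e gb _ _ (z + v); rewrite ve => h.
have {}h : c * (d ^+ 2 - (d - enorm v) ^+ 2) <= w (z + v).
  apply: h; last by lra.
    by move=> x xe; have [cx mx] := gb x xe; exact: pos.
  move=> x xe; rewrite -lerBrDl; apply: hm; split; last split.
  - by have := far_e x; rewrite /=; lra.
  - by have := near_e x; rewrite /=; lra.
  - exact: Cv.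
apply: le_trans h; rewrite -mulrA ler_pM2l//; nra.
Qed.

Lemma interior_pos_offaxis l x : (0 < n)%N -> 0 < l -> pos_reflect l ->
  cap l x -> mirror l x != 0 -> u x < u (mirror l x).
Proof.
move=> n0 l0 pos cx mx.
have [ray|/existsNP[t /not_implyP[t0 /not_implyP[_ /negP/negPn]]]] :=
    pselect (forall t : R, 0 <= t -> cap l (x + t *: e0) -> mirror l (x + t *: e0) != 0).
  exact: ray_pos.
rewrite mirror_eq0 => /eqP xt.
pose j : 'I_n.+1 := lift ord0 (Ordinal n0).
have j0 : j != 0 by [].
have xj : x 0 j = 0.
  have := congr1 (fun v : V => v 0 j) xt; rewrite !mxE (negbTE j0) andbF !mulr0.
  by rewrite addr0.
have [r /andP[r0 r1] gb] := good_ball_exists _ _ cx mx.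
pose ej : V := delta_mx 0 j.
have nj (a : R) : enorm (a *: ej) = `|a|.
  rewrite enormZ /enorm /edot (bigD1 j)//= big1 => [|i ij].
    by rewrite mxE !eqxx mulr1 addr0 sqrtr1 mulr1.
  by rewrite mxE (negbTE ij) andbF mul0r.
(* Off the axis, the ray from [y] misses [z]; the ball of radius [2 * r / 3] about [y] contains [x]
   and stays in the good ball. *)
pose y := x + (r / 3) *: ej.
have r3 : 0 < r / 3 by rewrite divr_gt0.
have yx : enorm (y - x) = r / 3.
  by rewrite /y addrAC subrr add0r nj gtr0_norm.
have [cy my] : cap l y /\ mirror l y != 0 by apply: gb; rewrite yx; lra.
have uy : u y < u (mirror l y).
  apply: ray_pos => // s s0 _; rewrite mirror_eq0; apply/eqP => ys.
  have := congr1 (fun v : V => v 0 j) ys.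
  by rewrite /y !mxE (negbTE j0) andbF eqxx xj !mulr0 mulr1 addr0 add0r => ?; lra.
have r23 : 0 < 2 * r / 3 <= 1 by apply/andP; split; lra.
apply: (propagate l y _ l0 pos r23 _ uy); last by rewrite enormB yx; lra.
move=> v vy; apply: gb; have -> : v - x = (v - y) + (y - x) by rewrite addrA subrK.
by apply: le_lt_trans (ler_enormD _ _) _; rewrite yx; lra.
Qed.

Lemma singular_strict l : 0 < l -> pos_reflect l -> cap l ((2 * l) *: e0) ->
  strict_at l ((2 * l) *: e0).
Proof.
move=> l0 pos cz; set z := (2 * l) *: e0.
have /nbhs_enorm[r r0 hr] := near_cap _ _ cz.
pose d := Num.min (r / 2) 1.
have d01 : 0 < d <= 1 by rewrite lt_min divr_gt0//= ltr01 ge_min lexx orbT.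
have [d0 d1] := andP d01.
have dr : d <= r / 2 by rewrite ge_min lexx.
have capz x : enorm (x - z) < 2 * d -> cap l x by move=> xz; apply: hr; lra.
have zv v : z + hatv v = mirror l v by rewrite -[v in RHS]add0r mirrorD mirror0.
have hat0 v : (hatv v == 0) = (v == 0) by rewrite -!enorm_eq0 enorm_hatv.
have [n0|] := posnP n; last first.
  (* In dimension at least two strictness holds throughout the cap away from [z], so the touching
     balls may lie in every direction. *)
  move=> n0; have [|c c0 hc] := singular_hopf l setT d l0 pos d01 closedT capz.
    by move=> x _; exact: interior_pos_offaxis.
  apply: (singular_lower l 0 c d l0 cz c0 d0) => y y0 yd.
  have := hc (hatv y); rewrite hat0 enorm_hatv -/z zv mirrorK => /(_ y0 yd).
  by rewrite edot0l subr0; apply.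
have axis v : v = v 0 0 *: e0.
  apply/rowP => i; have -> : i = 0 by apply/val_inj; case: i => -[|k] //= ; rewrite n0.
  by rewrite !mxE !eqxx mulr1.
(* On the line, only from the points beyond [z] does the ray reach the sphere without meeting
   [z]. *)
pose C := [set x : V | 2 * l <= x 0 0].
have cC : closed C.
  have := @preimage_closed _ _ (fun x : V => x 0 0) [set t : R | 2 * l <= t].
  by apply; [move=> y _; exact: continuous_coord|exact: closed_ge].
have [|c c0 hc] := singular_hopf l C d l0 pos d01 cC capz.
  move=> x Cx cx mx; apply: ray_pos => // t t0 _; apply/negP.
  rewrite mirror_eq0 => /eqP xt; move: mx; rewrite mirror_eq0 => /eqP; apply.
  have := congr1 (fun v : V => v 0 0) xt; rewrite coord_te0 mxE e00 mulr1 => e.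
  have t_0 : t = 0 by move: Cx; rewrite /C /=; lra.
  by rewrite -xt t_0 scale0r addr0.
have c20 : 0 < c / 2 by rewrite divr_gt0.
(* Hopf's lemma gives the growth [c * enorm y] for [y 0 0 < 0], and [pos_reflect] only nonnegativity
   for [y 0 0 >= 0]; the tilt moves half of the growth from the first side to the second. *)
apply: (singular_lower l (- (c / 2) *: e0) (c / 2) d l0 cz c20 d0) => y y0 yd.
rewrite edotZl edotC edot_e0.
have ny : enorm y = `|y 0 0| by rewrite {1}(axis y) enorm_te0.
have my0 : mirror l (mirror l y) != 0 by rewrite mirrorK.
have cmy : cap l (mirror l y).
  by apply: capz; rewrite -zv addrAC subrr add0r enorm_hatv; lra.
have posy : u (mirror l y) <= u y by have := pos _ cmy my0; rewrite mirrorK.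
have [s0|s0] := leP 0 (y 0 0).
  by rewrite ny ger0_norm//; lra.
have := hc (hatv y); rewrite hat0 enorm_hatv -/z zv mirrorK => /(_ y0 yd) h.
have {}h : c * enorm y <= u y - u (mirror l y).
  apply: h => x; rewrite /C /=.
  have -> : (d / enorm y) *: hatv y = d *: e0.
    rewrite (axis (hatv y)) scalerA; congr (_ *: _).
    by rewrite mxE eqxx ny ltr0_norm//; field; rewrite lt_eqF.
  move=> h; have := le_trans (coord_le_enorm _ 0) h.
  rewrite !mxE !eqxx !mulr1 ler_norml => /andP[+ _]; lra.
by move: h; rewrite ny ltr0_norm//; lra.
Qed.

(** A ray that runs into [z] is followed only to a point just before it, where [singular_strict]
    gives the inequality at all nearby points. *)
Lemma interior_pos l x : 0 < l -> pos_reflect l ->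
  cap l x -> mirror l x != 0 -> u x < u (mirror l x).
Proof.
move=> l0 pos cx mx.
have [ray|/existsNP[t /not_implyP[t0 /not_implyP[ct /negP/negPn]]]] :=
    pselect (forall t : R, 0 <= t -> cap l (x + t *: e0) -> mirror l (x + t *: e0) != 0).
  exact: ray_pos.
rewrite mirror_eq0 => /eqP xt; rewrite xt in ct.
have t_gt0 : 0 < t.
  rewrite lt_neqAle t0 andbT; apply/eqP => t_0.
  by move: mx; rewrite mirror_eq0 -xt -t_0 scale0r addr0 eqxx.
have xE : x = (2 * l - t) *: e0 by rewrite scalerBl -xt addrK.
have [z1 zl] := ct.
have z00 : ((2 * l) *: e0) 0 0 = 2 * l by rewrite mxE e00 mulr1.
have [d d0 hd] := near_strict _ _ l0 (ltW z1) zl (singular_strict _ l0 pos ct).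
pose s := Num.min (d / 2) t.
have s0 : 0 < s by rewrite lt_min divr_gt0.
have sd : s < d.
  by apply: (@le_lt_trans _ _ (d / 2)); [rewrite ge_min lexx|lra].
have st : s <= t by rewrite ge_min lexx orbT.
have pt (a : R) : x + a *: e0 = (2 * l - t + a) *: e0 by rewrite scalerDl -xE.
have good a : 0 <= a <= t - s -> cap l (x + a *: e0) /\ mirror l (x + a *: e0) != 0.
  move=> /andP[a0 a1]; have [x1 xl] := cx; split; last first.
    rewrite mirror_eq0 pt; apply/eqP => /(congr1 (fun v : V => v 0 0)).
    by rewrite !mxE !eqxx !mulr1; lra.
  have x00 : x 0 0 = 2 * l - t by rewrite xE mxE e00 mulr1.
  split; last by rewrite coord_te0; lra.
  by move: z1; rewrite pt !enorm_te0 !ger0_norm; lra.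
have b0 : 0 <= t - s by rewrite subr_ge0.
have [cb mb] : cap l (x + (t - s) *: e0) /\ mirror l (x + (t - s) *: e0) != 0.
  by apply: good; rewrite b0 lexx.
apply: (segment_pos l x (t - s) l0 pos b0 good); apply: hd => //.
- rewrite pt -scalerBl enorm_te0.
  have -> : 2 * l - t + (t - s) - 2 * l = - s by ring.
  by rewrite normrN gtr0_norm.
- by rewrite subrr normr0.
- by case: cb => /ltW.
Qed.

(** * Moving the plane *)

Lemma strict_all l x : 0 < l -> pos_reflect l -> enorm x <= 1 -> l < x 0 0 ->
  strict_at l x.
Proof.
move=> l0 pos; rewrite le_eqVlt => /predU1P[x1|x1] xl.
  exact: strict_boundary.
have cx : cap l x by [].
have [/eqP mx|mx] := eqVneq (mirror l x) 0.
  rewrite mirror_eq0 in mx; rewrite (eqP mx) in cx *; exact: singular_strict.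
exact/strict_interior/interior_pos.
Qed.

(** Compactness of the closed ball: the hypothesis of [strip] is checked near each point for planes
    near [l], and finitely many neighbourhoods give one range of planes. *)
Lemma pos_reflect_near l : 0 < l ->
  (forall x, enorm x <= 1 -> l < x 0 0 -> strict_at l x) ->
  exists2 k : R, 0 < k & forall l', `|l' - l| < k -> l' < 1 -> pos_reflect l'.
Proof.
move=> l0 strictP.
have l20 : 0 < l / 2 by rewrite divr_gt0.
(* The strip constants are taken for [l / 2], so that they also serve planes slightly below [l]. *)
have [d [eta [d0 eta0 H]]] :=
  strip F u F_C1 F_elliptic F_reflect u_C2 u_eq u_pos u_bdry (l / 2) l20.
pose P l' x := enorm x <= 1 -> l' <= x 0 0 -> mirror l' x != 0 ->
  u x < u (mirror l' x) \/ x 0 0 < l' + d /\ `|u (mirror l' x) - u x| < eta.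
suff : \forall l' \near l, forall x, ecball 1 x -> P l' x.
  move=> /nbhs_ballP[k /= k0 Hk].
  exists (Num.min k (l / 2)); first by rewrite lt_min k0.
  move=> l'; rewrite lt_min => /andP[lk l2] l'1.
  apply: H => //; first by move: l2; rewrite ltr_norml => /andP[]; lra.
  by move=> x x1; apply: (Hk l') => //; rewrite /ball /= distrC.
have near_cov : near_covering (@ecball R n 1).
  apply/compact_near_coveringP; apply: (@compact_ecball _ _ _ 1) => //.
  exact: closed_ecball.
apply: (near_cov R (nbhs l) P) => x x1.
suff [k k0 Hk] : exists2 k : R, 0 < k & forall x' l', enorm (x' - x) < k ->
    `|l' - l| < k -> P l' x'.
  exists ([set x' | enorm (x' - x) < k], [set l' | `|l' - l| < k]) => /=.
    split; first by apply/nbhs_enorm; exists k.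
    by apply/nbhs_ballP; exists k => // l' /=; rewrite /ball /= distrC.
  by move=> [x' l'] /= [h1 h2]; exact: Hk.
(* Left of the plane the condition is void nearby; right of it strictness persists; on it [x] is its
   own reflection, and continuity of [u] gives the second alternative of [strip]. *)
have [xl|xl|xl] := ltgtP (x 0 0) l.
- exists ((l - x 0 0) / 2); first by rewrite divr_gt0// subr_gt0.
  move=> x' l' hx hl _ l'x; exfalso.
  have := coord_le_enorm (x' - x) 0; rewrite !mxE ler_norml => /andP[_ h].
  by move: hl; rewrite ltr_norml => /andP[]; lra.
- have [k k0 Hk] := near_strict _ _ l0 x1 xl (strictP x x1 xl).
  by exists k => // x' l' hx hl x'1 _ mx; left; exact: Hk.
- have Dx : (ecball 1 `\ 0) x.
    by split => // x0; move: xl l0; rewrite x0 mxE => <-; rewrite ltxx.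
  have eta20 : 0 < eta / 2 by rewrite divr_gt0.
  have /nbhs_enorm[k1 k10 Hk] :=
    within_continuous_near _ _ _ (C2_continuous _ u_C2) Dx _ eta20.
  pose k := Num.min (k1 / 3) (Num.min (d / 2) (l / 2)).
  have k0 : 0 < k by rewrite !lt_min !divr_gt0.
  exists k => // x' l'; rewrite !lt_min => /and3P[a1 a2 a3] /and3P[b1 b2 b3].
  move=> x'1 l'x mx'; right; split.
    have := coord_le_enorm (x' - x) 0; rewrite !mxE ler_norml => /andP[_ h].
    by move: b2; rewrite ltr_norml => /andP[]; lra.
  have l'0 : 0 < l' by move: b3; rewrite ltr_norml => /andP[]; lra.
  have Dx' : (ecball 1 `\ 0) x'.
    by split => // x'0; move: l'x; rewrite x'0 mxE leNgt l'0.
  have Dm : (ecball 1 `\ 0) (mirror l' x').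
    split; last exact/eqP.
    exact: le_trans (enorm_mirror_le _ _ l'0 l'x) x'1.
  have h1 : `|u x' - u x| < eta / 2 by apply: Hk => //; lra.
  have h2 : `|u (mirror l' x') - u x| < eta / 2.
    apply: Hk => //; rewrite -{1}(mirror_fix l x xl).
    by apply: le_lt_trans (dist_mirror _ _ _ _) _; lra.
  have -> : u (mirror l' x') - u x' = (u (mirror l' x') - u x) - (u x' - u x) by ring.
  by apply: le_lt_trans (ler_normB _ _) _; lra.
Qed.

Lemma pos_reflect_closed l : 0 < l -> l < 1 ->
  (forall l', l < l' -> l' < 1 -> pos_reflect l') -> pos_reflect l.
Proof.
move=> l0 l1 H x cx mx; rewrite leNgt; apply/negP => bad.
have [x1 xl] := cx.
have Om : (eball 1 `\ 0) (mirror l x) by split; [exact: cap_mirror|exact/eqP].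
have /nbhs_enorm[r r0 hr] : nbhs (mirror l x) (fun y => u y < u x).
  exact: (cvgr_lt _ (u_continuous _ u_C2 _ Om)).
(* The plane is pushed up by [k], small enough for [u] at the new reflection to stay below [u x],
   for [x] to stay in the cap, and for the reflection to avoid the origin. *)
pose k := Num.min (r / 3) (Num.min ((x 0 0 - l) / 2) (enorm (mirror l x) / 4)).
have mx_gt0 : 0 < enorm (mirror l x) by rewrite enorm_gt0.
have k0 : 0 < k by rewrite !lt_min !divr_gt0// subr_gt0.
have kr : k <= r / 3 by rewrite ge_min lexx.
have kx : k <= (x 0 0 - l) / 2 by rewrite !ge_min lexx orbT.
have km : k <= enorm (mirror l x) / 4 by rewrite !ge_min lexx !orbT.
have x01 := cap_coord _ _ cx.
have cx' : cap (l + k) x by split => //; lra.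
have dm : enorm (mirror (l + k) x - mirror l x) <= 2 * k.
  have := dist_mirror l (l + k) x x.
  by rewrite subrr enorm0 add0r addrAC subrr add0r gtr0_norm.
have mx' : mirror (l + k) x != 0.
  apply/eqP => e; move: dm; rewrite e sub0r enormN; lra.
have lk1 : l + k < 1 by lra.
have llk : l < l + k by lra.
have := H _ llk lk1 x cx' mx'; rewrite leNgt => /negP; apply.
by apply: hr; lra.
Qed.

Lemma pos_reflect_all l : 0 < l -> l < 1 -> pos_reflect l.
Proof.
pose S := [set l : R | 0 < l <= 1 /\ forall l', l <= l' -> l' < 1 -> pos_reflect l'].
have S1 : S 1.
  by split=> [|l']; [rewrite ltr01 lexx|move=> h1 /(le_lt_trans h1); rewrite ltxx].
have S0 : has_inf S by split; [exists 1|exists 0 => t [/andP[/ltW]]].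
pose s := inf S.
have s0 : 0 <= s by apply: lb_le_inf; [exists 1|move=> t [/andP[/ltW]]].
have s1 : s <= 1 by apply: ge_inf => //; case: S0.
have above l' : s < l' -> l' < 1 -> pos_reflect l'.
  move=> sl l'1; have ls0 : 0 < l' - s by rewrite subr_gt0.
  have [t [_ Ht] ts] := inf_adherent ls0 S0.
  by apply: Ht => //; apply: ltW; apply: lt_le_trans ts _; rewrite -/s addrCA subrr addr0.
suff s_0 : s = 0 by move=> l0 l1; apply: above => //; rewrite s_0.
apply/eqP; rewrite eq_le s0 andbT leNgt; apply/negP => s_gt0.
(* For [s = 1] there is no such [x], so the start of the motion is an instance of the general step;
   otherwise [s < x 0 0 <= 1] lets the inequality pass to the limit plane. *)
have strictP x : enorm x <= 1 -> s < x 0 0 -> strict_at s x.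
  move=> x1 sx; apply: strict_all => //; apply: pos_reflect_closed => //.
  apply: lt_le_trans sx _; apply: le_trans x1.
  by apply: le_trans (coord_le_enorm x 0); exact: ler_norm.
have [k k0 Hk] := pos_reflect_near _ s_gt0 strictP.
pose t := Num.max (s / 2) (s - k / 2).
have ts : t < s by rewrite gt_max; apply/andP; split; lra.
have t0 : 0 < t by rewrite lt_max divr_gt0.
have St : S t.
  split=> [|l' tl l'1]; first by rewrite t0 ltW// (lt_le_trans ts).
  have [sl|ls] := ltP s l'; first exact: above.
  apply: Hk => //; rewrite ler0_norm ?subr_le0// opprB.
  by move: tl; rewrite ge_max => /andP[]; lra.
have : s <= t by apply: ge_inf => //; case: S0.
by rewrite leNgt ts.
Qed.

(** With [l = x0 0 0] the ball centred at [x0 + r *: e0] touches the plane at [x0]. Hopf's lemma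
    bounds [u (x0 - t *: e0) - u (x0 + t *: e0)] below by a multiple of [t], and to first order this
    difference is [- 2 * t] times the derivative. *)
Lemma partial_lt0 x0 : enorm x0 < 1 -> 0 < x0 0 0 -> partial 0 u x0 < 0.
Proof.
move=> x1 l0; set l := x0 0 0 in l0 *.
have l1 : l < 1.
  by apply: le_lt_trans x1; apply: le_trans (coord_le_enorm x0 0); exact: ler_norm.
have pos := pos_reflect_all _ l0 l1.
(* Points of the ball are within [2 * r] of [x0]: the second bound keeps them in the unit ball, the
   first off the reflected origin, which is at distance at least [l] from [x0]. *)
pose r := Num.min (l / 2) ((1 - enorm x0) / 2).
have r0 : 0 < r by rewrite lt_min !divr_gt0// subr_gt0.
have rl : r <= l / 2 by rewrite ge_min lexx.
have rx : r <= (1 - enorm x0) / 2 by rewrite ge_min lexx orbT.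
have r1 : r <= 1 by lra.
pose e := x0 + r *: e0.
have ex : enorm (e - x0) = r by rewrite /e addrAC subrr add0r enorm_te0 gtr0_norm.
have gb : good_ball l e r.
  move=> x xe.
  have xx0 : enorm (x - x0) < 2 * r.
    have -> : x - x0 = (x - e) + (e - x0) by rewrite addrA subrK.
    by apply: le_lt_trans (ler_enormD _ _) _; lra.
  split; first split.
  - by apply: le_lt_trans (ler_enorm_dist x x0) _; lra.
  - have := le_lt_trans (coord_le_enorm (x - e) 0) xe.
    by rewrite !mxE !eqxx mulr1 -/l ltr_norml => /andP[]; lra.
  - rewrite mirror_eq0; apply/eqP => xz.
    have := le_lt_trans (coord_le_enorm (x - x0) 0) xx0.
    by rewrite xz !mxE !eqxx mulr1 -/l ltr_norml => /andP[]; lra.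
pose w y := u (mirror l y) - u y.
pose K := [set x | enorm (x - e) <= r / 2].
have Kb x : K x -> enorm (x - e) < r by rewrite /K /= => ?; lra.
have cK : compact K.
  apply: (@compact_ecball _ _ _ (enorm e + r)) => [|y Ky].
    have := @preimage_closed _ _ (fun x => enorm (x - e)) [set t : R | t <= r / 2].
    by apply; [move=> y _; exact: continuous_enormB|exact: closed_le].
  rewrite /ecball /=; apply: le_trans (ler_enorm_dist y e) _.
  by rewrite lerD2l ltW// Kb.
have fc : {within K, continuous w}.
  apply/subspace_continuousP => y Ky; apply: cvg_within_filter.
  have [cy my] := gb y (Kb y Ky).
  exact: (cvgB (u_mirror_continuous _ u_C2 _ _ l0 cy my)
    (u_continuous _ u_C2 _ (cap_punctured _ _ l0 cy))).
have Ke : K e by rewrite /K /= subrr enorm0 divr_ge0// ltW.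
have [x2 /set_mem Kx2 hmin] := compact_EVT_min (ex_intro K e Ke) cK fc.
have m0 : 0 < w x2.
  by have [cy my] := gb x2 (Kb x2 Kx2); rewrite subr_gt0; exact: interior_pos.
have r20 : 0 < r / 2 by rewrite divr_gt0.
have r2r : r / 2 < r by lra.
have [c c0 Hc] := Hopf l (r / 2) r (w x2) l0 r20 r2r r1 m0.
have key (t : R) : 0 < t < r -> c * r * t <= u (x0 + - t *: e0) - u (x0 + t *: e0).
  move=> /andP[t0 tr].
  have te : enorm (x0 + t *: e0 - e) = r - t.
    rewrite opprD addrACA subrr add0r -scalerBl enorm_te0 ltr0_norm ?subr_lt0//.
    by rewrite opprB.
  have := Hc e gb _ _ (x0 + t *: e0); rewrite te => h.
  have hm : mirror l (x0 + t *: e0) = x0 + - t *: e0.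
    rewrite mirrorD mirror_fix// hatvZ; congr (_ + _).
    apply/rowP => i; rewrite !mxE.
    by case: (i == 0); rewrite /= ?mulr1n ?mulr0n; ring.
  rewrite hm in h; apply: le_trans (h _ _ _); last by lra.
  - by rewrite -mulrA ler_pM2l//; nra.
  - by move=> x xe; have [cx mx] := gb x xe; exact: pos.
  - by move=> x xe; rewrite -lerBrDl; apply: hmin; rewrite in_setE.
have Ox : (eball 1 `\ 0) x0 by split => // x00; move: l0; rewrite /l x00 mxE ltxx.
(* Each of the two expansions errs by at most [c * r / 4 * t], so half of [c * r * t] survives. *)
have q0 : 0 < c * r / 4 by rewrite divr_gt0// mulr_gt0.
have [d d0 Hd] := C2_frechet _ Ox _ q0.
pose t := Num.min d r / 2.
have dr0 : 0 < Num.min d r by rewrite lt_min d0.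
have t0 : 0 < t by rewrite divr_gt0.
have : t < Num.min d r by rewrite /t; lra.
rewrite lt_min => /andP[td tr].
have h1 := key t (introT andP (conj t0 tr)).
have g0 : gradient u x0 0 0 = partial 0 u x0 by rewrite mxE.
have h2 := Hd (t *: e0); have h3 := Hd (- t *: e0).
rewrite !enorm_te0 !edotZr !edot_e0 ?normrN (gtr0_norm t0) g0 in h2 h3.
have {h2} := h2 td; rewrite ler_norml => /andP[h2 _].
have {h3} := h3 td; rewrite ler_norml => /andP[_ h3].
rewrite -(pmulr_rlt0 _ t0).
have : 0 < c * r * t by rewrite !mulr_gt0.
lra.
Qed.

End MovingPlanes.

Theorem theorem1p4 (R : realType) (n : nat)
    (F : 'rV[R]_n.+1 -> R -> 'rV[R]_n.+1 -> 'M[R]_n.+1 -> R)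
    (u : 'rV[R]_n.+1 -> R)
    (F_C1 : C1_on_jets F)
    (F_elliptic : forall (x : 'rV[R]_n.+1) (s : R) (p : 'rV[R]_n.+1)
        (M : 'M[R]_n.+1),
      (ecball 1 `\ 0) x -> symmx M -> posdefmx (dsym (F x s p) M))
    (F_reflect : forall (x : 'rV[R]_n.+1) (t : R),
      eball 1 x -> 0 < x 0 0 < 1 ->
      -1 < t <= x 0 0 -> 0 < x 0 0 + t -> set_x1 x t != 0 ->
      forall (s : R) (p : 'rV[R]_n.+1) (M : 'M[R]_n.+1), symmx M ->
      F x s p M <= F (set_x1 x t) s (hatv p) (hatmx M))
    (u_C2 : C2_on_punctured_cball u)
    (u_super : exists2 rbar : R, 0 < rbar <= 1 &
      forall (V : 'rV[R]_n.+1) (r : R), 0 < r < rbar ->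
      inf_eq_min (eball r `\ 0) (esphere r) (fun x => u x + edot V x))
    (u_eq : forall x : 'rV[R]_n.+1, (eball 1 `\ 0) x ->
      F x (u x) (gradient u x) (hessian u x) = 0)
    (u_pos : forall x : 'rV[R]_n.+1, (eball 1 `\ 0) x -> 0 < u x)
    (u_bdry : forall x : 'rV[R]_n.+1, esphere 1 x -> u x = 0) :
  forall x : 'rV[R]_n.+1, eball 1 x -> 0 < x 0 0 < 1 -> partial 0 u x < 0.
Proof.
move=> x x1 /andP[x0 _].
exact: (partial_lt0 F u F_C1 F_elliptic F_reflect u_C2 u_super u_eq u_pos u_bdry).
Qed.
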